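(* For integers $0\leq j\leq k$ and positive real numbers $a,b$ set $$\nu_{k,j}(a,b)=a^2(k-2j)^2+2b^2\big((2j+1)k-2j^2\big).$$ Then, for all positive real numbers $a,b$, the spectra of the Laplace--Beltrami operators (as multisets, eigenvalues counted with multiplicity) are $$\operatorname{Spec}(\mathrm{SU}(2),g_{(a,b,b)})=\bigcup_{k\geq0}\big\{\!\big\{\underbrace{\nu_{k,j}(a,b),\dots,\nu_{k,j}(a,b)}_{(k+1)\text{-times}}:0\leq j\leq k\big\}\!\big\},$$ $$\operatorname{Spec}(\mathrm{SO}(3),g_{(a,b,b)})=\bigcup_{k\geq0,\ k\text{ even}}\big\{\!\big\{\underbrace{\nu_{k,j}(a,b),\dots,\nu_{k,j}(a,b)}_{(k+1)\text{-times}}:0\leq j\leq k\big\}\!\big\},$$ where $k$ ranges over integers and the unions are unions of multisets in which multiplicities are added.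
   Context: In $\mathfrak{su}(2)$ set $X_1=\begin{pmatrix} i&0\\0&-i\end{pmatrix}$, $X_2=\begin{pmatrix}0&1\\-1&0\end{pmatrix}$, $X_3=\begin{pmatrix}0&i\\i&0\end{pmatrix}$. The group $\mathrm{SO}(3)$ is identified with $\mathrm{SU}(2)/\{\pm I_2\}$, so its Lie algebra is $\mathfrak{su}(2)$. For $G=\mathrm{SU}(2)$ or $\mathrm{SO}(3)$ and positive reals $a,b,c$, $g_{(a,b,c)}$ denotes the left-invariant Riemannian metric on $G$ whose inner product on $\mathfrak{su}(2)$ (the tangent space at the identity) has $\{aX_1,bX_2,cX_3\}$ as an orthonormal basis. The Laplace--Beltrami operator is taken with the sign convention making it non-negative. Double braces denote multisets. *)

(* Defs.v *)
From HB Require Import structures.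
From mathcomp Require Import all_boot all_order all_algebra.
From mathcomp Require Import generic_quotient complex.
From mathcomp Require Import all_classical all_reals all_analysis.
From mathcomp Require Import ring.

Set Implicit Arguments.
Unset Strict Implicit.
Unset Printing Implicit Defensive.

Import Order.TTheory GRing.Theory Num.Theory.
Import numFieldNormedType.Exports.

Local Open Scope classical_set_scope.
Local Open Scope complex_scope.
Local Open Scope ring_scope.

(* A multiset of real numbers is its multiplicity function, with values in
   {0, 1, 2, ...} and +oo. *)
Definition multiset (R : realType) := R -> \bar R.

Definition mrepeat (R : realType) (m : nat) (x : R) : multiset R :=
  fun y => if y == x then (m%:R)%:E else 0%E.

(* Multiplicities are added, so a union over an infinite I may produce +oo. *)
Definition munion (R : realType) (T : choiceType) (I : set T)
    (A : T -> multiset R) : multiset R :=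
  fun y => (\esum_(i in I) A i y)%E.

Section Smooth.
Variables (R : realType) (n : nat).

Definition partial (i : 'I_n) (F : 'rV[R]_n -> R) : 'rV[R]_n -> R :=
  fun x => 'D_(delta_mx 0 i) F x.

Definition iter_partial (s : seq 'I_n) (F : 'rV[R]_n -> R) : 'rV[R]_n -> R :=
  foldr partial F s.

Definition smooth (F : 'rV[R]_n -> R) : Prop :=
  forall s : seq 'I_n,
    continuous (iter_partial s F) /\
    forall (x : 'rV[R]_n) (i : 'I_n), derivable (iter_partial s F) x (delta_mx 0 i).

End Smooth.

(* A Riemannian manifold presented by an atlas of global parametrizations
   R^n -> M (the inverses of the charts) together with the Gram matrices of the
   metric in the coordinate frames. *)
Record riemannian_atlas (R : realType) (n : nat) := RiemannianAtlas {
  carrier :> Type;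
  chart : Type;
  param : chart -> 'rV[R]_n -> carrier;
  gram : chart -> 'rV[R]_n -> 'M[R]_n
}.

Section LaplaceBeltrami.
Variables (R : realType) (n : nat).

(* - |g|^(-1/2) d_i (|g|^(1/2) g^(ij) d_j F), the Laplace--Beltrami operator
   - div grad in coordinates *)
Definition laplace_coord (g : 'rV[R]_n -> 'M[R]_n) (F : 'rV[R]_n -> R)
    (x : 'rV[R]_n) : R :=
  - (Num.sqrt (\det (g x)))^-1 *
    \sum_(i < n) partial i (fun y =>
      \sum_(j < n) Num.sqrt (\det (g y)) * invmx (g y) i j * partial j F y) x.

Variable M : riemannian_atlas R n.

Definition smooth_on (f : M -> R) : Prop :=
  forall c : chart M, smooth (f \o param c).

Definition is_laplacian (f h : M -> R) : Prop :=
  forall (c : chart M) (x : 'rV[R]_n),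
    h (param c x) = laplace_coord (gram c) (f \o param c) x.

Definition eigenspace_LB (l : R) : set (M -> R) :=
  [set f | smooth_on f /\ is_laplacian f (fun p => l * f p)].

Definition lin_indep (m : nat) (v : 'I_m -> M -> R) : Prop :=
  forall c : 'I_m -> R,
    (forall p : M, \sum_(i < m) c i * v i p = 0) -> forall i, c i = 0.

Definition dim_fun (E : set (M -> R)) : \bar R :=
  ereal_sup [set d | exists (m : nat) (v : 'I_m -> M -> R),
    [/\ forall i, E (v i), lin_indep v & d = (m%:R)%:E]].

(* Functions are real-valued: the operator is real and symmetric, so passing to
   complex-valued functions changes neither eigenvalues nor multiplicities. *)
Definition Spec : multiset R := fun l => dim_fun (eigenspace_LB l).

End LaplaceBeltrami.

Section SU2.
Variable R : realType.
Notation C := R[i].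
Notation ii := (0 +i* 1 : C).

Definition mx2 (p q r s : C) : 'M[C]_2 :=
  \matrix_(i, j) if i == 0 then (if j == 0 then p else q)
                 else (if j == 0 then r else s).

Definition X1 : 'M[C]_2 := mx2 ii 0 0 (- ii).
Definition X2 : 'M[C]_2 := mx2 0 1 (- 1) 0.
Definition X3 : 'M[C]_2 := mx2 0 ii ii 0.

Definition su2X (i : 'I_3) : 'M[C]_2 := nth 0 [:: X1; X2; X3] i.

Definition su2_vec (u : 'rV[R]_3) : 'M[C]_2 :=
  \sum_(i < 3) (u 0 i)%:C *: su2X i.

Definition su2_coord (A : 'M[C]_2) : 'rV[R]_3 :=
  \row_(i < 3) nth 0 [:: complex.Im (A 0 0); complex.Re (A 0 1); complex.Im (A 0 1)] i.

(* The inner product on su(2) for which (a X1, b X2, c X3) is orthonormal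
   (see su2_ip_orthonormal). *)
Definition su2_ip (a b c : R) (A B : 'M[C]_2) : R :=
  \sum_(i < 3) (su2_coord A 0 i / nth 0 [:: a; b; c] i) *
               (su2_coord B 0 i / nth 0 [:: a; b; c] i).

Lemma su2_vecE (u : 'rV[R]_3) :
  su2_vec u = mx2 (0 +i* u 0 0) (u 0 1 +i* u 0 (inord 2))
                  (- u 0 1 +i* u 0 (inord 2)) (0 +i* - u 0 0).
Proof.
have -> : inord 2 = lift ord0 (lift ord0 ord0) :> 'I_3.
  by apply: val_inj; rewrite /= inordK.
have -> : 1 = lift ord0 ord0 :> 'I_3 by apply: val_inj.
apply/matrixP => i j; rewrite /su2_vec !big_ord_recl big_ord0 /su2X /= !mxE.
by case: (i == 0); case: (j == 0); simpc.
Qed.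

Lemma su2_vecK : cancel su2_vec su2_coord.
Proof.
move=> u; rewrite su2_vecE; apply/rowP => -[[|[|[|//]]] i3]; rewrite !mxE /=;
  congr (u _ _); apply: val_inj => //=; by rewrite inordK.
Qed.

Lemma su2_ip_orthonormal (a b c : R) (i j : 'I_3) : 0 < a -> 0 < b -> 0 < c ->
  let e (k : 'I_3) := (nth 0 [:: a; b; c] k)%:C *: su2X k in
  su2_ip a b c (e i) (e j) = (i == j)%:R.
Proof.
move=> a0 b0 c0 e.
have eE k : e k = su2_vec (nth 0 [:: a; b; c] k *: delta_mx 0 k).
  rewrite /su2_vec (bigD1 k)//= !mxE !eqxx mulr1 big1 ?addr0// => l lk.
  by rewrite !mxE (negbTE lk) andbF mulr0 scale0r.
rewrite /su2_ip !eE !su2_vecK (bigD1 i)//= big1 => [|l li]; last first.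
  by rewrite !mxE (negbTE li) andbF mulr0 !mul0r.
have nz : nth 0 [:: a; b; c] i != 0.
  by case: i => -[|[|[|//]]] ? /=; rewrite lt0r_neq0.
rewrite addr0 !mxE !eqxx mulr1 divff// mul1r.
rewrite /=; case: (eqVneq i j) => [<-|_]; first by rewrite mulr1 divff.
by rewrite mulr0 mul0r.
Qed.


Definition SU2_pred (U : 'M[C]_2) : bool := (U \is unitarymx) && (\det U == 1).

Record SU2 := MkSU2 { SU2_val :> 'M[C]_2; SU2_valP : SU2_pred SU2_val }.
HB.instance Definition _ := [isSub for SU2_val].
HB.instance Definition _ := [Choice of SU2 by <:].

Lemma SU2_mulP (p q : SU2) : SU2_pred (p *m q).
Proof.
case: p q => [p /andP[pu /eqP pd]] [q /andP[qu /eqP qd]] /=.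
by rewrite /SU2_pred mul_unitarymx// det_mulmx pd qd mulr1 eqxx.
Qed.
Definition SU2_mul (p q : SU2) : SU2 := MkSU2 (SU2_mulP p q).

(* (I + x1 X1 + x2 X2 + x3 X3) / |...| : the inverse of the central projection
   of the open hemisphere centred at I of SU(2) = S^3 onto R^3. *)
Definition SU2_cap_mx (x : 'rV[R]_3) : 'M[C]_2 :=
  (Num.sqrt (1 + \sum_(i < 3) x 0 i ^+ 2))^-1%:C *: (1%:M + su2_vec x).

Lemma SU2_capP (x : 'rV[R]_3) : SU2_pred (SU2_cap_mx x).
Proof.
rewrite /SU2_pred /SU2_cap_mx su2_vecE.
set N := 1 + _; set s := (Num.sqrt N)^-1.
set x2 := x 0 (inord 2).
have NE : N = 1 + x 0 0 ^+ 2 + x 0 1 ^+ 2 + x2 ^+ 2.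
  rewrite /N !big_ord_recl big_ord0 addr0 !addrA.
  congr (_ + x 0 _ ^+ 2 + x 0 _ ^+ 2 + x 0 _ ^+ 2); apply: val_inj => //=.
  by rewrite inordK.
have N0 : 0 < N by rewrite NE -!addrA ltr_wpDr// !addr_ge0// sqr_ge0.
have sN : s ^+ 2 * N = 1.
  by rewrite exprVn sqr_sqrtr ?(ltW N0)// mulVf// lt0r_neq0.
have sE : s ^+ 2 * (1 + x 0 0 ^+ 2 + x 0 1 ^+ 2 + x2 ^+ 2) = 1 by rewrite -NE.
apply/andP; split.
  apply/unitarymxP/matrixP => i j; rewrite !mxE !big_ord_recl big_ord0 !mxE.
  rewrite /= addr0.
  case: i => -[|[|//]] i2; case: j => -[|[|//]] j2; rewrite /=; simpc;
    apply/eqP; rewrite eq_complex /=; apply/andP; split; apply/eqP;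
    by [ring | rewrite -sE; ring].
rewrite (expand_det_row _ ord0) !big_ord_recl big_ord0 /cofactor !det_mx11 !mxE.
rewrite /= addr0 expr0 expr1; simpc.
rewrite eq_complex /=; apply/andP; split; apply/eqP;
  by [ring | rewrite -sE; ring].
Qed.
Definition SU2_cap (x : 'rV[R]_3) : SU2 := MkSU2 (SU2_capP x).

Definition SU2_param (p : SU2) (x : 'rV[R]_3) : SU2 := SU2_mul p (SU2_cap x).

(* The i-th coordinate tangent vector, as an element of 'M[C]_2. *)
Definition SU2_tangent (p : SU2) (i : 'I_3) (x : 'rV[R]_3) : 'M[C]_2 :=
  \matrix_(r, s) (partial i (fun y => complex.Re (SU2_param p y r s)) x +i*
                  partial i (fun y => complex.Im (SU2_param p y r s)) x).

(* Left-invariance: a tangent vector V at U is moved to su(2) as U^-1 V. *)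
Definition SU2_gram (a b c : R) (p : SU2) (x : 'rV[R]_3) : 'M[R]_3 :=
  \matrix_(i, j)
    su2_ip a b c (invmx (SU2_param p x) *m SU2_tangent p i x)
                 (invmx (SU2_param p x) *m SU2_tangent p j x).

Definition SU2_metric (a b c : R) : riemannian_atlas R 3 :=
  RiemannianAtlas SU2_param (SU2_gram a b c).

Definition pm_eq (p q : SU2) : bool :=
  (val p == val q) || (val p == - val q).

Lemma pm_eq_refl : reflexive pm_eq.
Proof. by move=> p; rewrite /pm_eq eqxx. Qed.
Lemma pm_eq_sym : symmetric pm_eq.
Proof. by move=> p q; rewrite /pm_eq eq_sym -eqr_oppLR [- _ == _]eq_sym. Qed.
Lemma pm_eq_trans : transitive pm_eq.
Proof.
move=> q p r; rewrite /pm_eq => /orP[]/eqP-> /orP[]/eqP->;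
  by rewrite ?opprK eqxx ?orbT.
Qed.
Canonical pm_eq_equiv := EquivRel pm_eq pm_eq_refl pm_eq_sym pm_eq_trans.

Definition SO3 := {eq_quot pm_eq}%qT.

(* The projection SU(2) -> SO(3) is a local isometry and each hemisphere above
   contains no two antipodal points (see SO3_param_inj), so the same
   parametrizations and Gram matrices present the metric on SO(3). *)
Definition SO3_param (p : SU2) (x : 'rV[R]_3) : SO3 := (\pi_SO3 (SU2_param p x))%qT.

Lemma SO3_param_inj (p : SU2) : injective (SO3_param p).
Proof.
move=> x y /eqmodP /=; rewrite /pm_eq /= => E.
have pU : (p : 'M[C]_2) \in unitmx.
  by rewrite unitmxE; case/andP: (SU2_valP p) => _ /eqP ->; exact: unitr1.
have {E} : SU2_cap_mx x = SU2_cap_mx y \/ SU2_cap_mx x = - SU2_cap_mx y.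
  by case/orP: E => /eqP E; [left|right]; apply: (can_inj (mulKmx pU));
    rewrite ?mulmxN.
have sP z : 0 < (Num.sqrt (1 + \sum_(i < 3) (z : 'rV[R]_3) 0 i ^+ 2))^-1.
  rewrite invr_gt0 sqrtr_gt0 ltr_wpDr// sumr_ge0// => i _; exact: sqr_ge0.
have := (sP x, sP y); rewrite /SU2_cap_mx.
set s := (Num.sqrt _)^-1; set t := (Num.sqrt _)^-1 => -[s0 t0].
have re (r : R) z : complex.Re ((r%:C *: (1%:M + su2_vec z)) 0 0) = r.
  by rewrite su2_vecE !mxE /=; simpc.
have co (r : R) z : su2_coord (r%:C *: (1%:M + su2_vec z)) = r *: z.
  rewrite -[in RHS](su2_vecK z) su2_vecE; apply/rowP => -[[|[|[|//]]] i3];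
    by rewrite !mxE /=; simpc.
case=> E.
  have st : s = t by have := re s x; rewrite E => <-; exact: re.
  move: (co s x); rewrite E co -st => /scalerI -> //; exact: lt0r_neq0.
have : s = - t.
  by have := re s x; rewrite E => <-; rewrite mxE raddfN; congr (- _); exact: re.
by move=> st; move: s0; rewrite st oppr_gt0 ltNge (ltW t0).
Qed.

Definition SO3_metric (a b c : R) : riemannian_atlas R 3 :=
  RiemannianAtlas SO3_param (SU2_gram a b c).

End SU2.

Definition nu (R : realType) (a b : R) (k j : nat) : R :=
  a ^+ 2 * (k%:R - 2 * j%:R) ^+ 2 +
  2 * b ^+ 2 * ((2 * j%:R + 1) * k%:R - 2 * j%:R ^+ 2).

(* Main.v *)
Require Import Defs.
From HB Require Import structures.
From mathcomp Require Import all_boot all_order all_algebra.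
From mathcomp Require Import generic_quotient complex.
From mathcomp Require Import all_classical all_reals all_analysis.
From mathcomp Require Import ring lra zify.

Set Implicit Arguments.
Unset Strict Implicit.
Unset Printing Implicit Defensive.

Import Order.TTheory GRing.Theory Num.Theory.
Import numFieldNormedType.Exports.
Local Open Scope classical_set_scope.
Local Open Scope complex_scope.
Local Open Scope ring_scope.

(** The left-invariant frame (a X_1, b X_2, b X_3) is orthonormal and, SU(2)
    being unimodular, divergence free. Hence in every chart the Laplace--Beltrami
    operator is - (a^2 X_1^2 + b^2 X_2^2 + b^2 X_3^2) (laplace_coordE).

    Eigenfunctions. A left-invariant field differentiates U to U X_k, so it acts
    on the two linear forms u = U00 X + U10 and v = U01 X + U11 as on the standard
    representation, and on u^p v^q as on the symmetric power of degree p + q.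
    There X_1 is diagonal with eigenvalue i (p - q), and X_2^2 + X_3^2 is diagonal
    with eigenvalue - (4pq + 2p + 2q). With k = p + q and j = q, the k + 1
    coefficients of u^p v^q are therefore eigenfunctions of eigenvalue nu k j
    (LapC_mcoef). They are linearly independent (mcoef_indep), and as many real
    functions can be extracted from their real and imaginary parts (real_family).

    No other eigenfunctions. The span of these matrix coefficients is an algebra
    stable under conjugation (cspanM, cspan_conj), so it is uniformly dense
    (scont_qapprox). The usual L^2 argument then needs an integral. It is obtained
    from the maximum principle: f has mean t when f - t is a uniform limit of
    Laplacians (has_mean). This mean is positive, invariant under left
    translations, and faithful on nonnegative continuous functions
    (mean_faithful). Green's formula holds on the span (Lap_symmetric) and passes
    to an arbitrary smooth eigenfunction through the resolvent of the Laplacian,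
    which is contracting for the uniform norm (eigenval_orthogonal). So an
    eigenfunction of eigenvalue l is orthogonal to every matrix coefficient of
    another eigenvalue; if there were more independent ones than matrix
    coefficients of eigenvalue l, a combination of them would be orthogonal to the
    whole span, hence zero (dim_le).

    Functions on SO(3) are the even functions on SU(2), and the coefficients of
    u^p v^q have the parity of p + q, so only even k occur for SO(3). *)

Local Notation i0 := (@Ordinal 3 0 isT).
Local Notation i1 := (@Ordinal 3 1 isT).
Local Notation i2 := (@Ordinal 3 2 isT).

Lemma sum3 (V : nmodType) (F : 'I_3 -> V) : \sum_(i < 3) F i = F i0 + F i1 + F i2.
Proof.
rewrite !big_ord_recl big_ord0 addr0 !addrA.
by congr (F _ + F _ + F _); apply: val_inj.
Qed.

Lemma ord3P (P : 'I_3 -> Prop) : P i0 -> P i1 -> P i2 -> forall i, P i.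
Proof.
move=> P0 P1 P2 [[|[|[|//]]] h].
- by rewrite (_ : Ordinal h = i0)//; apply: val_inj.
- by rewrite (_ : Ordinal h = i1)//; apply: val_inj.
- by rewrite (_ : Ordinal h = i2)//; apply: val_inj.
Qed.

(** * Directional derivatives along a line *)

Section line_restriction.
Variable R : realType.

Lemma is_derive_lineP (V : normedModType R) (f : V -> R) (x v : V) (t df : R) :
  is_derive t 1 (fun t : R => f (t *: v + x)) df <-> is_derive (t *: v + x) v f df.
Proof.
have E : (fun h : R => h^-1 *: (((fun t => f (t *: v + x)) \o shift t) (h *: (1 : R)) -
    f (t *: v + x))) = (fun h => h^-1 *: ((f \o shift (t *: v + x)) (h *: v) - f (t *: v + x))).
  apply/funext => h /=.
  rewrite addrA -scalerDl; congr (_ *: (f ((_ + _) *: _ + _) - _)).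
  by rewrite /GRing.scale /= mulr1.
split=> -[d1 d2]; split.
- by move: d1; rewrite /derivable E.
- by move: d2; rewrite /derive E.
- by move: d1; rewrite /derivable E.
- by move: d2; rewrite /derive E.
Qed.

Lemma is_derive_line0 (V : normedModType R) (f : V -> R) (x v : V) (df : R) :
  is_derive (0 : R) 1 (fun t : R => f (t *: v + x)) df -> is_derive x v f df.
Proof. by move=> /is_derive_lineP; rewrite scale0r add0r. Qed.
End line_restriction.

(** * Functions rational in the chart coordinates and the conformal factor *)

Section chart_calculus.
Variable R : realType.
Local Notation V := 'rV[R]_3.

(** In the chart around any centre, the entries of the matrix are affine
    functions of x times s(x) = (1 + |x|^2)^(-1/2), the symbol EScal. Since
    d_i s = - x_i s^3, the functions built from constants, coordinates and s
    are closed under differentiation, which makes smoothness and every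
    derivative below a computation on syntax. *)
Inductive chart_expr :=
| EConst of R | EVar of 'I_3 | EScal
| EAdd of chart_expr & chart_expr | EMul of chart_expr & chart_expr.

Definition scal (x : V) : R := (Num.sqrt (1 + \sum_(i < 3) x 0 i ^+ 2))^-1.

Fixpoint chart_eval (e : chart_expr) (x : V) : R :=
  match e with
  | EConst c => c
  | EVar i => x 0 i
  | EScal => scal x
  | EAdd e f => chart_eval e x + chart_eval f x
  | EMul e f => chart_eval e x * chart_eval f x
  end.

Fixpoint chart_diff (i : 'I_3) (e : chart_expr) : chart_expr :=
  match e with
  | EConst c => EConst 0
  | EVar j => EConst (i == j)%:R
  | EScal => EMul (EConst (-1)) (EMul (EVar i) (EMul EScal (EMul EScal EScal)))
  | EAdd e f => EAdd (chart_diff i e) (chart_diff i f)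
  | EMul e f => EAdd (EMul (chart_diff i e) f) (EMul e (chart_diff i f))
  end.

Lemma rad_gt0 (x : V) : 0 < 1 + \sum_(i < 3) x 0 i ^+ 2.
Proof. by rewrite ltr_wpDr// sumr_ge0// => i _; exact: sqr_ge0. Qed.

Lemma scal_gt0 x : 0 < scal x.
Proof. by rewrite invr_gt0 sqrtr_gt0 rad_gt0. Qed.

Lemma scalE x : scal x ^+ 2 * (1 + x 0 i0 ^+ 2 + x 0 i1 ^+ 2 + x 0 i2 ^+ 2) = 1.
Proof.
have -> : 1 + x 0 i0 ^+ 2 + x 0 i1 ^+ 2 + x 0 i2 ^+ 2 = 1 + \sum_(i < 3) x 0 i ^+ 2.
  by rewrite sum3 !addrA.
by rewrite exprVn sqr_sqrtr ?(ltW (rad_gt0 x))// mulVf// gt_eqF// rad_gt0.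
Qed.

Lemma is_derive_affine (a b t : R) : is_derive t 1 (fun t : R => t * a + b) a.
Proof.
rewrite (_ : (fun _ => _) = (a \*: id) + cst b); last first.
  by apply/funext => u /=; rewrite !fctE /= /GRing.scale /= mulrC.
by apply: is_derive_eq; rewrite addr0 /GRing.scale /= mulr1.
Qed.

Lemma is_derive_coord (j : 'I_3) (x v : V) : is_derive x v (fun y : V => y 0 j) (v 0 j).
Proof.
apply: is_derive_line0.
rewrite (_ : (fun _ => _) = (fun t : R => t * v 0 j + x 0 j)); last first.
  by apply/funext => t; rewrite !mxE.
exact: is_derive_affine.
Qed.

Lemma is_derive_scal (x v : V) :
  is_derive x v scal (- ((\sum_(j < 3) x 0 j * v 0 j) * scal x ^+ 3)).
Proof.
apply: is_derive_line0.
pose N (t : R) := 1 + \sum_(j < 3) (t * v 0 j + x 0 j) ^+ 2.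
have -> : (fun t : R => scal (t *: v + x)) = (fun t => (Num.sqrt (N t))^-1).
  apply/funext => t; rewrite /scal /N; congr (Num.sqrt (_ + _))^-1.
  by apply: eq_bigr => j _; rewrite !mxE.
have N0 : N 0 = 1 + \sum_(j < 3) x 0 j ^+ 2.
  by rewrite /N; congr (_ + _); apply: eq_bigr => j _; rewrite mul0r add0r.
have Npos : 0 < N 0 by rewrite N0 rad_gt0.
have dN : is_derive (0 : R) 1 N (2 * \sum_(j < 3) x 0 j * v 0 j).
  rewrite (_ : N = cst 1 + \sum_(j < 3) (fun t : R => t * v 0 j + x 0 j) ^+ 2); last first.
    apply/funext => t; rewrite /N fctE /=; congr (_ + _).
    by rewrite fct_sumE; apply: eq_bigr => j _; rewrite fctE.
  have dj j := is_derive_affine (v 0 j) (x 0 j) 0.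
  apply: is_derive_eq; rewrite add0r mulr_sumr; apply: eq_bigr => j _.
  by rewrite /GRing.scale /= mul0r add0r expr1 mulrA.
have dS := is_derive1_comp (is_derive1_sqrt Npos) dN.
have sn0 : (Num.sqrt \o N) 0 != 0 by rewrite /= gt_eqF// sqrtr_gt0.
apply: (is_derive_eq (is_deriveV sn0 dS)).
rewrite /= /scal -N0 /GRing.scale /=.
have : Num.sqrt (N 0) != 0 by rewrite gt_eqF// sqrtr_gt0.
by move: (Num.sqrt _) => q q0; field.
Qed.

Lemma is_derive_chart_eval (e : chart_expr) (x : V) i :
  is_derive x (delta_mx 0 i) (chart_eval e) (chart_eval (chart_diff i e) x).
Proof.
elim: e => [c|j||e He f Hf|e He f Hf] /=.
- exact: is_derive_cst.
- apply: (is_derive_eq (is_derive_coord _ _ _)).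
  by rewrite mxE eqxx /= eq_sym.
- apply: (is_derive_eq (is_derive_scal _ _)).
  rewrite (bigD1 i)//= big1 ?addr0 => [|j ji].
    by rewrite mxE !eqxx mulr1; ring.
  by rewrite mxE (negbTE ji) andbF mulr0.
- exact: is_deriveD.
- apply: (is_derive_eq (is_deriveM He Hf)).
  by rewrite /GRing.scale /= addrC; congr (_ + _); rewrite mulrC.
Qed.

Lemma scal_continuous : continuous scal.
Proof.
suff H (x : V) : {for x, continuous scal} by exact: H.
have cN : {for x, continuous (fun y : V => 1 + \sum_(i < 3) y 0 i ^+ 2)}.
  apply: (@continuousD _ _ _ (cst (1 : R)) (fun y : V => \sum_(i < 3) y 0 i ^+ 2)).
    exact: cst_continuous.
  have -> : (fun y : V => \sum_(i < 3) y 0 i ^+ 2) =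
      ((fun y => y 0 i0) * (fun y => y 0 i0) + (fun y => y 0 i1) * (fun y => y 0 i1) +
      (fun y => y 0 i2) * (fun y => y 0 i2)).
    by apply/funext => y; rewrite sum3.
  by do !apply: continuousD; apply: continuousM; exact: coord_continuous.
apply: (@continuousV _ _ (fun y : V => Num.sqrt (1 + \sum_(i < 3) y 0 i ^+ 2))).
  by rewrite gt_eqF// sqrtr_gt0 rad_gt0.
by apply: (continuous_comp cN); exact: sqrt_continuous.
Qed.

Lemma chart_eval_continuous e : continuous (chart_eval e).
Proof.
elim: e => [c|j||e He f Hf|e He f Hf] x.
- exact: cst_continuous.
- exact: coord_continuous.
- exact: scal_continuous.
- by apply: (@continuousD _ _ _ (chart_eval e) (chart_eval f)); [exact: He|exact: Hf].
- by apply: (@continuousM _ _ (chart_eval e) (chart_eval f)); [exact: He|exact: Hf].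
Qed.

Lemma partial_chart_eval i e : partial i (chart_eval e) = chart_eval (chart_diff i e).
Proof. by apply/funext => x; rewrite /partial; have := is_derive_chart_eval e x i => -[]. Qed.

Lemma smooth_chart_eval e : smooth (chart_eval e).
Proof.
have E s : iter_partial s (chart_eval e) = chart_eval (foldr chart_diff e s).
  by elim: s => //= i s ->; rewrite partial_chart_eval.
move=> s; split; first by rewrite E; exact: chart_eval_continuous.
by move=> x i; rewrite E; case: (is_derive_chart_eval (foldr chart_diff e s) x i).
Qed.

End chart_calculus.

Lemma sum2 (V : nmodType) (F : 'I_2 -> V) : \sum_(i < 2) F i = F 0 + F 1.
Proof. by rewrite !big_ord_recl big_ord0 addr0; congr (F _ + F _); apply: val_inj. Qed.

Lemma ord2P (P : 'I_2 -> Prop) : P 0 -> P 1 -> forall i, P i.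
Proof.
move=> P0 P1 [[|[|//]] h].
- by rewrite (_ : Ordinal h = 0)//; apply: val_inj.
- by rewrite (_ : Ordinal h = 1)//; apply: val_inj.
Qed.

(** * The coordinate frame of a chart, read in su(2) *)

Section su2_charts.
Variable R : realType.
Local Notation V := 'rV[R]_3.
Local Notation C := R[i].
Local Notation "''v0'" := (EVar R i0).
Local Notation "''v1'" := (EVar R i1).
Local Notation "''v2'" := (EVar R i2).
Local Notation opp e := (EMul (EConst (-1)) e).

Definition cap_re (l t : 'I_2) : chart_expr R :=
  EMul (EScal R) (if l == 0 then if t == 0 then EConst 1 else 'v1
               else if t == 0 then opp 'v1 else EConst 1).
Definition cap_im (l t : 'I_2) : chart_expr R :=
  EMul (EScal R) (if l == 0 then if t == 0 then 'v0 else 'v2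
               else if t == 0 then 'v2 else opp 'v0).

Lemma row3E (x : V) : (x 0 0 = x 0 i0) * (x 0 1 = x 0 i1) * (x 0 (inord 2) = x 0 i2).
Proof. by do 2?split; congr (x _ _); apply: val_inj => //=; rewrite inordK. Qed.

Lemma eq_complexP (z w : C) : complex.Re z = complex.Re w -> complex.Im z = complex.Im w -> z = w.
Proof. by case: z => a b; case: w => c d /= -> ->. Qed.

Lemma cap_mxE (x : V) l t : SU2_cap_mx x l t = chart_eval (cap_re l t) x +i* chart_eval (cap_im l t) x.
Proof.
rewrite /SU2_cap_mx su2_vecE !row3E -/(scal x) !mxE /cap_re /cap_im.
move: l t; apply: ord2P; apply: ord2P; rewrite /=; simpc; apply: eq_complexP => /=; ring.
Qed.

Definition ent_re (p : 'M[C]_2) (r t : 'I_2) : chart_expr R :=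
  EAdd (EAdd (EMul (EConst (complex.Re (p r 0))) (cap_re 0 t)) (EMul (EConst (- complex.Im (p r 0))) (cap_im 0 t)))
      (EAdd (EMul (EConst (complex.Re (p r 1))) (cap_re 1 t)) (EMul (EConst (- complex.Im (p r 1))) (cap_im 1 t))).
Definition ent_im (p : 'M[C]_2) (r t : 'I_2) : chart_expr R :=
  EAdd (EAdd (EMul (EConst (complex.Re (p r 0))) (cap_im 0 t)) (EMul (EConst (complex.Im (p r 0))) (cap_re 0 t)))
      (EAdd (EMul (EConst (complex.Re (p r 1))) (cap_im 1 t)) (EMul (EConst (complex.Im (p r 1))) (cap_re 1 t))).

Lemma param_entE (p : SU2 R) (x : V) r t :
  SU2_param p x r t = chart_eval (ent_re p r t) x +i* chart_eval (ent_im p r t) x.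
Proof.
rewrite /SU2_param /= mxE sum2 !cap_mxE.
case: (val p r 0) => a b; case: (val p r 1) => c d.
by simpc; apply: eq_complexP => /=; ring.
Qed.

(** The i-th coordinate derivative of the central parametrization of the
    hemisphere around I. *)
Definition dcap (i : 'I_3) (x : V) : 'M[C]_2 :=
  (- (x 0 i * scal x ^+ 3))%:C *: (1%:M + su2_vec x) + (scal x)%:C *: su2X R i.

Lemma dcapE i (x : V) l t :
  dcap i x l t = chart_eval (chart_diff i (cap_re l t)) x +i* chart_eval (chart_diff i (cap_im l t)) x.
Proof.
rewrite /dcap su2_vecE !row3E !mxE.
by move: l t i; apply: ord2P; apply: ord2P; apply: ord3P => /=; rewrite ?mxE /=; simpc;
  apply: eq_complexP => /=; ring.
Qed.

Local Arguments cap_re : simpl never.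
Local Arguments cap_im : simpl never.

(** The parametrization at p is p times the one at I, so p factors out of the
    tangent vectors; by left invariance the Gram matrix does not see it. *)
Lemma tangentE (p : SU2 R) i x : SU2_tangent p i x = p *m dcap i x.
Proof.
apply/matrixP => r t; rewrite !mxE sum2 !dcapE.
under eq_fun do rewrite param_entE /=.
rewrite -[X in X +i* _]/(partial i (chart_eval (ent_re p r t)) x).
under eq_fun do rewrite param_entE /=.
rewrite -[X in _ +i* X]/(partial i (chart_eval (ent_im p r t)) x).
rewrite !partial_chart_eval /ent_re /ent_im /=.
case: (val p r 0) => a b; case: (val p r 1) => c d.
by simpc; apply: eq_complexP => /=; ring.
Qed.

Lemma SU2_unit (p : SU2 R) : (p : 'M[C]_2) \in unitmx.
Proof. by rewrite unitmxE; case/andP: (SU2_valP p) => _ /eqP ->; exact: unitr1. Qed.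

Definition inv_cap (x : V) : 'M[C]_2 :=
  \matrix_(l, t) (chart_eval (cap_re t l) x +i* - chart_eval (cap_im t l) x).

Lemma invmx_cap (x : V) : invmx (SU2_cap_mx x) = inv_cap x.
Proof.
have e := scalE x.
have E : SU2_cap_mx x *m inv_cap x = 1%:M.
  apply/matrixP => i j; rewrite !mxE sum2 !cap_mxE !mxE.
  move: j i; apply: ord2P; apply: ord2P; rewrite /cap_re /cap_im /=; simpc;
    apply: eq_complexP => /=; by [ring | rewrite -[RHS]e; ring].
have U : SU2_cap_mx x \in unitmx := SU2_unit (SU2_cap x).
by rewrite -[RHS](mulKmx U) E mulmx1.
Qed.

Lemma inv_capE x l t : invmx (SU2_cap_mx x) l t = chart_eval (cap_re t l) x +i* - chart_eval (cap_im t l) x.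
Proof. by rewrite invmx_cap mxE. Qed.

(** Up to the factor s^2, the rows are e_i minus the cross product of x and
    e_i, the components of the i-th coordinate vector in the left-invariant
    frame X_1, X_2, X_3. *)
Definition coframe (i k : 'I_3) (x : V) : R :=
  nth 0 (nth [::] [:: [:: 1; - x 0 i2; x 0 i1]; [:: x 0 i2; 1; - x 0 i0];
                      [:: - x 0 i1; x 0 i0; 1]] i) k.

Lemma coord_tangent (p : SU2 R) (i k : 'I_3) x :
  su2_coord (invmx (SU2_param p x) *m SU2_tangent p i x) 0 k = scal x ^+ 2 * coframe i k x.
Proof.
have -> : invmx (SU2_param p x) *m SU2_tangent p i x = invmx (SU2_cap_mx x) *m dcap i x.
  have Uc : SU2_cap_mx x \in unitmx := SU2_unit (SU2_cap x).
  have Up := SU2_unit (SU2_mul p (SU2_cap x)).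
  apply: (can_inj (mulKmx Up)); rewrite mulKVmx// tangentE /=.
  by rewrite -mulmxA (mulKVmx Uc).
rewrite mxE; move: k i; apply: ord3P; apply: ord3P;
  rewrite [nth _ _ _]/= mxE sum2 !inv_capE !dcapE /coframe /cap_re /cap_im /=; simpc => /=; ring.
Qed.

End su2_charts.

(** * The Laplacian as a sum of squares of left-invariant fields *)

Section su2_laplacian.
Variable R : realType.
Local Notation V := 'rV[R]_3.
Local Notation C := R[i].
Local Notation opp e := (EMul (EConst (-1)) e).
Variables a b c : R.
Hypothesis (a0 : 0 < a) (b0 : 0 < b) (c0 : 0 < c).
(** The squared coefficients of the orthonormal frame (a X_1, b X_2, c X_3),
    which are the coefficients of the squares in the Laplacian. *)
Definition wt (k : 'I_3) : R := nth 0 [:: a; b; c] k ^+ 2.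

Lemma gramE p x i j :
  SU2_gram a b c p x i j = scal x ^+ 4 * \sum_(k < 3) coframe i k x * coframe j k x / wt k.
Proof.
rewrite /SU2_gram mxE /su2_ip mulr_sumr; apply: eq_bigr => k _.
rewrite [X in X / _ * _](coord_tangent p i k) [X in _ * (X / _)](coord_tangent p j k).
rewrite /wt; have : nth 0 [:: a; b; c] k != 0.
  by move: k; apply: ord3P; rewrite /= gt_eqF.
by move: (nth _ _ _) => w w0; field.
Qed.

Let v0 := EVar R i0.
Let v1 := EVar R i1.
Let v2 := EVar R i2.

(** The field X_k in coordinates is sum_j (frame k j) d_j: right
    multiplication by 1 + t e_k moves the central projection x with velocity
    e_k + x_k x plus the cross product of x and e_k. *)
Definition frame (k j : 'I_3) : chart_expr R :=
  nth (EConst 0) (nth [::]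
   [:: [:: EAdd (EConst 1) (EMul v0 v0); EAdd v2 (EMul v0 v1); EAdd (opp v1) (EMul v0 v2)];
       [:: EAdd (opp v2) (EMul v1 v0); EAdd (EConst 1) (EMul v1 v1); EAdd v0 (EMul v1 v2)];
       [:: EAdd v1 (EMul v2 v0); EAdd (opp v0) (EMul v2 v1); EAdd (EConst 1) (EMul v2 v2)]] k) j.

Definition frame_mx (x : V) : 'M[R]_3 := \matrix_(k, j) chart_eval (frame k j) x.
Definition coframe_mx (x : V) : 'M[R]_3 := \matrix_(i, k) (scal x ^+ 2 * coframe i k x).

Lemma frame_coframe x : frame_mx x *m coframe_mx x = 1%:M.
Proof.
have e := scalE x; apply/matrixP => k l; rewrite mxE sum3 !mxE.
move: k l; apply: ord3P; apply: ord3P; rewrite /coframe /=;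
  first [by apply: (etrans _ e); ring | by rewrite -[RHS]/(0:R); ring].
Qed.

(** The left-invariant frame has a constant Gram matrix, so the coordinate one
    is a change of basis of a diagonal matrix, and its inverse and determinant
    follow from those of the frame. *)
Lemma gram_mxE p x : SU2_gram a b c p x =
  coframe_mx x *m diag_mx (\row_k (wt k)^-1) *m (coframe_mx x)^T.
Proof.
apply/matrixP => i j; rewrite gramE mulr_sumr mxE; apply: eq_bigr => k _.
rewrite mul_mx_diag !mxE; ring.
Qed.

Lemma invmx_gramE p x i j : invmx (SU2_gram a b c p x) i j =
  \sum_(k < 3) wt k * chart_eval (frame k i) x * chart_eval (frame k j) x.
Proof.
pose K := (frame_mx x)^T *m diag_mx (\row_k wt k) *m frame_mx x.
have GK : SU2_gram a b c p x *m K = 1%:M.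
  rewrite gram_mxE /K -!mulmxA (mulmxA (coframe_mx x)^T) -trmx_mul frame_coframe.
  rewrite trmx1 mul1mx (mulmxA (diag_mx _)) (_ : diag_mx _ *m diag_mx _ = 1%:M).
    by rewrite mul1mx mulmx1C// frame_coframe.
  apply/matrixP => u v; rewrite mul_diag_mx !mxE mulrnAr mulVf//.
  move: u {v}; apply: ord3P; rewrite /wt /= expf_eq0 /= gt_eqF //.
have [U _] := mulmx1_unit GK.
rewrite -[invmx _]mulmx1 -GK mulKmx// /K mxE; apply: eq_bigr => k _.
by rewrite mul_mx_diag !mxE; ring.
Qed.

Lemma det_coframe x : \det (coframe_mx x) = scal x ^+ 4.
Proof.
have e := scalE x.
rewrite (expand_det_row _ i0) sum3 /cofactor !(expand_det_row _ 0) !sum2 /cofactor !det_mx11 !mxE.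
rewrite /coframe /= !modn_small//.
apply: (@etrans _ _ (scal x ^+ 4 * (scal x ^+ 2 * (1 + x 0 i0 ^+ 2 + x 0 i1 ^+ 2 + x 0 i2 ^+ 2)))).
  by ring.
by rewrite e mulr1.
Qed.

Lemma sqrt_det_gram p x : Num.sqrt (\det (SU2_gram a b c p x)) = (a * b * c)^-1 * scal x ^+ 4.
Proof.
have abc0 : 0 < (a * b * c)^-1 by rewrite invr_gt0 !mulr_gt0.
rewrite gram_mxE !det_mulmx det_tr det_diag det_coframe.
have -> : \prod_(i < 3) (\row_k (wt k)^-1) 0 i = ((a * b * c)^-1) ^+ 2 :> R.
  rewrite !big_ord_recl big_ord0 !mxE /wt /=.
  have [/gt_eqF/negbT ? /gt_eqF/negbT ? /gt_eqF/negbT ?] := And3 a0 b0 c0.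
  by field; do !(apply/andP; split).
rewrite -[RHS]ger0_norm; last by rewrite mulr_ge0 ?exprn_ge0 // ltW// scal_gt0.
by rewrite -sqrtr_sqr; congr Num.sqrt; ring.
Qed.

Definition Xd (k : 'I_3) (F : V -> R) (x : V) : R :=
  \sum_(j < 3) chart_eval (frame k j) x * partial j F x.

Lemma derivable_Xd k F x i : smooth F -> derivable (Xd k F) x (delta_mx 0 i).
Proof.
move=> sF; rewrite (_ : Xd k F = \sum_(j < 3) chart_eval (frame k j) * partial j F); last first.
  by apply/funext => y; rewrite fct_sumE.
apply: derivable_sum => j; apply: derivableM.
  by case: (is_derive_chart_eval (frame k j) x i).
exact: (sF [:: j]).2.
Qed.

(** Components of the k-th field multiplied by the volume density s^4. *)
Definition rho_frame (k i : 'I_3) : chart_expr R :=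
  EMul (EMul (EMul (EScal R) (EScal R)) (EMul (EScal R) (EScal R))) (frame k i).

(** The group is unimodular: left-invariant fields preserve the volume, hence
    are divergence free. This is why no first-order term survives in the
    Laplacian. *)
Lemma div_rho_frame k x : \sum_(i < 3) chart_eval (chart_diff i (rho_frame k i)) x = 0.
Proof.
have e := scalE x.
have : \sum_(i < 3) chart_eval (chart_diff i (rho_frame k i)) x =
    4 * x 0 k * scal x ^+ 4 * (1 - scal x ^+ 2 * (1 + x 0 i0 ^+ 2 + x 0 i1 ^+ 2 + x 0 i2 ^+ 2)).
  by rewrite sum3; move: k; apply: ord3P => /=; ring.
by move=> ->; rewrite e subrr mulr0.
Qed.

(** Expanding the inverse Gram matrix in the frame writes the flux of the
    gradient of F as sum_k w_k (density times X_k) (X_k F), and each density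
    times X_k is divergence free, so only the second derivative X_k (X_k F)
    remains. *)
Lemma laplace_coordE p F x : smooth F ->
  laplace_coord (SU2_gram a b c p) F x = - \sum_(k < 3) wt k * Xd k (Xd k F) x.
Proof.
move=> sF.
have abc0 : a * b * c != 0 by rewrite gt_eqF// !mulr_gt0.
pose kap := (a * b * c)^-1.
have flux i : (fun y => \sum_(j < 3) Num.sqrt (\det (SU2_gram a b c p y)) *
      invmx (SU2_gram a b c p y) i j * partial j F y) =
    \sum_(k < 3) (kap * wt k) \*: (chart_eval (rho_frame k i) * Xd k F).
  apply/funext => y; rewrite fct_sumE.
  under eq_bigr do rewrite sqrt_det_gram invmx_gramE mulr_sumr mulr_suml.
  rewrite exchange_big /=; apply: eq_bigr => k _.
  rewrite !fctE /GRing.scale /= /Xd !mulr_sumr; apply: eq_bigr => j _.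
  by rewrite /kap; ring.
have dflux i : partial i (fun y => \sum_(j < 3) Num.sqrt (\det (SU2_gram a b c p y)) *
      invmx (SU2_gram a b c p y) i j * partial j F y) x =
    \sum_(k < 3) kap * wt k * (chart_eval (chart_diff i (rho_frame k i)) x * Xd k F x +
       scal x ^+ 4 * (chart_eval (frame k i) x * partial i (Xd k F) x)).
  rewrite flux /partial.
  have dX k := derivableP (@derivable_Xd k F x i sF).
  have dr k := is_derive_chart_eval (rho_frame k i) x i.
  have dM k := is_deriveM (dr k) (dX k).
  have dZ k := is_deriveZ (kap * wt k) (dM k).
  rewrite (@derive_val _ _ _ _ _ _ _ (is_derive_sum dZ)).
  by apply: eq_bigr => k _; rewrite /GRing.scale /=; ring.
rewrite /laplace_coord; transitivity (- ((a * b * c)^-1 * scal x ^+ 4)^-1 *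
    \sum_(i < 3) \sum_(k < 3) kap * wt k * (chart_eval (chart_diff i (rho_frame k i)) x * Xd k F x +
       scal x ^+ 4 * (chart_eval (frame k i) x * partial i (Xd k F) x))).
  by congr (- _^-1 * _); [exact: sqrt_det_gram|apply: eq_bigr => i _; exact: dflux].
rewrite exchange_big /= -/kap mulNr mulr_sumr; congr (- _); apply: eq_bigr => k _.
rewrite -mulr_sumr big_split /= -mulr_suml div_rho_frame mul0r add0r -mulr_sumr -/(Xd k (Xd k F) x).
have : scal x != 0 by rewrite gt_eqF// scal_gt0.
rewrite /kap {kap flux dflux}; move: (a * b * c) abc0 (Xd _ _ _) (wt k) (scal x) => d d0 X w s s0.
by field; rewrite s0 d0.
Qed.

End su2_laplacian.

(** * Second-derivative test *)

Section second_derivative.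
Variable R : realType.

Lemma max_deriv1 (g dg : R -> R) : (forall t, is_derive t (1 : R) g (dg t)) ->
  (forall t, g t <= g 0) -> dg 0 = 0.
Proof.
move=> dgE gmax.
have d t : derivable g t 1 by case: (dgE t).
have N10 : (-1 : R) <= 1 by lra.
have in0 : 0 \in `](-1 : R), 1[ by rewrite in_itv /= ltrN10 ltr01.
have [_ h] := derive1_at_max N10 (fun t _ => d t) in0 (fun t _ => gmax t).
by have [_ <-] := dgE 0.
Qed.

(** If the derivative of g at its maximum had positive slope, g would increase
    to the right of it by the mean value theorem. *)
Lemma max_deriv2 (g dg : R -> R) (d : R) : (forall t, is_derive t (1 : R) g (dg t)) ->
  (forall t, g t <= g 0) -> is_derive 0 (1 : R) dg d -> d <= 0.
Proof.
move=> dgE gmax ddg; rewrite leNgt; apply/negP => d0.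
have dg0 := max_deriv1 dgE gmax.
have [ex dv] := ddg.
have : (fun h : R => h^-1 *: ((dg \o shift 0) (h *: (1:R)) - dg 0)) @ 0^' --> d.
  by rewrite -dv; exact: ex.
move=> /cvgr_gt /(_ _ d0) [e /= e0 H].
have He h : 0 < h -> h < e -> 0 < dg h.
  move=> h0 he; have := H h; rewrite /ball /= sub0r normrN gtr0_norm// => /(_ he).
  rewrite gt_eqF// => /(_ isT).
  by rewrite dg0 subr0 addr0 /GRing.scale /= mulr1 pmulr_rgt0 ?invr_gt0.
have e20 : 0 < e / 2 by rewrite divr_gt0.
have [|x xin gE] := @MVT R g dg 0 (e/2) e20 (fun x _ => dgE x).
  apply: continuous_subspaceT => x; apply: differentiable_continuous.
  by apply/derivable1_diffP; case: (dgE x).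
move: xin; rewrite in_itv /= => /andP[x0 xe].
have := gmax (e / 2); apply/negP; rewrite -ltNge -subr_gt0 gE subr0 mulr_gt0//.
by apply: He => //; apply: (lt_trans xe); rewrite ltr_pdivrMr// mulr_natr mulr2n ltrDl.
Qed.
End second_derivative.

(** * SU(2) as the unit quaternions *)

Section su2_group.
Variable R : realType.
Local Notation C := R[i].
Local Notation SU := (SU2 R).
Local Notation Re := (@complex.Re R).
Local Notation Im := (@complex.Im R).

(** For a unitary matrix of determinant one the conjugate transpose and the
    adjugate are both the inverse; this forces the shape of the second row. *)
Lemma SU2_conj_adj (p : SU) : map_mx Num.conj (p : 'M[C]_2)^T = \adj (val p).
Proof.
case/andP: (SU2_valP p) => /unitarymxP pu /eqP pd.
apply: (can_inj (mulKmx (SU2_unit p))).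
by rewrite pu mul_mx_adj pd.
Qed.

Lemma SU2_row1 (p : SU) :
  (Re (p 1 0) = - Re (p 0 1)) * (Im (p 1 0) = Im (p 0 1)) *
  (Re (p 1 1) = Re (p 0 0)) * (Im (p 1 1) = - Im (p 0 0)).
Proof.
have /matrixP E := SU2_conj_adj p.
have := (E 0 0, E 1 0); rewrite !mxE /cofactor !det_mx11 !mxE.
have -> : lift 0 0 = 1 :> 'I_2 by apply: val_inj.
have -> : lift 1 0 = 0 :> 'I_2 by apply: val_inj.
rewrite /= expr0 expr1 mul1r mulN1r.
case: (val p 0 0) (val p 0 1) (val p 1 0) (val p 1 1) => [a b] [c d] [e f] [g h] /=.
by case=> [[? ?]] [? ?]; do 3?split; lra.
Qed.

Lemma SU2_norm (p : SU) :
  Re (p 0 0) ^+ 2 + Im (p 0 0) ^+ 2 + Re (p 0 1) ^+ 2 + Im (p 0 1) ^+ 2 = 1.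
Proof.
case/andP: (SU2_valP p) => /unitarymxP /matrixP /(_ 0 0) + _.
rewrite !mxE sum2 !mxE /=.
case: (val p 0 0) (val p 0 1) => [a b] [c d] /= [<- _].
ring.
Qed.

(** The matrix of the quaternion t + u_0 i + u_1 j + u_2 k, with i, j, k =
    X_1, X_2, X_3. *)
Definition qmx (t : R) (u : 'rV[R]_3) : 'M[C]_2 :=
  mx2 (t +i* u 0 i0) (u 0 i1 +i* u 0 i2) (- u 0 i1 +i* u 0 i2) (t +i* - u 0 i0).

Lemma SU2_qmx (p : SU) : val p = qmx (Re (p 0 0)) (su2_coord p).
Proof.
rewrite /qmx; apply/matrixP; apply: ord2P; apply: ord2P; rewrite !mxE /= ?mxE /=;
  by apply: eq_complexP => //=; rewrite SU2_row1.
Qed.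

Lemma qmx_pred (t : R) (u : 'rV[R]_3) : t ^+ 2 + \sum_(i < 3) u 0 i ^+ 2 = 1 -> SU2_pred (qmx t u).
Proof.
rewrite sum3 !addrA => e; apply/andP; split.
  apply/unitarymxP/matrixP; rewrite /qmx; apply: ord2P; apply: ord2P;
    rewrite !mxE sum2 !mxE /=; simpc; apply: eq_complexP => /=; by [ring | rewrite -e; ring].
rewrite /qmx (expand_det_row _ 0) sum2 /cofactor !det_mx11 !mxE /= !modn_small//.
rewrite expr0 expr1; simpc.
by apply/eqP; apply: eq_complexP => /=; by [ring | rewrite -e; ring].
Qed.

Lemma SU2_normq (p : SU) : Re (p 0 0) ^+ 2 + \sum_(i < 3) su2_coord p 0 i ^+ 2 = 1.
Proof. by rewrite sum3 !mxE /= !addrA SU2_norm. Qed.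

Lemma SU2_1P : SU2_pred (1%:M : 'M[C]_2).
Proof. by rewrite /SU2_pred det1 eqxx andbT; apply/unitarymxP; rewrite trmx1 map_mx1 mulmx1. Qed.
Definition SU2_one : SU := MkSU2 SU2_1P.

Lemma SU2_invP (p : SU) : SU2_pred (qmx (Re (p 0 0)) (- su2_coord p)).
Proof.
by apply: qmx_pred; rewrite -(SU2_normq p) !sum3 !mxE !sqrrN.
Qed.
Definition SU2_inv (p : SU) : SU := MkSU2 (SU2_invP p).

Lemma SU2_mulV (p : SU) : SU2_mul p (SU2_inv p) = SU2_one.
Proof.
apply: val_inj; rewrite /= [in X in X *m _]SU2_qmx /qmx.
have e := SU2_norm p.
apply/matrixP; apply: ord2P; apply: ord2P;
    rewrite !mxE sum2 !mxE /=; simpc; apply: eq_complexP => /=; by [ring | rewrite -e; ring].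
Qed.

Lemma SU2_mulA (p q r : SU) : SU2_mul p (SU2_mul q r) = SU2_mul (SU2_mul p q) r.
Proof. by apply: val_inj; rewrite /= mulmxA. Qed.

Lemma SU2_mul1 (p : SU) : SU2_mul SU2_one p = p.
Proof. by apply: val_inj; rewrite /= mul1mx. Qed.

Lemma SU2_mulr1 (p : SU) : SU2_mul p SU2_one = p.
Proof. by apply: val_inj; rewrite /= mulmx1. Qed.

Lemma SU2_Vmul (p : SU) : SU2_mul (SU2_inv p) p = SU2_one.
Proof.
by apply: val_inj; rewrite /= mulmx1C//; have /(congr1 val) := SU2_mulV p.
Qed.

Lemma cap0 : SU2_cap (0 : 'rV[R]_3) = SU2_one.
Proof.
apply: val_inj; rewrite /= /SU2_cap_mx big1 => [|i _]; last by rewrite mxE expr0n.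
rewrite addr0 sqrtr1 invr1 /su2_vec big1 => [|i _]; last by rewrite mxE scale0r.
by rewrite addr0 scale1r.
Qed.

Lemma param0 (p : SU) : SU2_param p 0 = p.
Proof. by rewrite /SU2_param cap0 SU2_mulr1. Qed.

Lemma param_mul (g p : SU) x : SU2_param (SU2_mul g p) x = SU2_mul g (SU2_param p x).
Proof. by rewrite /SU2_param SU2_mulA. Qed.

(** The inner product of R^4 on unit quaternions. It is invariant under
    translations, and 1 - qdot x y is half the squared distance, used below as
    the distance of SU(2). *)
Definition qdot (x y : SU) : R := Re (x 0 0) * Re (y 0 0) +
  \sum_(i < 3) su2_coord x 0 i * su2_coord y 0 i.

Lemma qdot_inv x y : Re (SU2_mul (SU2_inv y) x 0 0) = qdot x y.
Proof.
rewrite /= (SU2_qmx x) /qmx !mxE sum2 !mxE /=; simpc => /=.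
rewrite /qdot sum3 !mxE /=; ring.
Qed.

(** The open hemisphere around y is covered by the chart at y: the real part
    of y^-1 x is qdot x y > 0, and dividing the imaginary part by it gives the
    central projection. *)
Lemma SU2_param_near (y x : SU) : 0 < qdot x y ->
  exists2 z : 'rV[R]_3, x = SU2_param y z &
    (qdot x y) ^+ 2 * \sum_(i < 3) z 0 i ^+ 2 = 1 - qdot x y ^+ 2.
Proof.
move=> r0; set w := SU2_mul (SU2_inv y) x.
have rE : Re (w 0 0) = qdot x y by rewrite qdot_inv.
have nw := SU2_normq w.
have rn0 : qdot x y != 0 by rewrite gt_eqF.
have zE : \sum_(i < 3) ((qdot x y)^-1 *: su2_coord w) 0 i ^+ 2 =
    (qdot x y) ^- 2 * (1 - qdot x y ^+ 2).
  rewrite -nw rE addrC addKr mulr_sumr; apply: eq_bigr => i _.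
  by rewrite mxE exprMn exprVn.
exists ((qdot x y)^-1 *: su2_coord w).
  rewrite -[LHS]SU2_mul1 -(SU2_mulV y) -SU2_mulA; congr SU2_mul; rewrite -/w.
  apply: val_inj; rewrite [LHS]SU2_qmx /= /SU2_cap_mx zE.
  have -> : 1 + qdot x y ^- 2 * (1 - qdot x y ^+ 2) = ((qdot x y)^-1) ^+ 2 by field.
  rewrite sqrtr_sqr ger0_norm ?invr_ge0 ?(ltW r0)// invrK rE.
  rewrite /qmx su2_vecE !row3E; move: (su2_coord w) (qdot x y) rn0 => v r rn0.
  apply/matrixP; apply: ord2P; apply: ord2P; rewrite !mxE /=; simpc; apply: eq_complexP => /=; by field.
by rewrite zE; field.
Qed.

End su2_group.

(** * Compactness of SU(2) *)

Section su2_compact.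
Variable R : realType.
Local Notation C := R[i].
Local Notation SU := (SU2 R).
Local Notation Re := (@complex.Re R).
Local Notation Im := (@complex.Im R).
Local Notation one := (SU2_one R).

Lemma qdot_id (x : SU) : qdot x x = 1.
Proof. by rewrite -(SU2_normq x) /qdot; congr (_ + _); apply: eq_bigr => i _. Qed.

Lemma qdot_le1 (x y : SU) : `|qdot x y| <= 1.
Proof.
have := qdot_id x; have := qdot_id y; rewrite /qdot !sum3 ler_norml.
move: (Re _) (Re _) (su2_coord _ _ _) (su2_coord _ _ _) (su2_coord _ _ _)
  (su2_coord _ _ _) (su2_coord _ _ _) (su2_coord _ _ _) => a b c d e f g h ea eb.
have := (sqr_ge0 (a-b), sqr_ge0 (a+b), (sqr_ge0 (f - c), sqr_ge0 (g - d)),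
  (sqr_ge0 (h - e), sqr_ge0 (f + c)), (sqr_ge0 (g + d), sqr_ge0 (h + e))).
move=> [[[[? ?] [? ?]] [? ?]] [? ?]].
by apply/andP; split; nra.
Qed.

Definition qvec (x : SU) : 'rV[R]_(1 + 3) := row_mx (const_mx (Re (x 0 0))) (su2_coord x).

Lemma qdotE x y : qdot x y = \sum_(i < 1 + 3) qvec x 0 i * qvec y 0 i.
Proof.
rewrite big_split_ord /= big_ord_recl big_ord0 addr0 /qdot; congr (_ + _).
  by rewrite !row_mxEl !mxE.
by apply: eq_bigr => i _; rewrite !row_mxEr.
Qed.

Lemma qvec_surj (v : 'rV[R]_(1 + 3)) : \sum_(i < 1 + 3) v 0 i ^+ 2 = 1 -> exists x, qvec x = v.
Proof.
rewrite big_split_ord /= big_ord_recl big_ord0 addr0 => e.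
have P : SU2_pred (qmx (v 0 (lshift 3 ord0)) (rsubmx v)).
  by apply: qmx_pred; rewrite -e; congr (_ + _); apply: eq_bigr => i _; rewrite mxE.
exists (MkSU2 P); apply/rowP => i; case: (fintype.splitP i) => j ij.
  have -> : i = lshift 3 j by apply: val_inj.
  by rewrite row_mxEl !mxE /=; congr (v _ _); apply: val_inj; rewrite /= ord1.
have -> : i = rshift 1 j by apply: val_inj.
rewrite row_mxEr !mxE /=; move: j {ij}; apply: ord3P => /=; rewrite ?mxE /= ?mxE //; congr (v _ _); exact: val_inj.
Qed.

Lemma dot_continuous (c : 'rV[R]_(1 + 3)) :
  continuous (fun v : 'rV[R]_(1 + 3) => \sum_(i < 1 + 3) v 0 i * c 0 i).
Proof.
move=> v; apply: differentiable_continuous.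
rewrite (_ : (fun _ => _) = \sum_(i < 1 + 3) (fun v : 'rV[R]_(1 + 3) => v 0 i * c 0 i)).
  apply: differentiable_sum => i; apply: differentiableM => //; exact: differentiable_coord.
by apply/funext => w; rewrite fct_sumE.
Qed.

(** SU(2) is the unit sphere of R^4, closed in a product of segments.
    Compactness is used only in this form, where P y x says that x is close
    enough to y. *)
Lemma SU2_cover (P : SU -> SU -> Prop) :
  (forall y, exists2 r : R, 0 < r & forall x, 1 - qdot x y < r -> P y x) ->
  exists s : seq SU, forall x, exists2 y, y \in s & P y x.
Proof.
move=> near_P.
have /choice[r rP] : forall y, exists r : R, 0 < r /\ forall x, 1 - qdot x y < r -> P y x.
  by move=> y; have [r ? ?] := near_P y; exists r.
pose S := [set v : 'rV[R]_(1 + 3) | \sum_(i < 1 + 3) v 0 i ^+ 2 = 1].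
have S_compact : compact S.
  apply: (@subclosed_compact _ _ [set v : 'rV[R]_(1 + 3) | forall i, `[(-1 : R), 1]%classic (v ord0 i)]).
  - apply: (@preimage_closed _ _ (fun v : 'rV[R]_(1 + 3) => \sum_(i < 1 + 3) v 0 i ^+ 2) [set t | t = 1]).
      move=> v _.
      apply: differentiable_continuous.
      rewrite (_ : (fun _ => _) = \sum_(i < 1 + 3) (fun v : 'rV[R]_(1 + 3) => v 0 i * v 0 i)).
        by apply: differentiable_sum => i; apply: differentiableM; exact: differentiable_coord.
      by apply/funext => w; rewrite fct_sumE.
    exact: closed_eq.
  - by apply: (@rV_compact _ _ (fun=> `[(-1 : R), 1]%classic)) => i; exact: segment_compact.
  - move=> v /= vS i; rewrite /= in_itv /= -ler_norml -(@expr_le1 _ 2)//.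
    rewrite real_normK ?num_real// -vS (bigD1 i)//= lerDl sumr_ge0// => j _.
    exact: sqr_ge0.
move: S_compact; rewrite compact_cover.
move=> /(_ SU setT (fun y => [set v | \sum_(i < 1 + 3) v 0 i * qvec y 0 i > 1 - r y])).
case.
- move=> y _; apply: (@open_comp _ _ (fun v : 'rV[R]_(1 + 3) =>
    \sum_(i < 1 + 3) v 0 i * qvec y 0 i) [set t | 1 - r y < t]).
    by move=> v _; exact: dot_continuous.
  exact: open_gt.
- move=> v vS; have [y yv] := qvec_surj vS; exists y => //=.
  rewrite -yv -qdotE qdot_id; have [] := rP y; lra.
- move=> D _ SD; exists (finmap.enum_fset D) => x.
  have /SD[y yD /= yx] : S (qvec x).
    by rewrite /S /= -(qdot_id x) qdotE; apply: eq_bigr.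
  exists y; first exact: yD.
  by apply: (rP y).2; rewrite qdotE; move: yx; lra.
Qed.

Definition scont (f : SU -> R) := forall y (e : R), 0 < e ->
  exists2 r : R, 0 < r & forall x, 1 - qdot x y < r -> `|f x - f y| < e.

Lemma seq_argmax (T : eqType) (F : T -> R) (s : seq T) (x0 : T) : x0 \in s ->
  exists2 x, x \in s & forall y, y \in s -> F y <= F x.
Proof.
elim: s x0 => // a s IH x0 _.
case: s IH => [_|b s /(_ b (mem_head _ _))[x xs xmax]].
  by exists a => [|y]; rewrite ?mem_head// inE => /eqP->.
have [xa|ax] := leP (F x) (F a).
  exists a; first exact: mem_head.
  by move=> y; rewrite inE => /orP[/eqP->//|/xmax/le_trans]; apply.
exists x; first by rewrite inE xs orbT.
by move=> y; rewrite inE => /orP[/eqP->|/xmax//]; exact: ltW.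
Qed.

(** If no value were the largest, choose for each y a point g y with a larger
    value; near y the function stays below its value at g y, and finitely many
    such g y cannot all be exceeded. *)
Lemma SU2_max (u : SU -> R) : scont u -> exists x, forall y, u y <= u x.
Proof.
move=> cu; apply: contrapT => nomax.
have /choice[g gP] : forall y, exists z, u y < u z.
  move=> y; apply: contrapT => h; apply: nomax; exists y => z.
  by rewrite leNgt; apply/negP => yz; apply: h; exists z.
have [|s sP] := @SU2_cover (fun y x => u x < u (g y)).
  move=> y; have [r r0 rP] := cu y (u (g y) - u y) ltac:(by rewrite subr_gt0).
  by exists r => // x /rP; rewrite ltr_norml => /andP[_]; rewrite ltrD2r.
have [y0 y0s _] := sP one.
have [y ys ymax] := seq_argmax (fun y => u (g y)) y0s.
have [z /ymax zs] := sP (g y).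
by rewrite ltNge zs.
Qed.

Lemma scont_bounded (u : SU -> R) : scont u -> exists2 B : R, 0 < B & forall x, `|u x| <= B.
Proof.
move=> cu; have cN : scont (fun x => - u x).
  move=> y e /(cu y)[r r0 rP]; exists r => // x /rP.
  by rewrite -opprD normrN.
have [x xP] := SU2_max cu; have [y yP] := SU2_max cN.
exists (`|u x| + `|u y| + 1) => [|z]; first by rewrite ltr_wpDl// addr_ge0.
rewrite ler_norml; have := (xP z, yP z, ler_norm (u x), ler_norm (- u y)); rewrite normrN.
by move=> [[[? ?] ?] ?]; have := (normr_ge0 (u x), normr_ge0 (u y)) => -[? ?]; apply/andP; split; lra.
Qed.

(** A point near y is the image of a small vector in the chart at y. *)
Lemma chart_scont (f : SU -> R) :
  (forall p, continuous (f \o SU2_param p : 'rV[R]_3 -> R)) -> scont f.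
Proof.
move=> cf y e e0.
have /cvgrPdist_lt /(_ e e0) := cf y 0.
rewrite /= param0 => /nbhs_ballP[d /= d0 dP].
exists (Num.min (1/2) ((d/4) ^+ 2)).
  by rewrite lt_min divr_gt0//= exprn_gt0// divr_gt0.
move=> x; rewrite lt_min => /andP[q1 q2].
have q12 : 1/2 < qdot x y by lra.
have [|z xz zE] := @SU2_param_near R y x; first lra.
rewrite [in f x]xz distrC; apply: dP; split => // i j; rewrite ord1 /ball /= mxE sub0r normrN.
have qle : qdot x y <= 1 by have := qdot_le1 x y; rewrite ler_norml => /andP[].
rewrite -(@ltr_pXn2r _ 2)// ?nnegrE ?(ltW d0)// real_normK ?num_real//.
have zj : z 0 j ^+ 2 <= \sum_(i < 3) z 0 i ^+ 2.
  by rewrite (bigD1 j)//= lerDl sumr_ge0// => k _; exact: sqr_ge0.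
have s0 : 0 <= \sum_(i < 3) z 0 i ^+ 2 by rewrite sumr_ge0// => k _; exact: sqr_ge0.
have dd := sqr_ge0 d.
move: zE zj s0 q1 q2; rewrite expr_div_n (_ : 4 ^+ 2 = 16 :> R); last by ring.
set s := \sum_(_ < _) _.
move: (z 0 j ^+ 2) s (qdot x y) (d ^+ 2) q12 qle dd => w s q D q12 q1 D0 sE ws s0 _ qD.
have : 0 <= s * (q ^+ 2 - 1/4) by apply: mulr_ge0 => //; nra.
have : (1 - q) * (1 + q) <= 2 * (1 - q) by nra.
by nra.
Qed.

End su2_compact.

(** * Uniform approximation of continuous functions *)

Section abs_approx.
Variable R : realType.

(** The classical iteration p <- p + (t^2 - p^2)/2, which increases to |t| on
    [-1, 1]. *)
Fixpoint abs_poly (n : nat) : {poly R} :=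
  if n is m.+1 then abs_poly m + (1/2)%:P * ('X^2 - abs_poly m ^+ 2) else 0.

Lemma bernoulli_decay (x : R) n : 0 <= x <= 1 -> (1 - x) ^+ n * (1 + n%:R * x) <= 1.
Proof.
move=> /andP[x0 x1]; elim: n => [|n IH]; first by rewrite mul0r addr0 mulr1.
apply: le_trans IH; rewrite exprSr -mulrA ler_wpM2l ?exprn_ge0 ?subr_ge0//.
rewrite -natr1; have n0 : 0 <= n%:R :> R by [].
have : 0 <= (n%:R + 1) * x ^+ 2 by rewrite mulr_ge0// ?addr_ge0// sqr_ge0.
nra.
Qed.

(** The error is multiplied at each step by 1 - (|t| + p)/2, at most 1 -
    |t|/2. *)
Lemma abs_polyP (t : R) n : `|t| <= 1 ->
  0 <= (abs_poly n).[t] <= `|t| /\ `|t| - (abs_poly n).[t] <= `|t| * (1 - `|t| / 2) ^+ n.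
Proof.
move=> t1; elim: n => [|n [/andP[p0 pt] IH]].
  by rewrite /= horner0 subr0 expr0 mulr1 !lexx normr_ge0.
rewrite /= !(hornerD, hornerM, hornerC, hornerN, hornerX, horner_exp) -!expr2.

have <- : `|t| ^+ 2 = t ^+ 2 by rewrite real_normK// num_real.
move: (normr_ge0 t) t1 p0 pt IH; move: (`|t|) ((abs_poly n).[t]) => a p a0 a1 p0 pa IH.
have E : a - (p + 1 / 2 * (a ^+ 2 - p ^+ 2)) = (a - p) * (1 - (a + p) / 2) by field.
have k0 : 0 <= 1 - (a + p) / 2 by lra.
split.
  rewrite -[_ <= a]subr_ge0 E mulr_ge0// ?subr_ge0// andbT.
  by rewrite addr_ge0// mulr_ge0// subr_ge0 lerXn2r.
rewrite E exprSr mulrA; apply: ler_pM => //; first by rewrite subr_ge0.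
lra.
Qed.

Lemma abs_poly_approx (e : R) : 0 < e ->
  exists p : {poly R}, forall t, `|t| <= 1 -> `| `|t| - p.[t] | <= e.
Proof.
move=> e0; pose n := Num.bound (2 / e); exists (abs_poly n) => t t1.
have [/andP[p0 pt] H] := abs_polyP n t1.
rewrite ger0_norm ?subr_ge0//; apply: (le_trans H).
have nE : 2 / e < n%:R by apply: le_lt_trans (archi_boundP _); rewrite ?ler_norm// divr_ge0// ltW.
have := @bernoulli_decay (`|t| / 2) n.
have n2 : 2 < n%:R * e by rewrite -ltr_pdivrMr.
move: (normr_ge0 t) t1; move: (`|t|) => a a0 a1.
have /[swap]/[apply] : 0 <= a / 2 <= 1 by apply/andP; split; lra.
have : 0 <= (1 - a / 2) ^+ n by rewrite exprn_ge0//; lra.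
move: ((1 - a / 2) ^+ n) (n%:R : R) n2 => y N n2 y0 H2.
have yN : y * N * a <= 2 by nra.
have [ye|] := leP (a * y) e; first by [].
nra.
Qed.
End abs_approx.

Section density.
Variable R : realType.
Local Notation SU := (SU2 R).

(** Polynomials in the four quaternion coordinates, which are the functions
    qdot x y. *)
Inductive qdot_poly : (SU -> R) -> Prop :=
| QCst c : qdot_poly (fun=> c)
| QDot y : qdot_poly (fun x => qdot x y)
| QAdd f g : qdot_poly f -> qdot_poly g -> qdot_poly (fun x => f x + g x)
| QMul f g : qdot_poly f -> qdot_poly g -> qdot_poly (fun x => f x * g x).

Lemma qdot_poly_bounded f : qdot_poly f -> exists2 B : R, 0 < B & forall x, `|f x| <= B.
Proof.
elim=> [c|y|{}f g _ [B B0 fB] _ [D D0 gD]|{}f g _ [B B0 fB] _ [D D0 gD]].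
- by exists (`|c| + 1) => [|_]; rewrite ?ltr_wpDl// lerDl.
- by exists 1 => // x; exact: qdot_le1.
- exists (B + D) => [|x]; first exact: addr_gt0.
  by rewrite (le_trans (ler_normD _ _))// lerD.
- exists (B * D) => [|x]; first exact: mulr_gt0.
  by rewrite normrM ler_pM.
Qed.

Lemma qdot_poly_horner f (p : {poly R}) : qdot_poly f -> qdot_poly (fun x => p.[f x]).
Proof.
move=> qf; elim/poly_ind: p => [|p c IH].
  by under eq_fun do rewrite horner0; exact: QCst.
under eq_fun do rewrite hornerMXaddC.
exact: QAdd (QMul IH qf) (QCst c).
Qed.

Definition qapprox (f : SU -> R) := forall e : R, 0 < e ->
  exists2 g, qdot_poly g & forall x, `|f x - g x| <= e.

Lemma qdot_poly_approx f : qdot_poly f -> qapprox f.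
Proof. by move=> qf e e0; exists f => // x; rewrite subrr normr0 ltW. Qed.

Lemma qapproxD f g : qapprox f -> qapprox g -> qapprox (fun x => f x + g x).
Proof.
move=> af ag e e0; have e2 : 0 < e / 2 by rewrite divr_gt0.
have [f1 q1 H1] := af _ e2; have [g1 q2 H2] := ag _ e2.
exists (fun x => f1 x + g1 x); first exact: QAdd.
move=> x; rewrite opprD addrACA (le_trans (ler_normD _ _))// [leRHS](splitr e).
by rewrite lerD.
Qed.

Lemma qapproxZ c f : qapprox f -> qapprox (fun x => c * f x).
Proof.
move=> af e e0; have c1 : 0 < `|c| + 1 by rewrite ltr_wpDl.
have [g qg H] := af (e / (`|c| + 1)) (divr_gt0 e0 c1).
exists (fun x => c * g x); first exact: QMul (QCst c) qg.
move=> x; rewrite -mulrBr normrM.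
have [-> |c0] := eqVneq c 0; first by rewrite normr0 mul0r ltW.
apply: (@le_trans _ _ (`|c| * (e / (`|c| + 1)))); first by rewrite ler_wpM2l.
by rewrite mulrCA ger_pMr// ler_pdivrMr// mul1r lerDl.
Qed.

Lemma qapprox_norm f : qapprox f -> qapprox (fun x => `|f x|).
Proof.
move=> af e e0; have e2 : 0 < e / 2 by rewrite divr_gt0.
have [g qg H] := af _ e2; have [B B0 gB] := qdot_poly_bounded qg.
have [p pP] := @abs_poly_approx R (e / 2 / B) (divr_gt0 e2 B0).
exists (fun x => B * p.[B^-1 * g x]).
  exact: QMul (QCst B) (qdot_poly_horner p (QMul (QCst B^-1) qg)).
move=> x; rewrite [leRHS](splitr e) -(subrK (`|g x|) (`|f x|)) -addrA.
rewrite (le_trans (ler_normD _ _))// lerD//; first exact: le_trans (ler_dist_dist _ _) (H x).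
have -> : `|g x| = B * `|B^-1 * g x|.
  by rewrite normrM (gtr0_norm (_ : 0 < B^-1)) ?invr_gt0// mulrA mulfV ?mul1r// gt_eqF.
rewrite -mulrBr normrM gtr0_norm// mulrC -ler_pdivlMr//; apply: pP.
by rewrite normrM (gtr0_norm (_ : 0 < B^-1)) ?invr_gt0// mulrC ler_pdivrMr// mul1r.
Qed.

Lemma qapprox_max f g : qapprox f -> qapprox g -> qapprox (fun x => Num.max (f x) (g x)).
Proof.
move=> af ag.
have := qapproxZ (1/2) (qapproxD (qapproxD af ag) (qapprox_norm (qapproxD af (qapproxZ (-1) ag)))).
congr qapprox; apply/funext => x.
rewrite mulN1r; have [fg|fg] := leP (f x) (g x).
  by rewrite ler0_norm ?subr_le0//; field.
by rewrite ger0_norm ?subr_ge0 ?ltW//; field.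
Qed.

(** A one-step Stone-Weierstrass argument. The affine function T y x = f y - K
    y (1 - qdot x y) agrees with f at y and, for K y large, lies below f + e/2
    everywhere. Near y it is above f - e/2, so by compactness the maximum of
    finitely many of them is uniformly close to f; and maxima of polynomials
    are limits of polynomials because the absolute value is. *)
Lemma scont_qapprox f : scont f -> qapprox f.
Proof.
move=> cf e e0; have e2 : 0 < e / 2 by rewrite divr_gt0.
have [B B0 fB] := scont_bounded cf.
have /choice[K KP] : forall y, exists K : R, forall x, f y - K * (1 - qdot x y) <= f x + e / 2.
  move=> y; have [r r0 rP] := cf y (e / 2) e2.
  exists (2 * B / r) => x; have [|xr] := ltP (1 - qdot x y) r.
    move=> /rP; rewrite ltr_norml => /andP[h _].
    have : 0 <= 2 * B / r * (1 - qdot x y).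
      apply: mulr_ge0; first by rewrite divr_ge0 ?mulr_ge0 ?(ltW B0) ?(ltW r0).
      rewrite subr_ge0.
      by have := qdot_le1 x y; rewrite ler_norml => /andP[].
    lra.
  have : 2 * B <= 2 * B / r * (1 - qdot x y).
    by rewrite mulrAC ler_pdivlMr// ler_wpM2l// mulr_ge0 ?(ltW B0).
  have := (fB x, fB y); rewrite !ler_norml => -[/andP[? ?] /andP[? ?]]; lra.
pose T y x := f y - K y * (1 - qdot x y).
have qT y : qdot_poly (T y).
  rewrite (_ : T y = fun x => (f y - K y) + K y * qdot x y); last first.
    by apply/funext => x; rewrite /T; ring.
  exact: QAdd (QCst _) (QMul (QCst _) (QDot _)).
have e4 : 0 < e / 4 by rewrite divr_gt0.
have [|s sP] := @SU2_cover R (fun y x => f x - e / 2 <= T y x).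
  move=> y; have [r r0 rP] := cf y (e / 4) e4.
  have K1 : 0 < `|K y| + 1 by rewrite ltr_wpDl.
  exists (Num.min r (e / 4 / (`|K y| + 1))).
    by rewrite lt_min r0 divr_gt0// divr_gt0.
  move=> x; rewrite lt_min => /andP[/rP]; rewrite ltr_norml => /andP[_ h].
  rewrite ltr_pdivlMr// => h2.
  have q1 : 0 <= 1 - qdot x y.
    by rewrite subr_ge0; have := qdot_le1 x y; rewrite ler_norml => /andP[].
  have : K y * (1 - qdot x y) <= (1 - qdot x y) * (`|K y| + 1).
    by rewrite mulrC ler_wpM2l// (le_trans (ler_norm _))// lerDl.
  rewrite /T; lra.
have [y0 y0s _] := sP (SU2_one R).
have maxP : forall l : seq SU, exists2 G, qapprox G &
    (forall x, G x <= f x + e / 2) /\ forall y x, y \in l -> T y x <= G x.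
  elim=> [|y l [G aG [G1 G2]]].
    exists (T y0); first exact: qdot_poly_approx.
    by split=> // x; exact: KP.
  exists (fun x => Num.max (T y x) (G x)).
    by apply: qapprox_max => //; exact: qdot_poly_approx.
  split=> [x|z x]; first by rewrite ge_max G1 andbT; exact: KP.
  by rewrite inE le_max => /orP[/eqP->|/G2 ->]; rewrite ?lexx ?orbT.
have [G aG [G1 G2]] := maxP s.
have [g qg gG] := aG _ e2; exists g => // x.
have [y ys Ty] := sP x; have := G2 y x ys; have := G1 x; have := gG x.
rewrite !ler_norml => /andP[? ?] ? ?; apply/andP; split; lra.
Qed.

End density.

(** * Maximum principle *)

Section smooth_linear.
Variable R : realType.
Variable n : nat.
Local Notation V := 'rV[R]_n.

Lemma iter_partialD (F G : V -> R) s : smooth F -> smooth G ->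
  iter_partial s (F + G) = iter_partial s F + iter_partial s G.
Proof.
move=> sF sG; elim: s => //= i s ->; apply/funext => x.
by rewrite /partial deriveD//; [exact: (sF s).2|exact: (sG s).2].
Qed.

Lemma iter_partialZ (c : R) (F : V -> R) s : smooth F ->
  iter_partial s (c \*: F) = c \*: iter_partial s F.
Proof.
move=> sF; elim: s => //= i s ->; apply/funext => x.
by rewrite /partial deriveZ//; exact: (sF s).2.
Qed.

Lemma smoothD (F G : V -> R) : smooth F -> smooth G -> smooth (F + G).
Proof.
move=> sF sG s; rewrite iter_partialD//; split=> [x|x i].
  by apply: continuousD; [exact: (sF s).1|exact: (sG s).1].
by apply: derivableD; [exact: (sF s).2|exact: (sG s).2].
Qed.

Lemma smoothZ (c : R) (F : V -> R) : smooth F -> smooth (c \*: F).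
Proof.
move=> sF s; rewrite iter_partialZ//; split=> [x|x i].
  by apply: (@continuousM _ _ (cst c)); [exact: cst_continuous|exact: (sF s).1].
by apply: derivableZ; exact: (sF s).2.
Qed.
End smooth_linear.

Section max_principle.
Variable R : realType.
Local Notation SU := (SU2 R).
Local Notation V := 'rV[R]_3.

Lemma XdD k (F G : V -> R) : (forall x i, derivable F x (delta_mx 0 i)) ->
  (forall x i, derivable G x (delta_mx 0 i)) -> Xd k (F + G) = Xd k F + Xd k G.
Proof.
move=> dF dG; apply/funext => x; rewrite -[RHS]/(Xd k F x + Xd k G x) /Xd -big_split /=.
by apply: eq_bigr => j _; rewrite /partial deriveD// mulrDr.
Qed.

Lemma XdZ k (c : R) (F : V -> R) : (forall x i, derivable F x (delta_mx 0 i)) ->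
  Xd k (c \*: F) = c \*: Xd k F.
Proof.
move=> dF; apply/funext => x; rewrite -[RHS]/(c * Xd k F x) /Xd mulr_sumr.
by apply: eq_bigr => j _; rewrite /partial deriveZ// /GRing.scale /= mulrCA.
Qed.

Lemma smooth_derivable (F : V -> R) : smooth F -> forall x i, derivable F x (delta_mx 0 i).
Proof. by move=> sF; exact: (sF [::]).2. Qed.

Lemma frame0 k j : chart_eval (frame R k j) 0 = (k == j)%:R.
Proof. by move: k j; apply: ord3P; apply: ord3P; rewrite /= !mxE ?mulr0 ?addr0. Qed.

Lemma is_derive_along (F : V -> R) i : (forall x i, derivable F x (delta_mx 0 i)) ->
  forall t : R, is_derive t 1 (fun t => F (t *: delta_mx 0 i + 0)) (partial i F (t *: delta_mx 0 i + 0)).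
Proof. by move=> dF t; apply/is_derive_lineP; exact: derivableP. Qed.

(** At the centre of a chart the frame is the coordinate frame, and the
    derivatives of its coefficients multiply first derivatives of F, which
    vanish at a maximum. *)
Lemma Xd2_at_max k (F : V -> R) : smooth F -> (forall x, F x <= F 0) -> Xd k (Xd k F) 0 <= 0.
Proof.
move=> sF Fmax; have dF := smooth_derivable sF.
have d1 i : partial i F 0 = 0.
  have := @max_deriv1 R _ _ (is_derive_along i dF).
  by rewrite scale0r addr0; apply.
have ddF i : (forall x j, derivable (partial i F) x (delta_mx 0 j)).
  exact: (sF [:: i]).2.
have d2 : partial k (partial k F) 0 <= 0.
  apply: (@max_deriv2 R _ _ _ (is_derive_along k dF)).
    by move=> t; rewrite scale0r !addr0.
  have := is_derive_along k (ddF k) 0.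
  by rewrite scale0r addr0.
suff -> : Xd k (Xd k F) 0 = partial k (partial k F) 0 by [].
rewrite {1}/Xd (bigD1 k)//= frame0 eqxx mul1r big1 ?addr0; last first.
  by move=> i; rewrite frame0 eq_sym => /negbTE ->; rewrite mul0r.
have dM j := is_deriveM (is_derive_chart_eval (frame R k j) 0 k) (derivableP (ddF j 0 k)).
rewrite /partial (_ : Xd k F = \sum_(j < 3) chart_eval (frame R k j) * partial j F); last first.
  by apply/funext => y; rewrite fct_sumE.
rewrite (@derive_val _ _ _ _ _ _ _ (is_derive_sum dM)) (bigD1 k)//= frame0 eqxx d1.
rewrite scale1r scale0r addr0 big1 ?addr0// => j jk.
by rewrite frame0 eq_sym (negbTE jk) d1 !scale0r addr0.
Qed.

Variables a b c : R.
Hypothesis (a0 : 0 < a) (b0 : 0 < b) (c0 : 0 < c).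

Definition Lap (q dq : SU -> R) : Prop :=
  @smooth_on _ _ (SU2_metric a b c) q /\ @is_laplacian _ _ (SU2_metric a b c) q dq.

Lemma LapP q dq : Lap q dq <-> (forall p, smooth (q \o SU2_param p)) /\
  forall p x, dq (SU2_param p x) = - \sum_(k < 3) wt a b c k * Xd k (Xd k (q \o SU2_param p)) x.
Proof.
split=> -[sq dE]; split=> // p x.
  by rewrite -(laplace_coordE a0 b0 c0 p); [exact: dE|exact: sq].
by rewrite dE/= (laplace_coordE a0 b0 c0)//; exact: sq.
Qed.

Lemma Lap_unique q d d' : Lap q d -> Lap q d' -> d = d'.
Proof.
by move=> [_ h] [_ h']; apply/funext => p; rewrite -(param0 p); rewrite (h p 0) (h' p 0).
Qed.

Lemma LapD q dq r dr : Lap q dq -> Lap r dr ->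
  Lap (fun x => q x + r x) (fun x => dq x + dr x).
Proof.
move=> /LapP[sq dqE] /LapP[sr drE]; apply/LapP; split=> p.
  exact: smoothD (sq p) (sr p).
move=> x; rewrite dqE drE -opprD -big_split /=; congr (- _); apply: eq_bigr => k _.
rewrite -mulrDr; congr (_ * _).
have -> : (fun x => q x + r x) \o SU2_param p = (q \o SU2_param p) + (r \o SU2_param p) by [].
rewrite XdD; [|exact: smooth_derivable..].
by rewrite XdD// => y i; exact: derivable_Xd.
Qed.

Lemma LapZ t q dq : Lap q dq -> Lap (fun x => t * q x) (fun x => t * dq x).
Proof.
move=> /LapP[sq dqE]; apply/LapP; split=> p.
  exact: smoothZ (sq p).
move=> x; rewrite dqE mulrN mulr_sumr; congr (- _); apply: eq_bigr => k _.
rewrite mulrCA; congr (_ * _).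
have -> : (fun x => t * q x) \o SU2_param p = t \*: (q \o SU2_param p) by [].
rewrite XdZ; last exact: smooth_derivable.
by rewrite XdZ// => y i; exact: derivable_Xd.
Qed.

Lemma Lap0 : Lap (fun=> 0) (fun=> 0).
Proof.
apply/LapP; split=> [p|p x]; first exact: (smooth_chart_eval (EConst 0)).
have X0 k : Xd k (cst 0 : V -> R) = cst 0.
  by apply/funext => y; rewrite /Xd big1// => j _; rewrite /partial derive_cst mulr0.
rewrite -[_ \o _]/(cst 0 : V -> R) big1 ?oppr0// => k _.
by rewrite !X0 mulr0.
Qed.

(** Left translations permute the charts without changing the Gram matrices. *)
Lemma LapL g q dq : Lap q dq -> Lap (fun x => q (SU2_mul g x)) (fun x => dq (SU2_mul g x)).
Proof.
move=> /LapP[sq dqE]; apply/LapP.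
have E p : (fun x => q (SU2_mul g x)) \o SU2_param p = q \o SU2_param (SU2_mul g p).
  by apply/funext => x /=; rewrite param_mul.
by split=> [p|p x]; rewrite E// -param_mul dqE.
Qed.

Lemma Lap_scont q dq : Lap q dq -> scont q.
Proof. by move=> [sq _]; apply: chart_scont => p; exact: (sq p [::]).1. Qed.

(** At a maximum every X_k X_k u is nonpositive, by the chart centred there. *)
Lemma max_principle u du : Lap u du -> exists2 x, (forall y, u y <= u x) & 0 <= du x.
Proof.
move=> Lu; have [x xmax] := SU2_max (Lap_scont Lu); exists x => //.
move/LapP: Lu => [su duE].
rewrite -(param0 x) duE oppr_ge0; apply: sumr_le0 => k _.
rewrite mulr_ge0_le0 ?sqr_ge0//; apply: Xd2_at_max => // y /=.
by rewrite param0.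
Qed.

(** * The mean of a function, without measure theory *)

(** f has mean t when f - t is a uniform limit of Laplacians. This is the
    normalized Haar integral: Laplacians have integral zero, and conversely a
    polynomial of integral zero is a Laplacian. The maximum principle gives
    positivity and left translations preserve Laplacians, so the integral is
    available on continuous functions without constructing a measure. *)
Definition has_mean (f : SU -> R) (t : R) := forall e : R, 0 < e ->
  exists q dq, Lap q dq /\ forall x, `|f x - t - dq x| <= e.

(** If f - t is within e of the Laplacian of q, then at a maximum of q that
    Laplacian is nonnegative, whence t <= f + e at this point. *)
Lemma mean_le f t B : has_mean f t -> (forall x, f x <= B) -> t <= B.
Proof.
move=> If fB; apply/ler_addgt0Pr => e e0.
have [q [dq [Lq qE]]] := If e e0.
have [x _ dx] := max_principle Lq.
have := qE x; rewrite ler_norml => /andP[h _]; have := fB x; lra.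
Qed.

Lemma meanD f t g u : has_mean f t -> has_mean g u -> has_mean (fun x => f x + g x) (t + u).
Proof.
move=> If Ig e e0; have e2 : 0 < e / 2 by rewrite divr_gt0.
have [q [dq [Lq qE]]] := If _ e2; have [r [dr [Lr rE]]] := Ig _ e2.
exists (fun x => q x + r x), (fun x => dq x + dr x); split; first exact: LapD.
move=> x; have := (qE x, rE x); rewrite !ler_norml => -[/andP[? ?] /andP[? ?]].
by apply/andP; split; lra.
Qed.

Lemma meanZ c' f t : has_mean f t -> has_mean (fun x => c' * f x) (c' * t).
Proof.
move=> If e e0; have c1 : 0 < `|c'| + 1 by rewrite ltr_wpDl.
have [q [dq [Lq qE]]] := If (e / (`|c'| + 1)) (divr_gt0 e0 c1).
exists (fun x => c' * q x), (fun x => c' * dq x); split; first exact: LapZ.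
move=> x; rewrite -!mulrBr normrM.
apply: (@le_trans _ _ (`|c'| * (e / (`|c'| + 1)))); first by rewrite ler_wpM2l.
by rewrite mulrCA ger_pMr// ler_pdivrMr// mul1r lerDl.
Qed.

Lemma mean_cst t : has_mean (fun=> t) t.
Proof.
move=> e e0; exists (fun=> 0), (fun=> 0); split; first exact: Lap0.
by move=> x; rewrite subrr subr0 normr0 ltW.
Qed.

Lemma mean_Lap q dq : Lap q dq -> has_mean dq 0.
Proof.
by move=> Lq e e0; exists q, dq; split=> // x; rewrite subr0 subrr normr0 ltW.
Qed.

Lemma mean_norm f t B : has_mean f t -> (forall x, `|f x| <= B) -> `|t| <= B.
Proof.
move=> If fB; rewrite ler_norml; apply/andP; split.
  rewrite lerNl; have := meanZ (-1) If; rewrite mulN1r => /mean_le; apply => x.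
  by rewrite mulN1r lerNl; have := fB x; rewrite ler_norml => /andP[].
by apply: (mean_le If) => x; have := fB x; rewrite ler_norml => /andP[].
Qed.

Lemma mean_unique f t u : has_mean f t -> has_mean f u -> t = u.
Proof.
move=> If Ig; have := meanD If (meanZ (-1) Ig).
move=> /(@mean_norm _ _ 0) H; apply/eqP; rewrite -subr_eq0 -normr_le0 -mulN1r.
by apply: H => x; rewrite mulN1r subrr normr0.
Qed.

Lemma meanL g f t : has_mean f t -> has_mean (fun x => f (SU2_mul g x)) t.
Proof.
move=> If e e0; have [q [dq [Lq qE]]] := If e e0.
exists (fun x => q (SU2_mul g x)), (fun x => dq (SU2_mul g x)); split; first exact: LapL.
by move=> x; exact: qE.
Qed.

(** Means of approximations form a Cauchy sequence by mean_norm; the limit is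
    taken as a supremum. *)
Lemma mean_lim f : (forall e : R, 0 < e -> exists2 g, exists t, has_mean g t &
  forall x, `|f x - g x| <= e) -> exists t, has_mean f t.
Proof.
move=> H.
have [d d0 d_small] : exists2 d : nat -> R, (forall n, 0 < d n) &
    forall e : R, 0 < e -> exists n, d n <= e.
  exists (fun n => n.+1%:R^-1) => [n|e e0]; first by rewrite invr_gt0.
  exists (Num.bound e^-1).
  rewrite -[leRHS]invrK lef_pV2 ?posrE ?invr_gt0 ?ltr0n//.
  apply/ltW/(lt_le_trans (archi_boundP _)); first by rewrite invr_ge0 ltW.
  by rewrite ler_nat.
have /choice[g gP] : forall n, exists gt : (SU -> R) * R, has_mean gt.1 gt.2 /\
    forall x, `|f x - gt.1 x| <= d n.
  by move=> n; have [|g [t It] gE] := H (d n); [exact: d0|exists (g, t)].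
have gap m n : `|(g m).2 - (g n).2| <= d m + d n.
  have [Im fm] := gP m; have [In fn] := gP n.
  rewrite -mulN1r; apply: (mean_norm (meanD Im (meanZ (-1) In))) => x.
  have := (fm x, fn x); rewrite mulN1r !ler_norml => -[/andP[? ?] /andP[? ?]].
  by apply/andP; split; lra.
pose A := [set (g n).2 - d n | n in [set: nat]].
have A_ub n : ubound A ((g n).2 + d n).
  by move=> _ [m _ <-]; have := gap m n; rewrite ler_norml => /andP[? ?]; lra.
have supA : has_sup A.
  by split; [exists ((g 0%N).2 - d 0%N), 0%N|exists ((g 0%N).2 + d 0%N); exact: A_ub].
exists (sup A) => e e0.
have e3 : 0 < e / 4 by rewrite divr_gt0.
have [n nE] := d_small _ e3.
have [It fg] := gP n.
have [q [dq [Lq qE]]] := It _ e3.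
exists q, dq; split=> // x.
have s1 : sup A <= (g n).2 + d n := ge_sup supA.1 (A_ub n).
have s2 : (g n).2 - d n <= sup A by apply: ub_le_sup; [exact: supA.2|exists n].
have := (fg x, qE x); rewrite !ler_norml => -[/andP[? ?] /andP[? ?]].
apply/andP; split; lra.
Qed.

Lemma mean_approx0 f : (forall e : R, 0 < e -> exists2 g, has_mean g 0 &
  forall x, `|f x - g x| <= e) -> has_mean f 0.
Proof.
move=> H e e0; have e2 : 0 < e / 2 by rewrite divr_gt0.
have [g Ig fg] := H _ e2; have [q [dq [Lq qE]]] := Ig _ e2.
exists q, dq; split=> // x; have := (fg x, qE x).
rewrite !ler_norml => -[/andP[? ?] /andP[? ?]].
by apply/andP; split; lra.
Qed.

(** If f x > 0, finitely many translates of f add up to a function bounded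
    below by a positive constant, by compactness; yet their sum has mean zero. *)
Lemma mean_faithful f : scont f -> (forall x, 0 <= f x) -> has_mean f 0 -> forall x, f x = 0.
Proof.
move=> cf f0 If x; apply/eqP; rewrite eq_le f0 andbT leNgt; apply/negP => fx.
have fx2 : 0 < f x / 2 by rewrite divr_gt0.
(* translating by x y^-1 brings the value f x to the point y *)
pose T y z := f (SU2_mul (SU2_mul x (SU2_inv y)) z).
have [|s sP] := @SU2_cover R (fun y z => f x / 2 <= T y z).
  move=> y; have [r r0 rP] := cf x (f x / 2) fx2.
  exists r => // z; rewrite /T.
  set g := SU2_mul x (SU2_inv y).
  have -> : qdot z y = qdot (SU2_mul g z) x.
    rewrite -!qdot_inv.
    have -> : SU2_inv y = SU2_mul (SU2_inv x) g.
      by rewrite /g SU2_mulA SU2_Vmul SU2_mul1.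
    by rewrite SU2_mulA.
  by move=> /rP; rewrite ltr_norml => /andP[? _]; lra.
have IT y : has_mean (T y) 0 by exact: meanL.
have [G [IG G0 GT]] : exists G, [/\ has_mean G 0, forall z, 0 <= G z &
    forall y z, y \in s -> T y z <= G z].
  elim: s {sP} => [|y l [G [IG G0 GT]]]; first by exists (fun=> 0); split=> //; exact: mean_cst.
  exists (fun z => T y z + G z); split.
  - by have := meanD (IT y) IG; rewrite addr0.
  - by move=> z; rewrite addr_ge0// f0.
  - move=> w z; rewrite inE => /orP[/eqP->|/GT wl]; first by rewrite lerDl.
    by rewrite (le_trans (wl z))// lerDr f0.
have := mean_le (meanZ (-1) IG); rewrite mulr0 => /(_ (- (f x / 2))) H.
suff : 0 <= - (f x / 2) by lra.
apply: H => z; have [y ys h] := sP z; have := GT y z ys; lra.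
Qed.

End max_principle.

(** * Complex functions and left-invariant derivatives *)

Section left_fields.
Variable R : realType.
Local Notation C := R[i].
Local Notation SU := (SU2 R).
Local Notation V := 'rV[R]_3.
Local Notation Re := (@complex.Re R).
Local Notation Im := (@complex.Im R).

Definition chartable (F : SU -> C) : Prop := forall p : SU, exists e1 e2 : chart_expr R,
  forall x, F (SU2_param p x) = chart_eval e1 x +i* chart_eval e2 x.

Definition lderiv_chart (k : 'I_3) (p : SU) (F : SU -> C) (x : V) : C :=
  Xd k (fun x => Re (F (SU2_param p x))) x +i* Xd k (fun x => Im (F (SU2_param p x))) x.

(** G is the derivative of F along the left-invariant field X_k, both being
    elementary in every chart. *)
Definition lderiv (k : 'I_3) (F G : SU -> C) : Prop :=
  [/\ chartable F, chartable G & forall p x, lderiv_chart k p F x = G (SU2_param p x)].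

Lemma Xd_chart_eval k e x :
  Xd k (chart_eval e) x =
  \sum_(j < 3) chart_eval (frame R k j) x * chart_eval (chart_diff j e) x.
Proof. by apply: eq_bigr => j _; rewrite partial_chart_eval. Qed.

Lemma lderiv_chart_eval k p F (e1 e2 : chart_expr R) x :
  (forall y, F (SU2_param p y) = chart_eval e1 y +i* chart_eval e2 y) ->
  lderiv_chart k p F x = Xd k (chart_eval e1) x +i* Xd k (chart_eval e2) x.
Proof.
move=> FE; rewrite /lderiv_chart; congr (Xd k _ x +i* Xd k _ x); apply/funext => y; by rewrite FE.
Qed.

Lemma chartable_cst z : chartable (fun=> z).
Proof. by move=> p; exists (EConst (Re z)), (EConst (Im z)) => x; case: z. Qed.

Lemma chartableD F G : chartable F -> chartable G -> chartable (fun x => F x + G x).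
Proof.
move=> cF cG p; have [e1 [e2 FE]] := cF p; have [e3 [e4 GE]] := cG p.
by exists (EAdd e1 e3), (EAdd e2 e4) => x; rewrite FE GE.
Qed.

Lemma chartableM F G : chartable F -> chartable G -> chartable (fun x => F x * G x).
Proof.
move=> cF cG p; have [e1 [e2 FE]] := cF p; have [e3 [e4 GE]] := cG p.
exists (EAdd (EMul e1 e3) (EMul (EConst (-1)) (EMul e2 e4))), (EAdd (EMul e1 e4) (EMul e2 e3)) => x.
by rewrite FE GE; simpc; apply: eq_complexP => /=; ring.
Qed.

Lemma lderiv_cst k z : lderiv k (fun=> z) (fun=> 0).
Proof.
split; [exact: chartable_cst..|move=> p x].
rewrite (@lderiv_chart_eval _ _ _ (EConst (Re z)) (EConst (Im z))); last by case: z.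
by rewrite !Xd_chart_eval !big1// => j _; rewrite mulr0.
Qed.

Lemma lderivD k F F' G G' : lderiv k F F' -> lderiv k G G' ->
  lderiv k (fun x => F x + G x) (fun x => F' x + G' x).
Proof.
move=> [cF cF' XF] [cG cG' XG]; split; [exact: chartableD..|move=> p x].
rewrite -XF -XG; have [e1 [e2 FE]] := cF p; have [e3 [e4 GE]] := cG p.
rewrite (lderiv_chart_eval _ _ FE) (lderiv_chart_eval _ _ GE) (@lderiv_chart_eval _ _ _ (EAdd e1 e3) (EAdd e2 e4)).
  by rewrite !Xd_chart_eval !sum3; simpc; apply: eq_complexP => /=; ring.
by move=> y; rewrite FE GE.
Qed.

Lemma lderivM k F F' G G' : lderiv k F F' -> lderiv k G G' ->
  lderiv k (fun x => F x * G x) (fun x => F x * G' x + F' x * G x).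
Proof.
move=> [cF cF' XF] [cG cG' XG]; split.
- exact: chartableM.
- by apply: chartableD; exact: chartableM.
move=> p x.
rewrite -XF -XG; have [e1 [e2 FE]] := cF p; have [e3 [e4 GE]] := cG p.
rewrite (lderiv_chart_eval _ _ FE) (lderiv_chart_eval _ _ GE)
  (@lderiv_chart_eval _ _ _ (EAdd (EMul e1 e3) (EMul (EConst (-1)) (EMul e2 e4)))
     (EAdd (EMul e1 e4) (EMul e2 e3))).
  by rewrite !Xd_chart_eval !sum3 FE GE; simpc; apply: eq_complexP => /=; ring.
by move=> y; rewrite FE GE; simpc; apply: eq_complexP => /=; ring.
Qed.

Lemma lderiv_ext k F F' G : lderiv k F F' -> F' = G -> lderiv k F G. Proof. by move=> ? <-. Qed.

Lemma lderivZ k z F F' : lderiv k F F' -> lderiv k (fun x => z * F x) (fun x => z * F' x).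
Proof.
move=> XF; apply: lderiv_ext (lderivM (lderiv_cst k z) XF) _.
by apply/funext => x; rewrite mul0r addr0.
Qed.

Lemma lderiv_sum k n (F F' : 'I_n -> SU -> C) : (forall i, lderiv k (F i) (F' i)) ->
  lderiv k (fun x => \sum_(i < n) F i x) (fun x => \sum_(i < n) F' i x).
Proof.
elim: n F F' => [|n IH] F F' H.
  under eq_fun do rewrite big_ord0.
  by under [X in lderiv _ _ X]eq_fun do rewrite big_ord0; exact: lderiv_cst.
under eq_fun do rewrite big_ord_recl.
under [X in lderiv _ _ X]eq_fun do rewrite big_ord_recl.
by apply: lderivD; [exact: H|apply: IH => i; exact: H].
Qed.

Lemma chartable_ent (r t : 'I_2) : chartable (fun U => U r t).
Proof. by move=> p; exists (ent_re p r t), (ent_im p r t) => x; exact: param_entE. Qed.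

(** The matrix product U X_k, entry by entry: left-invariant fields act by
    right multiplication. *)
Definition entX (k : 'I_3) (r t : 'I_2) (U : SU) : C :=
  nth 0 (if t == 0 then [:: 'i * U r 0; - U r 1; 'i * U r 1]
         else [:: - 'i * U r 1; U r 0; 'i * U r 0]) k.

Local Notation opp e := (EMul (EConst (-1)) e).

Definition capX_re (k : 'I_3) (l t : 'I_2) : chart_expr R :=
  nth (EConst 0) (if t == 0 then [:: opp (cap_im R l 0); opp (cap_re R l 1); opp (cap_im R l 1)]
               else [:: cap_im R l 1; cap_re R l 0; opp (cap_im R l 0)]) k.
Definition capX_im (k : 'I_3) (l t : 'I_2) : chart_expr R :=
  nth (EConst 0) (if t == 0 then [:: cap_re R l 0; opp (cap_im R l 1); cap_re R l 1]
               else [:: opp (cap_re R l 1); cap_im R l 0; cap_re R l 0]) k.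

(** The field X_k differentiates the central parametrization V to V X_k. The
    scalar s contributes - x_k s (s^2 (1 + |x|^2)), and the identity s^2 (1 +
    |x|^2) = 1 turns this into a polynomial identity. *)
Lemma Xd_cap k l t x : Xd k (chart_eval (cap_re R l t)) x = chart_eval (capX_re k l t) x /\
  Xd k (chart_eval (cap_im R l t)) x = chart_eval (capX_im k l t) x.
Proof.
have e : scal x ^+ 2 * (1 + x 0 i0 ^+ 2 + x 0 i1 ^+ 2 + x 0 i2 ^+ 2) - 1 = 0.
  by rewrite scalE subrr.
rewrite !Xd_chart_eval !sum3; split.
- transitivity (chart_eval (capX_re k l t) x - x 0 k * chart_eval (cap_re R l t) x *
    (scal x ^+ 2 * (1 + x 0 i0 ^+ 2 + x 0 i1 ^+ 2 + x 0 i2 ^+ 2) - 1)).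
    by move: t l k {e}; apply: ord2P; apply: ord2P; apply: ord3P => /=; ring.
  by rewrite e mulr0 subr0.
- transitivity (chart_eval (capX_im k l t) x - x 0 k * chart_eval (cap_im R l t) x *
    (scal x ^+ 2 * (1 + x 0 i0 ^+ 2 + x 0 i1 ^+ 2 + x 0 i2 ^+ 2) - 1)).
    by move: t l k {e}; apply: ord2P; apply: ord2P; apply: ord3P => /=; ring.
  by rewrite e mulr0 subr0.
Qed.

Lemma Xd_EAdd k (e f : chart_expr R) (x : V) :
  Xd k (chart_eval (EAdd e f)) x = Xd k (chart_eval e) x + Xd k (chart_eval f) x.
Proof. by rewrite !Xd_chart_eval !sum3 /=; ring. Qed.

Lemma Xd_EConstMul k c (e : chart_expr R) (x : V) :
  Xd k (chart_eval (EMul (EConst c) e)) x = c * Xd k (chart_eval e) x.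
Proof. by rewrite !Xd_chart_eval !sum3 /=; ring. Qed.

Local Arguments cap_re : simpl never.
Local Arguments cap_im : simpl never.

Lemma lderiv_chart_ent k p r t (x : V) : lderiv_chart k p (fun U => U r t) x = entX k r t (SU2_param p x).
Proof.
rewrite (lderiv_chart_eval _ _ (fun y => param_entE p y r t)) /ent_re /ent_im.
rewrite !(Xd_EAdd, Xd_EConstMul) !(Xd_cap _ _ _ _).1 !(Xd_cap _ _ _ _).2.
rewrite /entX !param_entE /ent_re /ent_im.
move: (Re _) (Im _) (Re _) (Im _) => p1 p2 p3 p4.
rewrite /capX_re /capX_im; move: t k; apply: ord2P; apply: ord3P => /=; simpc; apply: eq_complexP => /=; ring.
Qed.

Lemma lderiv_ent k r t : lderiv k (fun U => U r t) (entX k r t).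
Proof.
split; [exact: chartable_ent| |by move=> p x; exact: lderiv_chart_ent].
have cZ z r' t' : chartable (fun U => z * U r' t').
  by apply: chartableM; [exact: chartable_cst|exact: chartable_ent].
have cN r' t' : chartable (fun U => - U r' t').
  by under eq_fun do rewrite -mulN1r; exact: cZ.
rewrite /entX; move: t k; apply: ord2P; apply: ord3P => /=;
  by [exact: cZ|exact: cN|exact: chartable_ent].
Qed.

End left_fields.

(** * Matrix coefficients of the symmetric powers *)

Section matrix_coefficients.
Variable R : realType.
Local Notation C := R[i].
Local Notation SU := (SU2 R).

(** Polynomial-valued functions are differentiated coefficientwise; the
    product rule survives because coefficients of a product are finite sums of
    products. *)
Definition lderiv_poly (k : 'I_3) (P Q : SU -> {poly C}) : Prop :=
  forall m, lderiv k (fun U => (P U)`_m) (fun U => (Q U)`_m).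

Lemma lderiv_poly_ext k P Q Q' : lderiv_poly k P Q -> Q =1 Q' -> lderiv_poly k P Q'.
Proof. by move=> h /funext <-. Qed.

Lemma lderiv_polyM k P P' Q Q' : lderiv_poly k P P' -> lderiv_poly k Q Q' ->
  lderiv_poly k (fun U => P U * Q U) (fun U => P U * Q' U + P' U * Q U).
Proof.
move=> XP XQ m; under eq_fun do rewrite coefM.
under [X in lderiv _ _ X]eq_fun do rewrite coefD !coefM -big_split /=.
by apply: lderiv_sum => i; exact: lderivM.
Qed.

Lemma lderiv_poly_cst k P : lderiv_poly k (fun=> P) (fun=> 0).
Proof. move=> m; under [X in lderiv _ _ X]eq_fun do rewrite coef0; exact: lderiv_cst. Qed.

Lemma lderiv_polyD k P P' Q Q' : lderiv_poly k P P' -> lderiv_poly k Q Q' ->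
  lderiv_poly k (fun U => P U + Q U) (fun U => P' U + Q' U).
Proof.
move=> XP XQ m; under eq_fun do rewrite coefD.
under [X in lderiv _ _ X]eq_fun do rewrite coefD.
exact: lderivD.
Qed.

Lemma lderiv_polyZ k z P P' : lderiv_poly k P P' -> lderiv_poly k (fun U => z *: P U) (fun U => z *: P' U).
Proof.
move=> XP m; under eq_fun do rewrite coefZ.
under [X in lderiv _ _ X]eq_fun do rewrite coefZ.
exact: lderivZ.
Qed.

(** The two linear forms u (t = 0) and v (t = 1): the row vector (X, 1)
    multiplied by U. Right multiplication by a group element acts on the pair
    (u, v) linearly. *)
Definition colpoly (t : 'I_2) (U : SU) : {poly C} := U 0 t *: 'X + (U 1 t)%:P.

Lemma lderiv_poly_col k t : lderiv_poly k (colpoly t) (fun U => entX k 0 t U *: 'X + (entX k 1 t U)%:P).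
Proof.
move=> m; rewrite /colpoly.
under eq_fun do rewrite coefD coefZ coefX coefC.
under [X in lderiv _ _ X]eq_fun do rewrite coefD coefZ coefX coefC.
apply: lderivD; last by case: (m == 0%N); [exact: lderiv_ent|exact: lderiv_cst].
case: (m == 1%N).
  by under eq_fun do rewrite mulr1; under [X in lderiv _ _ X]eq_fun do rewrite mulr1; exact: lderiv_ent.
by under eq_fun do rewrite mulr0; under [X in lderiv _ _ X]eq_fun do rewrite mulr0; exact: lderiv_cst.
Qed.

Definition colX (k : 'I_3) (t : 'I_2) (U : SU) : {poly C} :=
  nth 0 (if t == 0 then [:: 'i *: colpoly 0 U; - colpoly 1 U; 'i *: colpoly 1 U]
         else [:: - 'i *: colpoly 1 U; colpoly 0 U; 'i *: colpoly 0 U]) k.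

Lemma lderiv_poly_colX k t : lderiv_poly k (colpoly t) (colX k t).
Proof.
apply: lderiv_poly_ext (lderiv_poly_col k t) _ => U; rewrite /colX /colpoly /entX.
by move: t k; apply: ord2P; apply: ord3P => /=;
  rewrite ?scalerDr ?scalerA -?mul_polyC ?polyCM ?polyCN; ring.
Qed.

(** The weight vector u^p v^q of the symmetric power of degree p + q; its
    coefficients are the matrix coefficients of that representation. *)
Definition gpoly (p q : nat) (U : SU) : {poly C} := colpoly 0 U ^+ p * colpoly 1 U ^+ q.

Lemma lderiv_poly_exp k P P' n : lderiv_poly k P P' ->
  lderiv_poly k (fun U => P U ^+ n) (fun U => n%:R * P U ^+ n.-1 * P' U).
Proof.
move=> XP; elim: n => [|n IH].
  under eq_fun do rewrite expr0; apply: lderiv_poly_ext (lderiv_poly_cst k 1) _ => U.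
  by rewrite !mul0r.
under eq_fun do rewrite exprS; apply: lderiv_poly_ext (lderiv_polyM XP IH) _ => U /=.
by case: n {IH} => [|n] /=; rewrite -?natr1 ?exprS; ring.
Qed.

Lemma lderiv_gpoly k p q : lderiv_poly k (gpoly p q)
  (fun U => q%:R * colX k 1 U * gpoly p q.-1 U + p%:R * colX k 0 U * gpoly p.-1 q U).
Proof.
apply: lderiv_poly_ext (lderiv_polyM (lderiv_poly_exp p (lderiv_poly_colX k 0))
  (lderiv_poly_exp q (lderiv_poly_colX k 1))) _ => U.
rewrite /gpoly; ring.
Qed.

(** u and v are weight vectors of X_1, of weights i and - i. *)
Lemma lderiv1_gpoly p q : lderiv_poly i0 (gpoly p q) (fun U => ('i * (p%:R - q%:R)) *: gpoly p q U).
Proof.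
apply: lderiv_poly_ext (lderiv_gpoly i0 p q) _ => U; rewrite /colX /gpoly /= -!mul_polyC.
rewrite polyCM polyCB !polyC_natr polyCN.
by case: p => [|p]; case: q => [|q] /=; rewrite ?exprS; ring.
Qed.

Lemma lderiv2_gpoly p q : lderiv_poly i1 (gpoly p q)
  (fun U => - p%:R *: gpoly p.-1 q.+1 U + q%:R *: gpoly p.+1 q.-1 U).
Proof.
apply: lderiv_poly_ext (lderiv_gpoly i1 p q) _ => U; rewrite /colX /gpoly /= -!mul_polyC.
rewrite polyCN !polyC_natr ?exprS; ring.
Qed.

Lemma lderiv3_gpoly p q : lderiv_poly i2 (gpoly p q)
  (fun U => ('i * p%:R) *: gpoly p.-1 q.+1 U + ('i * q%:R) *: gpoly p.+1 q.-1 U).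
Proof.
apply: lderiv_poly_ext (lderiv_gpoly i2 p q) _ => U; rewrite /colX /gpoly /= -!mul_polyC.
rewrite !polyCM !polyC_natr ?exprS; ring.
Qed.

Lemma lderiv11_gpoly p q : lderiv_poly i0 (fun U => ('i * (p%:R - q%:R)) *: gpoly p q U)
   (fun U => - (p%:R - q%:R) ^+ 2 *: gpoly p q U).
Proof.
apply: lderiv_poly_ext (lderiv_polyZ _ (lderiv1_gpoly p q)) _ => U.
by rewrite scalerA; congr (_ *: _); rewrite mulrACA -expr2 sqrCi expr2 mulN1r.
Qed.

Definition X2g p q (U : SU) := - p%:R *: gpoly p.-1 q.+1 U + q%:R *: gpoly p.+1 q.-1 U.
Definition X3g p q (U : SU) := ('i * p%:R) *: gpoly p.-1 q.+1 U + ('i * q%:R) *: gpoly p.+1 q.-1 U.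

Definition mcoef (p q m : nat) (U : SU) : C := (gpoly p q U)`_m.

(** The value of nu for k = p + q and j = q, symmetric in p and q. *)
Definition eigenval (a b : R) (p q : nat) : R :=
  a ^+ 2 * (p%:R - q%:R) ^+ 2 + b ^+ 2 * (4 * p%:R * q%:R + 2 * p%:R + 2 * q%:R).

Definition LapC (a b c : R) (F dF : SU -> C) : Prop :=
  Lap a b c (fun x => complex.Re (F x)) (fun x => complex.Re (dF x)) /\
  Lap a b c (fun x => complex.Im (F x)) (fun x => complex.Im (dF x)).

Lemma chartable_smooth (F : SU -> C) : chartable F -> forall p,
  smooth ((fun x => complex.Re (F x)) \o SU2_param p) /\
  smooth ((fun x => complex.Im (F x)) \o SU2_param p).
Proof.
move=> cF p; have [e1 [e2 FE]] := cF p.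
rewrite (_ : (fun x => complex.Re (F x)) \o SU2_param p = chart_eval e1); last first.
  by apply/funext => x /=; rewrite FE.
rewrite (_ : (fun x => complex.Im (F x)) \o SU2_param p = chart_eval e2); last first.
  by apply/funext => x /=; rewrite FE.
by split; exact: smooth_chart_eval.
Qed.

Lemma lderiv_LapC (a b c : R) (F : SU -> C) (G H : 'I_3 -> SU -> C) : 0 < a -> 0 < b -> 0 < c ->
  (forall k, lderiv k F (G k)) -> (forall k, lderiv k (G k) (H k)) ->
  LapC a b c F (fun x => - \sum_(k < 3) (wt a b c k)%:C * H k x).
Proof.
move=> a0 b0 c0 FG GH.
have cF : chartable F by case: (FG i0).
have XE k p x : Xd k (Xd k ((fun x => complex.Re (F x)) \o SU2_param p)) x = complex.Re (H k (SU2_param p x)) /\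
    Xd k (Xd k ((fun x => complex.Im (F x)) \o SU2_param p)) x = complex.Im (H k (SU2_param p x)).
  have [_ _ E1] := FG k; have [_ _ E2] := GH k.
  rewrite -E2 /lderiv_chart /=; split; congr (Xd k _ x); apply/funext => y; rewrite -E1 //.
split; apply/(LapP a0 b0 c0); split=> [p|p x].
- by case: (chartable_smooth cF p).
- rewrite raddfN raddf_sum; congr (- _); apply: eq_bigr => k _.
  by rewrite (XE k p x).1; case: (H k _) => u w /=; rewrite mul0r subr0.
- by case: (chartable_smooth cF p).
- rewrite raddfN raddf_sum; congr (- _); apply: eq_bigr => k _.
  by rewrite (XE k p x).2; case: (H k _) => u w /=; rewrite mul0r addr0.
Qed.

(** Applying X_2 and X_3 twice to u^p v^q produces u^(p-2) v^(q+2) and u^(p+2)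
    v^(q-2) with opposite coefficients, so they cancel in X_2^2 + X_3^2 and
    u^p v^q remains with coefficient - (4pq + 2p + 2q). This cancellation is
    where the equality of the last two weights is used. *)
Lemma LapC_mcoef a b p q m : 0 < a -> 0 < b ->
  LapC a b b (mcoef p q m) (fun U => (eigenval a b p q)%:C * mcoef p q m U).
Proof.
move=> a0 b0.
have X22 := lderiv_polyD (lderiv_polyZ (- p%:R) (lderiv2_gpoly p.-1 q.+1))
  (lderiv_polyZ q%:R (lderiv2_gpoly p.+1 q.-1)).
pose Y p q (U : SU) := - p%:R *: gpoly p.-1 q.+1 U + - q%:R *: gpoly p.+1 q.-1 U.
have X33 : lderiv_poly i2 (X3g p q) (fun U => p%:R *: Y p.-1 q.+1 U + q%:R *: Y p.+1 q.-1 U).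
  apply: lderiv_poly_ext (lderiv_polyD (lderiv_polyZ ('i * p%:R) (lderiv3_gpoly p.-1 q.+1))
    (lderiv_polyZ ('i * q%:R) (lderiv3_gpoly p.+1 q.-1))) _ => U.
  rewrite /Y /= !scalerDr !scalerA.
  have ii (x y : C) : ('i * x) * ('i * y) = - (x * y).
    by rewrite mulrACA -expr2 sqrCi mulN1r.
  by rewrite !ii !mulrN.
pose D1 (k : 'I_3) := nth (fun=> 0) [:: fun U : SU => ('i * (p%:R - q%:R)) *: gpoly p q U; X2g p q; X3g p q] k.
pose D2 (k : 'I_3) := nth (fun=> 0) [:: fun U : SU => - (p%:R - q%:R) ^+ 2 *: gpoly p q U;
  fun U => (- p%:R) *: X2g p.-1 q.+1 U + q%:R *: X2g p.+1 q.-1 U;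
  fun U => p%:R *: Y p.-1 q.+1 U + q%:R *: Y p.+1 q.-1 U] k.
have h1 k : lderiv_poly k (gpoly p q) (D1 k).
  by move: k; apply: ord3P; [exact: lderiv1_gpoly|exact: lderiv2_gpoly|exact: lderiv3_gpoly].
have h2 k : lderiv_poly k (D1 k) (D2 k).
  by move: k; apply: ord3P; [exact: lderiv11_gpoly|exact: X22|exact: X33].
have := lderiv_LapC a0 b0 b0 (fun k => h1 k m) (fun k => h2 k m).
congr LapC; apply/funext => U.
rewrite sum3 /wt /D2 /= /mcoef /X2g /Y /= !(coefD, coefZ) /eigenval.
rewrite !(rmorphD, rmorphN, rmorphM, rmorphXn, rmorph1, rmorph_nat) /=.
case: p q {X22 X33 D1 D2 h1 h2} => [|p] [|q] /=. all: ring.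
Qed.

End matrix_coefficients.

(** * The algebra of matrix coefficients *)

Section cspan.
Variable R : realType.
Local Notation C := R[i].
Local Notation SU := (SU2 R).

Inductive cspan : (SU -> C) -> Prop :=
| CSpan0 : cspan (fun=> 0)
| CSpanC (z : C) p q m F : cspan F -> cspan (fun U => z * mcoef p q m U + F U).

Lemma cspanD F G : cspan F -> cspan G -> cspan (fun U => F U + G U).
Proof.
move=> sF sG; elim: sF => [|z p q m {}F _ IH].
  by under eq_fun do rewrite add0r.
by under eq_fun do rewrite -addrA; exact: CSpanC.
Qed.

Lemma cspanZ z F : cspan F -> cspan (fun U => z * F U).
Proof.
elim=> [|w p q m {}F _ IH]; first by under eq_fun do rewrite mulr0; exact: CSpan0.
by under eq_fun do rewrite mulrDr mulrA; exact: CSpanC.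
Qed.

Lemma cspan_mcoef p q m : cspan (mcoef p q m).
Proof.
have := CSpanC 1 p q m CSpan0; congr cspan; apply/funext => U.
by rewrite mul1r addr0.
Qed.

Lemma mcoef00 m (U : SU) : mcoef 0 0 m U = (m == 0%N)%:R.
Proof. by rewrite /mcoef /gpoly !expr0 mulr1 coef1. Qed.

Lemma cspan_cst z : cspan (fun=> z).
Proof.
have := cspanZ z (cspan_mcoef 0 0 0); congr cspan; apply/funext => U.
by rewrite mcoef00 mulr1.
Qed.

Lemma SU2_det (U : SU) : U 0 0 * U 1 1 - U 0 1 * U 1 0 = 1.
Proof.
case/andP: (SU2_valP U) => _ /eqP; rewrite (expand_det_row _ 0) sum2 /cofactor !det_mx11 !mxE.
have -> : lift 0 0 = 1 :> 'I_2 by apply: val_inj.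
have -> : lift 1 0 = 0 :> 'I_2 by apply: val_inj.
by rewrite /= modn_small// expr0 expr1 mul1r mulN1r mulrN.
Qed.

(** The left-hand side is the determinant of U. *)
Lemma col_wronskian (U : SU) : (U 0 0)%:P * colpoly 1 U - (U 0 1)%:P * colpoly 0 U = 1.
Proof.
transitivity (U 0 0 * U 1 1 - U 0 1 * U 1 0)%:P; last by rewrite SU2_det.
rewrite /colpoly -!mul_polyC polyCB !polyCM; ring.
Qed.

Lemma deriv_colpoly t (U : SU) : (colpoly t U)^`() = (U 0 t)%:P.
Proof. by rewrite derivD derivZ derivX derivC addr0 alg_polyC. Qed.

Lemma deriv_gpoly p q (U : SU) : (gpoly p q U)^`() =
  p%:R * (U 0 0)%:P * gpoly p.-1 q U + q%:R * (U 0 1)%:P * gpoly p q.-1 U.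
Proof.
rewrite /gpoly derivM !deriv_exp !deriv_colpoly -[_ *+ p]mulr_natl -[_ *+ q]mulr_natl; ring.
Qed.

Lemma gpolyS0 p q (U : SU) : gpoly p.+1 q U = colpoly 0 U * gpoly p q U.
Proof. by rewrite /gpoly exprS mulrA. Qed.
Lemma gpoly0S p q (U : SU) : gpoly p q.+1 U = colpoly 1 U * gpoly p q U.
Proof. by rewrite /gpoly exprS mulrCA. Qed.

(** Clebsch-Gordan for the product with the standard representation: entry
    times u^p v^q splits into the derivative of a weight vector of degree p +
    q + 1, which only rescales and shifts coefficients, and a weight vector of
    degree p + q - 1. The second part appears through the determinant relation
    col_wronskian; the three other entries are similar, the second row using
    the derivative in the homogenizing variable. *)
Lemma mul_gpoly00 p q (U : SU) : (p + q).+1%:R * (U 0 0)%:P * gpoly p q U =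
  (gpoly p.+1 q U)^`() + q%:R * gpoly p q.-1 U.
Proof.
have W := col_wronskian U; apply/eqP; rewrite -subr_eq0; apply/eqP.
transitivity (q%:R * gpoly p q.-1 U *
    ((U 0 0)%:P * colpoly 1 U - (U 0 1)%:P * colpoly 0 U - 1)); last by rewrite W subrr mulr0.
rewrite deriv_gpoly -natr1 natrD.
by case: q => [|q] /=; rewrite ?gpolyS0 ?gpoly0S -?natr1; ring.
Qed.

Lemma mul_gpoly01 p q (U : SU) : (p + q).+1%:R * (U 0 1)%:P * gpoly p q U =
  (gpoly p q.+1 U)^`() - p%:R * gpoly p.-1 q U.
Proof.
have W := col_wronskian U; apply/eqP; rewrite -subr_eq0; apply/eqP.
transitivity (- (p%:R * gpoly p.-1 q U *
    ((U 0 0)%:P * colpoly 1 U - (U 0 1)%:P * colpoly 0 U - 1))); last by rewrite W subrr mulr0 oppr0.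
rewrite deriv_gpoly -natr1 natrD.
by case: p => [|p] /=; rewrite ?gpolyS0 ?gpoly0S -?natr1; ring.
Qed.

Lemma mul_gpoly10 p q (U : SU) : (p + q).+1%:R * (U 1 0)%:P * gpoly p q U =
  (p + q).+1%:R * gpoly p.+1 q U - 'X * (gpoly p.+1 q U)^`() - q%:R * 'X * gpoly p q.-1 U.
Proof.
have W := col_wronskian U; apply/eqP; rewrite -subr_eq0; apply/eqP.
transitivity (- (q%:R * 'X * gpoly p q.-1 U *
    ((U 0 0)%:P * colpoly 1 U - (U 0 1)%:P * colpoly 0 U - 1))); last by rewrite W subrr mulr0 oppr0.
have -> : (U 1 0)%:P = colpoly 0 U - (U 0 0)%:P * 'X by rewrite /colpoly -mul_polyC; ring.
rewrite deriv_gpoly -natr1 natrD.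
by case: q => [|q] /=; rewrite ?gpolyS0 ?gpoly0S -?natr1; ring.
Qed.

Lemma mul_gpoly11 p q (U : SU) : (p + q).+1%:R * (U 1 1)%:P * gpoly p q U =
  (p + q).+1%:R * gpoly p q.+1 U - 'X * (gpoly p q.+1 U)^`() + p%:R * 'X * gpoly p.-1 q U.
Proof.
have W := col_wronskian U; apply/eqP; rewrite -subr_eq0; apply/eqP.
transitivity (p%:R * 'X * gpoly p.-1 q U *
    ((U 0 0)%:P * colpoly 1 U - (U 0 1)%:P * colpoly 0 U - 1)); last by rewrite W subrr mulr0.
have -> : (U 1 1)%:P = colpoly 1 U - (U 0 1)%:P * 'X by rewrite /colpoly -mul_polyC; ring.
rewrite deriv_gpoly -natr1 natrD.
by case: p => [|p] /=; rewrite ?gpolyS0 ?gpoly0S -?natr1; ring.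
Qed.

Lemma cspan_coef_shift (P : SU -> {poly C}) :
  (forall m, cspan (fun U => (P U)`_m)) -> forall m, cspan (fun U => ('X * P U)`_m).
Proof.
move=> sP [|m]; under eq_fun do rewrite coefXM /=; first exact: CSpan0.
exact: sP.
Qed.

Lemma cspan_coef_deriv (P : SU -> {poly C}) :
  (forall m, cspan (fun U => (P U)`_m)) -> forall m, cspan (fun U => ((P U)^`())`_m).
Proof.
move=> sP m; under eq_fun do rewrite coef_deriv -mulr_natl.
exact: cspanZ.
Qed.

(** Multiplication by an entry maps coefficients of degree k to coefficients
    of degrees k + 1 and k - 1, so the span is stable. *)
Lemma cspan_ent_mcoef r t p q m : cspan (fun U => U r t * mcoef p q m U).
Proof.
have n0 : (p + q).+1%:R != 0 :> C by rewrite pnatr_eq0.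
suff : cspan (fun U => ((p + q).+1%:R * (U r t)%:P * gpoly p q U)`_m).
  move=> /(cspanZ (p + q).+1%:R^-1); congr cspan; apply/funext => U.
  by rewrite -polyC_natr -polyCM coefCM mulrA mulrA mulVf// mul1r.
have sg p' q' m' : cspan (fun U => (gpoly p' q' U)`_m') := cspan_mcoef p' q' m'.
have sZ n (P : SU -> {poly C}) m' : (forall m, cspan (fun U => (P U)`_m)) -> cspan (fun U => (n%:R * P U)`_m').
  by move=> sP; under eq_fun do rewrite -polyC_natr coefCM; exact: cspanZ.
have sN (P : SU -> {poly C}) m' : (forall m, cspan (fun U => (P U)`_m)) -> cspan (fun U => (- P U)`_m').
  by move=> sP; under eq_fun do rewrite coefN -mulN1r; exact: cspanZ.
have sD (P Q : SU -> {poly C}) m' : (forall m, cspan (fun U => (P U)`_m)) ->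
    (forall m, cspan (fun U => (Q U)`_m)) -> cspan (fun U => (P U + Q U)`_m').
  by move=> sP sQ; under eq_fun do rewrite coefD; exact: cspanD.
move: r t; apply: ord2P; apply: ord2P.
- under eq_fun do rewrite mul_gpoly00.
  by apply: (sD _ _ _) => m'; [exact: cspan_coef_deriv|exact: sZ].
- under eq_fun do rewrite mul_gpoly01.
  by apply: (sD _ _ _) => m'; [exact: cspan_coef_deriv|apply: (sN _ _) => m2; exact: sZ].
- under eq_fun do rewrite mul_gpoly10 -[_ * 'X * _]mulrA.
  apply: (sD _ _ _) => m'; first apply: (sD _ _ _) => m2; first exact: sZ.
    by apply: (sN _ _) => m3; apply: cspan_coef_shift => m4; exact: cspan_coef_deriv.
  by apply: (sN _ _) => m2; apply: (sZ _ _ _) => m3; exact: cspan_coef_shift.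
- under eq_fun do rewrite mul_gpoly11 -[_ * 'X * _]mulrA.
  apply: (sD _ _ _) => m'; first apply: (sD _ _ _) => m2; first exact: sZ.
    by apply: (sN _ _) => m3; apply: cspan_coef_shift => m4; exact: cspan_coef_deriv.
  by apply: (sZ _ _ _) => m3; exact: cspan_coef_shift.
Qed.

Lemma cspan_entM r t F : cspan F -> cspan (fun U => U r t * F U).
Proof.
elim=> [|z p q m {}F _ IH]; first by under eq_fun do rewrite mulr0; exact: CSpan0.
under eq_fun do rewrite mulrDr mulrCA.
by apply: cspanD => //; apply: cspanZ; exact: cspan_ent_mcoef.
Qed.

Lemma mcoefS0 p q m (U : SU) : mcoef p.+1 q m U =
  U 0 0 * (if m is m'.+1 then mcoef p q m' U else 0) + U 1 0 * mcoef p q m U.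
Proof.
rewrite /mcoef gpolyS0 /colpoly mulrDl -scalerAl coefD coefZ coefXM coefCM.
by case: m.
Qed.

Lemma mcoef0S p q m (U : SU) : mcoef p q.+1 m U =
  U 0 1 * (if m is m'.+1 then mcoef p q m' U else 0) + U 1 1 * mcoef p q m U.
Proof.
rewrite /mcoef gpoly0S /colpoly mulrDl -scalerAl coefD coefZ coefXM coefCM.
by case: m.
Qed.

(** Every matrix coefficient is a polynomial in the entries of U, by the
    recurrences obtained from multiplying by u or v. *)
Lemma mcoef_ind (P : (SU -> C) -> Prop) :
  P (fun=> 0) -> P (fun=> 1) ->
  (forall F G, P F -> P G -> P (fun U => F U + G U)) ->
  (forall r t F, P F -> P (fun U => U r t * F U)) -> forall p q m, P (mcoef p q m).
Proof.
move=> P0 P1 PD PM; elim=> [|p IHp] q.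
  elim: q => [|q IHq] m.
    by rewrite (funext (mcoef00 m)); case: m.
  rewrite (funext (mcoef0S 0 q m)); apply: PD; apply: PM => //.
  by case: m => [|m].
move=> m; rewrite (funext (mcoefS0 p q m)); apply: PD; apply: PM => //.
by case: m => [|m].
Qed.

Lemma cspanM F G : cspan F -> cspan G -> cspan (fun U => F U * G U).
Proof.
move=> sF sG; elim: sF => [|z p q m {}F _ IH].
  by under eq_fun do rewrite mul0r; exact: CSpan0.
under eq_fun do rewrite mulrDl -mulrA.
apply: cspanD => //; apply: cspanZ => {F IH z}.
move: p q m; apply: (mcoef_ind (P := fun F => cspan (fun U => F U * G U))) => [||F1 F2 s1 s2|r t F1 s1].
- by under eq_fun do rewrite mul0r; exact: CSpan0.
- by under eq_fun do rewrite mul1r.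
- by under eq_fun do rewrite mulrDl; exact: cspanD.
- by under eq_fun do rewrite -mulrA; exact: cspan_entM.
Qed.

Lemma SU2_conjE (U : SU) : [/\ (U 0 0)^* = U 1 1, (U 0 1)^* = - U 1 0,
  (U 1 0)^* = - U 0 1 & (U 1 1)^* = U 0 0].
Proof.
have [[[+ +] +] +] := SU2_row1 U.
case: (val U 0 0) (val U 0 1) (val U 1 0) (val U 1 1) => [? ?] [? ?] [? ?] [? ?] /= *.
by split; apply: eq_complexP => /=; lra.
Qed.

(** Conjugation exchanges the entries of U up to sign. *)
Lemma cspan_conj F : cspan F -> cspan (fun U => (F U)^*).
Proof.
elim=> [|z p q m {}F _ IH]; first by under eq_fun do rewrite rmorph0; exact: CSpan0.
under eq_fun do rewrite rmorphD rmorphM.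
apply: cspanD => //; apply: cspanZ => {F IH z}.
move: p q m; apply: (mcoef_ind (P := fun F => cspan (fun U => (F U)^*))) => [||F1 F2 s1 s2|r t F1 s1].
- by under eq_fun do rewrite rmorph0; exact: CSpan0.
- by under eq_fun do rewrite rmorph1; exact: cspan_cst.
- by under eq_fun do rewrite rmorphD; exact: cspanD.
- under eq_fun do rewrite rmorphM.
  have sN r' t' : cspan (fun U => - U r' t' * (F1 U)^*).
    by under eq_fun do rewrite -mulN1r -mulrA; apply: cspanZ; exact: cspan_entM.
  move: r t; apply: ord2P; apply: ord2P.
  + rewrite (_ : (fun _ => _) = fun U : SU => U 1 1 * (F1 U)^*); first exact: cspan_entM.
    by apply/funext => U; congr (_ * _); case: (SU2_conjE U).
  + rewrite (_ : (fun _ => _) = fun U : SU => - U 1 0 * (F1 U)^*); first exact: sN.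
    by apply/funext => U; congr (_ * _); case: (SU2_conjE U).
  + rewrite (_ : (fun _ => _) = fun U : SU => - U 0 1 * (F1 U)^*); first exact: sN.
    by apply/funext => U; congr (_ * _); case: (SU2_conjE U).
  + rewrite (_ : (fun _ => _) = fun U : SU => U 0 0 * (F1 U)^*); first exact: cspan_entM.
    by apply/funext => U; congr (_ * _); case: (SU2_conjE U).
Qed.

Lemma cspan_ent r t : cspan (fun U => U r t).
Proof.
have := cspan_entM r t (cspan_cst 1); congr cspan; apply/funext => U.
by rewrite mulr1.
Qed.

(** qdot x y is the real part of x00 times conj y00 plus x01 times conj y01. *)
Lemma cspan_qdot_poly f : qdot_poly f -> cspan (fun x => (f x)%:C).
Proof.
elim=> [c|y|{}f g _ sf _ sg|{}f g _ sf _ sg].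
- exact: cspan_cst.
- pose Fz (w z : C) U := (U : SU) 0 0 * w + (U : SU) 0 1 * z.
  have sF w z : cspan (Fz w z).
    by apply: cspanD; under eq_fun do rewrite mulrC; apply: cspanZ; exact: cspan_ent.
  have sG := sF ((y 0 0)^*) ((y 0 1)^*).
  have := cspanZ (2^-1) (cspanD sG (cspan_conj sG)); congr cspan; apply/funext => x.
  rewrite /Fz /qdot sum3 !mxE /=.
  case: (val x 0 0) (val x 0 1) (val y 0 0) (val y 0 1) => [x1 x2] [x3 x4] [y1 y2] [y3 y4] /=.
  by simpc; apply: eq_complexP => /=; field.
- by under eq_fun do rewrite rmorphD; exact: cspanD.
- by under eq_fun do rewrite rmorphM; exact: cspanM.
Qed.

End cspan.

(** * Orthogonality of eigenfunctions *)

Section orthogonality.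
Variable R : realType.
Local Notation C := R[i].
Local Notation SU := (SU2 R).
Local Notation Re := (@complex.Re R).
Local Notation Im := (@complex.Im R).
Variables a b : R.
Hypotheses (a0 : 0 < a) (b0 : 0 < b).
Local Notation LapC := (LapC a b b).
Local Notation Lap := (Lap a b b).
Local Notation has_mean := (has_mean a b b).

Definition has_meanC (F : SU -> C) (t : C) :=
  has_mean (fun x => Re (F x)) (Re t) /\ has_mean (fun x => Im (F x)) (Im t).

Lemma eq_mean f g t : has_mean f t -> f =1 g -> has_mean g t. Proof. by move=> ? /funext <-. Qed.
Lemma eq_meanC F G t : has_meanC F t -> F =1 G -> has_meanC G t. Proof. by move=> ? /funext <-. Qed.

Lemma meanCD F s G t : has_meanC F s -> has_meanC G t -> has_meanC (fun x => F x + G x) (s + t).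
Proof.
move=> [F1 F2] [G1 G2]; split.
  by have := meanD a0 b0 b0 F1 G1; rewrite raddfD => /eq_mean; apply => x; rewrite raddfD.
by have := meanD a0 b0 b0 F2 G2; rewrite raddfD => /eq_mean; apply => x; rewrite raddfD.
Qed.

Lemma meanCZ z F t : has_meanC F t -> has_meanC (fun x => z * F x) (z * t).
Proof.
case: z => z1 z2 [F1 F2]; case: t F1 F2 => t1 t2 F1 F2; split => /=.
  have := meanD a0 b0 b0 (meanZ a0 b0 b0 z1 F1) (meanZ a0 b0 b0 (- z2) F2).
  by rewrite mulNr => /eq_mean; apply => x; case: (F x) => /= *; rewrite mulNr.
have := meanD a0 b0 b0 (meanZ a0 b0 b0 z1 F2) (meanZ a0 b0 b0 z2 F1).
by move=> /eq_mean; apply => x; case: (F x).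
Qed.

Lemma meanC_cst t : has_meanC (fun=> t) t.
Proof. by split; apply: mean_cst. Qed.

Lemma meanC_sum n (F : 'I_n -> SU -> C) (t : 'I_n -> C) : (forall i, has_meanC (F i) (t i)) ->
  has_meanC (fun x => \sum_(i < n) F i x) (\sum_(i < n) t i).
Proof.
elim: n F t => [|n IH] F t H.
  by rewrite big_ord0; apply: eq_meanC (meanC_cst 0) _ => x; rewrite big_ord0.
rewrite big_ord_recl; apply: eq_meanC (meanCD (H ord0) (IH _ _ (fun i => H (lift ord0 i)))) _ => x.
by rewrite big_ord_recl.
Qed.

Lemma meanC_LapC F dF : LapC F dF -> has_meanC dF 0.
Proof. by move=> [h1 h2]; split; [exact: mean_Lap h1|exact: mean_Lap h2]. Qed.

Lemma eigenval_gt0 p q : (0 < p + q)%N -> 0 < eigenval a b p q.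
Proof.
move=> pq.
have h : 0 < 2 * p%:R + 2 * q%:R :> R by rewrite -mulrDr -natrD mulr_gt0// ltr0n.
have h2 : 0 <= 4 * p%:R * q%:R :> R by rewrite !mulr_ge0.
rewrite /eigenval ltr_wpDl//; first by rewrite mulr_ge0 ?sqr_ge0.
by rewrite mulr_gt0 ?exprn_gt0// -addrA ltr_wpDl.
Qed.

Lemma eigenval_ge0 p q : 0 <= eigenval a b p q.
Proof.
have [|/eigenval_gt0/ltW//] := posnP (p + q).
move/eqP; rewrite addn_eq0 => /andP[/eqP-> /eqP->].
by rewrite /eigenval subrr expr0n /= !mulr0 !addr0 mulr0.
Qed.

(** With a nonzero eigenvalue, the function is itself the Laplacian of a
    multiple of itself. *)
Lemma meanC_mcoef p q m : (0 < p + q)%N -> has_meanC (mcoef p q m) 0.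
Proof.
move=> pq; have := meanCZ (eigenval a b p q)%:C^-1 (meanC_LapC (LapC_mcoef p q m a0 b0)).
rewrite mulr0 => /eq_meanC; apply => x; rewrite mulrA mulVf ?mul1r//.
by apply/eqP => /(congr1 Re) /= /eqP; rewrite gt_eqF// eigenval_gt0.
Qed.

Lemma cspan_meanC F : cspan F -> exists t, has_meanC F t.
Proof.
elim=> [|z p q m {}F _ [t Ft]]; first by exists 0; exact: meanC_cst.
have [pq|] := posnP (p + q); last first.
  by move=> /(meanC_mcoef m) /(meanCZ z) /meanCD /(_ Ft); eexists; eassumption.
exists (z * (m == 0%N)%:R + t).
apply: eq_meanC (meanCD (meanC_cst (z * (m == 0%N)%:R)) Ft) _ => x.
by move/eqP: pq; rewrite addn_eq0 => /andP[/eqP-> /eqP->]; rewrite mcoef00.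
Qed.

Lemma mcoef_lderiv k p q m : exists2 G, lderiv k (mcoef p q m) G & cspan G /\ has_meanC G 0.
Proof.
have comb z w p' q' p2 q2 : (z != 0 -> (0 < p' + q')%N) -> (w != 0 -> (0 < p2 + q2)%N) ->
    let G := fun U => (z *: gpoly p' q' U + w *: gpoly p2 q2 U)`_m in cspan G /\ has_meanC G 0.
  move=> zP wP; rewrite /=; under eq_fun do rewrite coefD !coefZ.
  split; first by apply: cspanD; apply: cspanZ; exact: cspan_mcoef.
  rewrite -[X in has_meanC _ X]addr0; apply: meanCD.
    have [->|/zP /(meanC_mcoef m) /(meanCZ z)] := eqVneq z 0; last by rewrite mulr0.
    by apply: eq_meanC (meanC_cst 0) _ => x; rewrite mul0r.
  have [->|/wP /(meanC_mcoef m) /(meanCZ w)] := eqVneq w 0; last by rewrite mulr0.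
  by apply: eq_meanC (meanC_cst 0) _ => x; rewrite mul0r.
move: k; apply: ord3P.
- refine (ex_intro2 _ _ _ (lderiv1_gpoly R p q m) _).
  have := comb ('i * (p%:R - q%:R)) 0 p q 0%N 0%N; case=> [||s i].
  + by case: p => // ; case: q => //; rewrite subrr mulr0 eqxx.
  + by rewrite eqxx.
  by split; [move: s|move: i]; under eq_fun do rewrite scale0r addr0.
- refine (ex_intro2 _ _ _ (lderiv2_gpoly R p q m) _).
  by apply: comb; rewrite ?addnS ?addSn.
- refine (ex_intro2 _ _ _ (lderiv3_gpoly R p q m) _).
  by apply: comb; rewrite ?addnS ?addSn.
Qed.

(** A left-invariant field preserves the degree p + q of matrix coefficients
    and annihilates constants, so its values contain no constant term and have
    mean zero. *)
Lemma cspan_lderiv k F : cspan F -> exists2 G, lderiv k F G & cspan G /\ has_meanC G 0.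
Proof.
elim=> [|z p q m {}F _ [G XG [sG IG]]].
  by exists (fun=> 0); [exact: lderiv_cst|split; [exact: CSpan0|exact: meanC_cst]].
have [H XH [sH IH]] := mcoef_lderiv k p q m.
exists (fun U => z * H U + G U); first exact: lderivD (lderivZ z XH) XG.
split; first exact: cspanD (cspanZ z sH) sG.
by have := meanCD (meanCZ z IH) IG; rewrite mulr0 addr0.
Qed.

Lemma lderiv_unique k F G (H : SU -> C) : lderiv k F G -> lderiv k F H -> G = H.
Proof.
by move=> [_ _ E1] [_ _ E2]; apply/funext => p; rewrite -(param0 p) -E1 E2.
Qed.

Lemma LapC_unique F dF dF' : LapC F dF -> LapC F dF' -> dF = dF'.
Proof.
move=> [h1 h2] [h3 h4]; apply/funext => x; apply: eq_complexP.
  by have /(congr1 (@^~ x)) := Lap_unique h1 h3.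
by have /(congr1 (@^~ x)) := Lap_unique h2 h4.
Qed.

(** Green's formula: F X_k X_k G - G X_k X_k F is the X_k-derivative of F X_k
    G - G X_k F, which lies in the span, so its mean vanishes. *)
Lemma Lap_symmetric F G dF dG : cspan F -> cspan G -> LapC F dF -> LapC G dG ->
  has_meanC (fun x => F x * dG x - G x * dF x) 0.
Proof.
move=> sF sG LF LG.
have XX K : cspan K -> exists K1K2 : ('I_3 -> SU -> C) * ('I_3 -> SU -> C), forall k,
    [/\ lderiv k K (K1K2.1 k), lderiv k (K1K2.1 k) (K1K2.2 k) & cspan (K1K2.1 k)].
  move=> sK; have /choice[K12 KP] : forall k, exists K12 : (SU -> C) * (SU -> C),
      [/\ lderiv k K K12.1, lderiv k K12.1 K12.2 & cspan K12.1].
    move=> k; have [K1 X1 [s1 _]] := cspan_lderiv k sK; have [K2 X2 _] := cspan_lderiv k s1.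
    by exists (K1, K2).
  by exists (fun k => (K12 k).1, fun k => (K12 k).2) => k; exact: KP.
have [[F1 F2] FP] := XX _ sF; have [[G1 G2] GP] := XX _ sG.
have FX k : lderiv k F (F1 k) by case: (FP k). have FX2 k : lderiv k (F1 k) (F2 k) by case: (FP k).
have GX k : lderiv k G (G1 k) by case: (GP k). have GX2 k : lderiv k (G1 k) (G2 k) by case: (GP k).
have dFE := LapC_unique LF (lderiv_LapC a0 b0 b0 FX FX2).
have dGE := LapC_unique LG (lderiv_LapC a0 b0 b0 GX GX2).
have I0 k : has_meanC (fun x => - (wt a b b k)%:C * (F x * G2 k x - G x * F2 k x)) 0.
  rewrite -(mulr0 (- (wt a b b k)%:C)); apply: meanCZ.
  have sH : cspan (fun x => F x * G1 k x + -1 * (G x * F1 k x)).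
    by apply: cspanD; [|apply: cspanZ]; apply: cspanM => //; [case: (GP k)|case: (FP k)].
  have [H XH [_ IH]] := cspan_lderiv k sH.
  have XH' := lderivD (lderivM (FX k) (GX2 k)) (lderivZ (-1) (lderivM (GX k) (FX2 k))).
  apply: eq_meanC IH _ => x; rewrite (lderiv_unique XH XH'); ring.
have := meanC_sum I0; rewrite big1// => /eq_meanC; apply => x.
by rewrite dFE dGE !mulrN !mulr_sumr opprK addrC -sumrB; apply: eq_bigr => k _; ring.
Qed.

Lemma eq_Lap q q' dq dq' : Lap q dq -> q =1 q' -> dq =1 dq' -> Lap q' dq'.
Proof. by move=> Lq /funext <- /funext <-. Qed.

Lemma LapCD F dF G dG : LapC F dF -> LapC G dG -> LapC (fun x => F x + G x) (fun x => dF x + dG x).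
Proof.
move=> [F1 F2] [G1 G2]; split.
  by apply: eq_Lap (LapD a0 b0 b0 F1 G1) _ _ => x; rewrite raddfD.
by apply: eq_Lap (LapD a0 b0 b0 F2 G2) _ _ => x; rewrite raddfD.
Qed.

Lemma LapCZ z F dF : LapC F dF -> LapC (fun x => z * F x) (fun x => z * dF x).
Proof.
case: z => z1 z2 [F1 F2]; split.
  apply: eq_Lap (LapD a0 b0 b0 (LapZ a0 b0 b0 z1 F1) (LapZ a0 b0 b0 (- z2) F2)) _ _ => x.
    by case: (F x) => /= *; rewrite mulNr.
  by case: (dF x) => /= *; rewrite mulNr.
apply: eq_Lap (LapD a0 b0 b0 (LapZ a0 b0 b0 z1 F2) (LapZ a0 b0 b0 z2 F1)) _ _ => x.
  by case: (F x).
by case: (dF x).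
Qed.

(** On an eigenfunction of eigenvalue m the equation (Delta + s) G = F is
    solved by dividing by m + s. *)
Lemma cspan_resolvent (s : R) F : 0 < s -> cspan F ->
  exists2 G, cspan G & LapC G (fun x => F x - s%:C * G x).
Proof.
move=> s0; elim=> [|z p q m {}F _ [G sG LG]].
  exists (fun=> 0); first exact: CSpan0.
  rewrite (_ : (fun _ => _) = fun=> 0); last by apply/funext => x; rewrite mulr0 subr0.
  by split; exact: Lap0.
pose w := ((eigenval a b p q) + s)%:C.
have w0 : w != 0.
  by apply/eqP => /(congr1 Re) /= /eqP; rewrite gt_eqF// ltr_wpDl// eigenval_ge0.
exists (fun U => z / w * mcoef p q m U + G U); first exact: CSpanC.
have := LapCD (LapCZ (z / w) (LapC_mcoef p q m a0 b0)) LG.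
congr LapC; apply/funext => x.
have -> : (eigenval a b p q)%:C = w - s%:C by rewrite /w [(_ + s)%:C]rmorphD addrK.
by move: w0; move: w (mcoef _ _ _ _) => w g w0; field.
Qed.

Lemma real_resolvent (s : R) p : 0 < s -> cspan (fun x => (p x)%:C) ->
  exists2 q, cspan (fun x => (q x)%:C) & Lap q (fun x => p x - s * q x).
Proof.
move=> s0 sp; have [G sG [LG _]] := cspan_resolvent s0 sp.
exists (fun x => Re (G x)).
  have := cspanZ 2^-1 (cspanD sG (cspan_conj sG)); congr cspan; apply/funext => x.
  by case: (G x) => u v; simpc; apply: eq_complexP => /=; field.
move: LG; congr Lap; apply/funext => x.
by case: (G x) => u v /=; rewrite mul0r subr0.
Qed.

Lemma cspan_bounded F : cspan F -> exists2 B : R, 0 < B & forall x, `|Re (F x)| <= B /\ `|Im (F x)| <= B.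
Proof.
move=> sF; have [_ [cF _ _] _] := cspan_lderiv i0 sF.
have c1 : scont (fun x => Re (F x)).
  by apply: chart_scont => p; exact: ((chartable_smooth cF p).1 [::]).1.
have c2 : scont (fun x => Im (F x)).
  by apply: chart_scont => p; exact: ((chartable_smooth cF p).2 [::]).1.
have [B1 B10 H1] := scont_bounded c1; have [B2 B20 H2] := scont_bounded c2.
exists (B1 + B2) => [|x]; first exact: addr_gt0.
have := (H1 x, H2 x) => -[? ?]; split; lra.
Qed.

Lemma cspan_approx f (e : R) : scont f -> 0 < e ->
  exists2 p, cspan (fun x => (p x)%:C) & forall x, `|f x - p x| <= e.
Proof.
move=> cf e0; have [p qp pP] := scont_qapprox cf e0; exists p => //.
exact: cspan_qdot_poly.
Qed.

(** At a maximum of u its Laplacian is nonnegative, so u <= s u <= e there if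
    u is positive; the same bound for - u gives the lower one. *)
Lemma resolvent_bound (s e : R) u du : 1 <= s -> Lap u du ->
  (forall x, `|du x + s * u x| <= e) -> forall x, `|u x| <= e.
Proof.
move=> s1 Lu H.
have e0 : 0 <= e := le_trans (normr_ge0 _) (H (SU2_one R)).
have up v dv : Lap v dv -> (forall x, `|dv x + s * v x| <= e) -> forall x, v x <= e.
  move=> Lv Hv x; have [y ymax dy] := max_principle a0 b0 b0 Lv.
  apply: (le_trans (ymax x)).
  have := Hv y; rewrite ler_norml => /andP[_ h].
  have [v0|v0] := leP (v y) 0; first exact: le_trans e0.
  nra.
move=> x; rewrite ler_norml (up _ _ Lu H) andbT lerNl.
have := up _ _ (LapZ a0 b0 b0 (-1) Lu) _ x; rewrite mulN1r; apply => y.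
by rewrite -normrN; have := H y; congr (`|_| <= _); ring.
Qed.

(** f is only known to be smooth, so Green's formula is applied to polynomials
    near it. If r approximates f, the solution t of (Delta + s) t = r
    approximates f / (s + l), by the maximum principle. Green's formula for t
    and the matrix coefficient g of eigenvalue mu says that g (r - (s + mu) t)
    has mean zero, and this function approximates (l - mu)/(s + l) f g. *)
Lemma eigenval_orthogonal l f p q m : Lap f (fun x => l * f x) -> eigenval a b p q != l ->
  has_meanC (fun x => (f x)%:C * mcoef p q m x) 0.
Proof.
move=> Lf ml; set mu := eigenval a b p q in ml.
pose s := 1 + `|l|.
have s1 : 1 <= s by rewrite lerDl.
have sl : 0 < s + l by have := ler_norm (- l); rewrite normrN /s; lra.
have s0 : 0 < s by lra.
pose kap := (l - mu) / (s + l).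
have kap0 : kap != 0 by rewrite mulf_neq0 ?invr_eq0 ?(gt_eqF sl)// subr_eq0 eq_sym.
have [B B0 gB] := cspan_bounded (cspan_mcoef R p q m).
have mu0 : 0 <= mu by exact: eigenval_ge0.
have approx (e : R) : 0 < e -> exists2 h : SU -> R,
    has_meanC (fun x => (h x)%:C * mcoef p q m x) 0 & forall x, `|kap * f x - h x| <= e.
  move=> e0; pose d := e / (1 + s + mu).
  have d0 : 0 < d by rewrite divr_gt0//; lra.
  have [r sr fr] := cspan_approx (Lap_scont Lf) d0.
  have [t st Lt] := real_resolvent s0 sr.
  exists (fun x => r x - (s + mu) * t x).
    have LtC : LapC (fun x => (t x)%:C) (fun x => (r x - s * t x)%:C) by split; [exact: Lt|exact: Lap0].
    have := Lap_symmetric (cspan_mcoef R p q m) st (LapC_mcoef p q m a0 b0) LtC.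
    move=> /eq_meanC; apply => x; rewrite -/mu !(rmorphB, rmorphM, rmorphD) /=; ring.
  have tE x : `|t x + (- (s + l)^-1) * f x| <= d.
    move: x; apply: (resolvent_bound s1 (LapD a0 b0 b0 Lt (LapZ a0 b0 b0 (- (s + l)^-1) Lf))) => x.
    have -> : r x - s * t x + - (s + l)^-1 * (l * f x) + s * (t x + - (s + l)^-1 * f x) =
        r x - f x by field; rewrite gt_eqF.
    by rewrite distrC.
  move=> x.
  have -> : kap * f x - (r x - (s + mu) * t x) =
      (f x - r x) + (s + mu) * (t x + - (s + l)^-1 * f x).
    by rewrite /kap; field; rewrite gt_eqF.
  have -> : e = d + (s + mu) * d by rewrite /d; field; rewrite gt_eqF//; lra.
  rewrite (le_trans (ler_normD _ _))// lerD// normrM gtr0_norm; last lra.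
  by rewrite ler_pM2l//; lra.
have scale (g : SU -> R) : (forall x, `|g x| <= B) ->
    (forall h : SU -> R, has_meanC (fun x => (h x)%:C * mcoef p q m x) 0 -> has_mean (fun x => h x * g x) 0) ->
    has_mean (fun x => f x * g x) 0.
  move=> gb gP; suff : has_mean (fun x => kap * f x * g x) 0.
    move=> /(meanZ a0 b0 b0 kap^-1); rewrite mulr0 => /eq_mean; apply => x.
    by rewrite mulrA mulrA mulVf// mul1r.
  apply: (mean_approx0 (a := a) (b := b) (c := b)) => e e0.
  have [h Ih hE] := approx _ (divr_gt0 e0 B0).
  exists (fun x => h x * g x); first exact: gP.
  move=> x; rewrite -mulrBl normrM -[leRHS](divfK (lt0r_neq0 B0)).
  exact: ler_pM.
split; rewrite /=.
  have := scale (fun x => Re (mcoef p q m x)) (fun x => (gB x).1).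
  move=> H; apply: eq_mean (H _) _ => [h [Ih _]|x].
    by apply: eq_mean Ih _ => x; case: (mcoef p q m x) => u v /=; rewrite mul0r subr0.
  by case: (mcoef p q m x) => u v /=; rewrite mul0r subr0.
have := scale (fun x => Im (mcoef p q m x)) (fun x => (gB x).2).
move=> H; apply: eq_mean (H _) _ => [h [_ Ih]|x].
  by apply: eq_mean Ih _ => x; case: (mcoef p q m x) => u v /=; rewrite mul0r addr0.
by case: (mcoef p q m x) => u v /=; rewrite mul0r addr0.
Qed.

End orthogonality.

(** * Upper bound on multiplicities *)

Section upper_bound.
Variable R : realType.
Local Notation C := R[i].
Local Notation SU := (SU2 R).
Local Notation Re := (@complex.Re R).
Local Notation Im := (@complex.Im R).

Lemma scontD (f g : SU -> R) : scont f -> scont g -> scont (fun x => f x + g x).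
Proof.
move=> cf cg y e e0; have e2 : 0 < e / 2 by rewrite divr_gt0.
have [r r0 rP] := cf y _ e2; have [t t0 tP] := cg y _ e2.
exists (Num.min r t) => [|x]; first by rewrite lt_min r0.
rewrite lt_min => /andP[/rP h1 /tP h2].
rewrite opprD addrACA (le_lt_trans (ler_normD _ _))// [ltRHS](splitr e); exact: ltrD.
Qed.

Lemma scontM (f g : SU -> R) : scont f -> scont g -> scont (fun x => f x * g x).
Proof.
move=> cf cg y e e0; have [B B0 fB] := scont_bounded cf; have [D D0 gD] := scont_bounded cg.
have [r r0 rP] := cf y _ (divr_gt0 (divr_gt0 e0 (ltr0Sn _ 1)) D0).
have [t t0 tP] := cg y _ (divr_gt0 (divr_gt0 e0 (ltr0Sn _ 1)) B0).
exists (Num.min r t) => [|x]; first by rewrite lt_min r0.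
rewrite lt_min => /andP[/rP h1 /tP h2].
have -> : f x * g x - f y * g y = f x * (g x - g y) + (f x - f y) * g y by ring.
rewrite (le_lt_trans (ler_normD _ _))// [ltRHS](splitr e) !normrM ltrD//.
  apply: (@le_lt_trans _ _ (B * `|g x - g y|)); first by rewrite ler_wpM2r.
  by rewrite mulrC -ltr_pdivlMr.
apply: (@le_lt_trans _ _ (`|f x - f y| * D)); first by rewrite ler_wpM2l.
by rewrite -ltr_pdivlMr.
Qed.

Lemma SU2_neg1P : SU2_pred (- 1%:M : 'M[C]_2).
Proof.
rewrite /SU2_pred -scaleN1r detZ det1 mulr1 sqrrN expr1n eqxx andbT.
apply/unitarymxP/matrixP; apply: ord2P; apply: ord2P;
  rewrite !mxE sum2 !mxE /=; simpc; apply: eq_complexP => /=; ring.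
Qed.
Definition SU2_neg1 : SU := MkSU2 SU2_neg1P.

Lemma gpoly_neg p q (U : SU) : gpoly p q (SU2_mul SU2_neg1 U) = (-1) ^+ (p + q) * gpoly p q U.
Proof.
have E t : colpoly t (SU2_mul SU2_neg1 U) = - colpoly t U.
  by rewrite /colpoly /= mulNmx mul1mx !mxE scaleNr polyCN opprD.
by rewrite /gpoly !E (exprNn (colpoly 0 U)) (exprNn (colpoly 1 U)) mulrACA -exprD.
Qed.

Lemma mcoef_neg p q m (U : SU) : mcoef p q m (SU2_mul SU2_neg1 U) = (-1) ^+ (p + q) * mcoef p q m U.
Proof.
rewrite /mcoef gpoly_neg -[(-1) ^+ _ in LHS]signr_odd -[(-1) ^+ _ in RHS]signr_odd.
by case: (odd _); rewrite ?expr0 ?expr1 ?mul1r ?mulN1r ?coefN.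
Qed.

Lemma size_gpoly p q (U : SU) : (size (gpoly p q U) <= (p + q).+1)%N.
Proof.
have sc t : (size (colpoly t U) <= 2)%N.
  rewrite (leq_trans (size_polyD _ _))// geq_max (leq_trans (size_scale_leq _ _)) ?size_polyX//.
  by rewrite (leq_trans (size_polyC_leq1 _)).
have se t n : (size (colpoly t U ^+ n) <= n.+1)%N.
  rewrite (leq_trans (size_poly_exp_leq _ _))// ltnS.
  by rewrite -[leqRHS]mul1n leq_mul2r; case: (size _) (sc t) => [|[|[|]]]; rewrite ?orbT.
rewrite (leq_trans (size_polyMleq _ _))// -addSn.
have := leq_add (se 0 p) (se 1 q); rewrite addnS; case: (size _ + size _)%N => // n.
Qed.

Lemma mcoef_large p q m (U : SU) : (p + q < m)%N -> mcoef p q m U = 0.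
Proof. by move=> h; rewrite /mcoef nth_default// (leq_trans (size_gpoly p q U)). Qed.

Variables a b : R.
Hypotheses (a0 : 0 < a) (b0 : 0 < b).
Local Notation Lap := (Lap a b b).
Local Notation has_mean := (has_mean a b b).
Local Notation has_meanC := (has_meanC a b).

Lemma mean_odd f t : has_mean f t -> (forall x, f (SU2_mul SU2_neg1 x) = - f x) -> t = 0.
Proof.
move=> If fo; have I1 := meanL a0 b0 b0 SU2_neg1 If.
have I2 : has_mean (fun x => f (SU2_mul SU2_neg1 x)) (- t).
  have := meanZ a0 b0 b0 (-1) If; rewrite mulN1r => /eq_mean; apply => x.
  by rewrite fo mulN1r.
have := mean_unique a0 b0 b0 I1 I2; lra.
Qed.

Lemma meanC_mul_exists f G : scont f -> cspan G -> exists t, has_meanC (fun x => (f x)%:C * G x) t.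
Proof.
move=> cf sG; have [B B0 GB] := cspan_bounded a0 b0 sG.
have prod (e : R) : 0 < e -> exists2 g, exists t, has_meanC (fun x => (g x)%:C * G x) t &
    forall x, `|f x - g x| <= e / B.
  move=> e0; have [g sg gE] := cspan_approx cf (divr_gt0 e0 B0).
  exists g => //; have [t It] := cspan_meanC a0 b0 (cspanM sg sG); by exists t.
have [t1 I1] : exists t, has_mean (fun x => Re ((f x)%:C * G x)) t.
  apply: (mean_lim a0 b0 b0) => e e0; have [g [t [It _]] gE] := prod _ e0.
  exists (fun x => Re ((g x)%:C * G x)); first by exists (Re t).
  move=> x; have := (GB x).1; case: (G x) => u v /= uB.
  rewrite !mul0r !subr0 -mulrBl normrM -[leRHS](divfK (lt0r_neq0 B0)).
  exact: ler_pM.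
have [t2 I2] : exists t, has_mean (fun x => Im ((f x)%:C * G x)) t.
  apply: (mean_lim a0 b0 b0) => e e0; have [g [t [_ It]] gE] := prod _ e0.
  exists (fun x => Im ((g x)%:C * G x)); first by exists (Im t).
  move=> x; have := (GB x).2; case: (G x) => u v /= uB.
  rewrite !mul0r !addr0 -mulrBl normrM -[leRHS](divfK (lt0r_neq0 B0)).
  exact: ler_pM.
by exists (t1 +i* t2).
Qed.

(** With more functions than matrix coefficients of eigenvalue l, some nonzero
    complex combination F of them is orthogonal to all of these coefficients,
    hence to all matrix coefficients (by orthogonality of eigenfunctions, by
    parity, or because the coefficient vanishes). By density F is orthogonal
    to itself, so it vanishes. The flag e restricts everything to even
    functions, those that descend to SO(3). *)
Lemma dim_le (e : bool) (l : R) (m N : nat) (v : 'I_m -> SU -> R) (idx : 'I_N -> nat * nat * nat) :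
  (forall i, Lap (v i) (fun x => l * v i x)) ->
  (e -> forall i x, v i (SU2_mul SU2_neg1 x) = v i x) ->
  (forall p q k, eigenval a b p q = l -> (k <= p + q)%N -> (e ==> ~~ odd (p + q)) ->
     exists j, idx j = (p, q, k)) ->
  (forall c : 'I_m -> R, (forall x, \sum_(i < m) c i * v i x = 0) -> forall i, c i = 0) ->
  (m <= N)%N.
Proof.
move=> Lv ev idxP indep; rewrite leqNgt; apply/negP => Nm.
pose f j x := let: (p, q, k) := idx j in mcoef p q k (x : SU).
have sf j : cspan (f j) by rewrite /f; case: (idx j) => [[p q] k]; exact: cspan_mcoef.
have cv i : scont (v i) := Lap_scont (Lv i).
have /choice[t tP] : forall ij : 'I_m * 'I_N, exists t, has_meanC (fun x => (v ij.1 x)%:C * f ij.2 x) t.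
  by move=> [i j]; exact: meanC_mul_exists.
pose M := \matrix_(i < m, j < N) t (i, j).
have [al al0 alM] : exists2 al : 'rV[C]_m, al != 0 & al *m M = 0.
  have : kermx M != 0.
    by rewrite -mxrank_eq0 mxrank_ker subn_eq0 -ltnNge (leq_ltn_trans (rank_leq_col M)).
  by move=> /rowV0Pn[al /sub_kermxP alM al0]; exists al.
(* al is in the left kernel of M, so F is orthogonal to every f j *)
pose F x : C := \sum_(i < m) al 0 i * (v i x)%:C.
have mul_F G x : F x * G x = \sum_(i < m) al 0 i * ((v i x)%:C * G x).
  by rewrite mulr_suml; apply: eq_bigr => i _; rewrite mulrA.
have F_mcoef p q k : has_meanC (fun x => F x * mcoef p q k x) 0.
  have sum0 (s : 'I_m -> C) : (forall i, has_meanC (fun x => (v i x)%:C * mcoef p q k x) (s i)) ->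
      has_meanC (fun x => F x * mcoef p q k x) (\sum_(i < m) al 0 i * s i).
    move=> H; apply: eq_meanC (meanC_sum a0 b0 (fun i => meanCZ a0 b0 (al 0 i) (H i))) _ => x.
    by rewrite mul_F.
  have [kpq|kpq] := leqP k (p + q); last first.
    by apply: eq_meanC (meanC_cst a0 b0 0) _ => x; rewrite mcoef_large// mulr0.
  have [el|nel] := eqVneq (eigenval a b p q) l; last first.
    have := sum0 (fun=> 0) (fun i => eigenval_orthogonal a0 b0 k (Lv i) nel).
    by rewrite big1// => i _; rewrite mulr0.
  case: (boolP (e ==> ~~ odd (p + q))) => [pe|]; last first.
    rewrite negb_imply negbK => /andP[/ev{}ev odd_pq].
    have := sum0 (fun=> 0); rewrite big1 => [|i _]; last by rewrite mulr0.
    apply => i; have [s [s1 s2]] := meanC_mul_exists (cv i) (cspan_mcoef R p q k).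
    have odd_prod x : (v i (SU2_mul SU2_neg1 x))%:C * mcoef p q k (SU2_mul SU2_neg1 x) =
        - ((v i x)%:C * mcoef p q k x).
      by rewrite ev mcoef_neg -signr_odd odd_pq expr1 mulN1r mulrN.
    have e1 := mean_odd s1; have e2 := mean_odd s2.
    rewrite -[0]/(0 +i* 0) -{1}e1 => [|x]; last by rewrite odd_prod raddfN.
    rewrite -{1}e2 => [|x]; last by rewrite odd_prod raddfN.
    by split.
  have [j jE] := idxP p q k el kpq pe.
  have := sum0 (fun i => t (i, j)).
  have -> : \sum_(i < m) al 0 i * t (i, j) = (al *m M) 0 j.
    by rewrite mxE; apply: eq_bigr => i _; rewrite mxE.
  rewrite alM mxE; apply => i; apply: eq_meanC (tP (i, j)) _ => x.
  by rewrite /f jE.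
have F_span G : cspan G -> has_meanC (fun x => F x * G x) 0.
  elim=> [|z p q k {}G _ IH].
    by apply: eq_meanC (meanC_cst a0 b0 0) _ => x; rewrite mulr0.
  have := meanCD a0 b0 (meanCZ a0 b0 z (F_mcoef p q k)) IH.
  by rewrite mulr0 addr0 => /eq_meanC; apply => x; rewrite mulrDr mulrCA.
pose u x := \sum_(i < m) Re (al 0 i) * v i x.
pose w x := \sum_(i < m) Im (al 0 i) * v i x.
have FE x : F x = u x +i* w x.
  apply: eq_complexP; rewrite /F raddf_sum; apply: eq_bigr => i _;
    by case: (al 0 i) => x1 x2 /=; rewrite mulr0 ?subr0 ?add0r.
have scont_sum (c : 'I_m -> R) : scont (fun x => \sum_(i < m) c i * v i x).
  have scont_cst z : scont (fun=> z : R) by move=> y e' e0'; exists 1 => // x; rewrite subrr normr0.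
  suff H r : scont (fun x => \sum_(i <- r) c i * v i x) by exact: H.
  elim: r => [|i r IH]; first by under eq_fun do rewrite big_nil; exact: scont_cst.
  under eq_fun do rewrite big_cons.
  exact: scontD (scontM (scont_cst (c i)) (cv i)) IH.
have cu : scont u by exact: scont_sum.
have cw : scont w by exact: scont_sum.
have I0 : has_mean (fun x => u x * u x + w x * w x) 0.
  apply: (mean_approx0 (a := a) (b := b) (c := b)) => e' e0'.
  have [B B0 uB] := scont_bounded cu; have [D D0 wD] := scont_bounded cw.
  have e1 : 0 < e' / 2 by rewrite divr_gt0.
  have [p sp pE] := cspan_approx cu (divr_gt0 e1 B0).
  have [q sq qE] := cspan_approx cw (divr_gt0 e1 D0).
  exists (fun x => u x * p x + w x * q x).
    have [I1 _] := F_span _ sp; have [_ I2] := F_span _ sq.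
    have := meanD a0 b0 b0 I1 I2; rewrite addr0 => /eq_mean; apply => x.
    by rewrite FE /= !mulr0 subr0 add0r.
  move=> x; have -> : u x * u x + w x * w x - (u x * p x + w x * q x) =
    (u x - p x) * u x + (w x - q x) * w x by ring.
  rewrite (le_trans (ler_normD _ _))// [leRHS](splitr e') !normrM.
  rewrite -{1}[e' / 2](divfK (lt0r_neq0 B0)) -[X in _ <= _ + X](divfK (lt0r_neq0 D0)).
  by rewrite lerD// ler_pM.
have uw0 x : u x * u x + w x * w x = 0.
  apply: (mean_faithful a0 b0 b0 _ _ I0).
    by apply: scontD; exact: scontM.
  by move=> y; rewrite -!expr2 addr_ge0 ?sqr_ge0.
have u0 x : u x = 0 by have := uw0 x; nra.
have w0 x : w x = 0 by have := uw0 x; nra.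
case/negP: al0; apply/eqP/rowP => i; rewrite mxE; apply: eq_complexP.
  by have := indep (fun i => Re (al 0 i)) u0 i.
by have := indep (fun i => Im (al 0 i)) w0 i.
Qed.

End upper_bound.

(** * Real families from complex ones *)

Section exchange.
Variables (R : realType) (T : Type).
Local Notation C := R[i].

Definition indepC N (F : 'I_N -> T -> C) : Prop :=
  forall c : 'I_N -> C, (forall x, \sum_(i < N) c i * F i x = 0) -> forall i, c i = 0.

Lemma dep_replaced N (G : 'I_N -> T -> C) k (A : T -> C) : indepC G ->
  ~ indepC (fun j => if j == k then A else G j) ->
  exists d : 'I_N -> C, forall x, A x = \sum_(j < N | j != k) d j * G j x.
Proof.
move=> iG dep; have [c [cr [i ci]]] : exists c : 'I_N -> C,
    (forall x, \sum_(j < N) c j * (if j == k then A else G j) x = 0) /\ exists i, c i != 0.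
  apply: contrapT => h; apply: dep => c cr i; apply/eqP/negPn/negP => ci.
  by apply: h; exists c; split=> //; exists i.
have split_k x : c k * A x + \sum_(j < N | j != k) c j * G j x = 0.
  rewrite -[RHS](cr x) [RHS](bigD1 k)//= eqxx; congr (_ + _).
  by apply: eq_bigr => j /negbTE ->.
have c0 : c k != 0.
  apply: contraNneq ci => c0; apply/eqP.
  pose c' j := if j == k then 0 else c j.
  have : forall x, \sum_(j < N) c' j * G j x = 0.
    move=> x; rewrite -[RHS](split_k x) c0 mul0r add0r [LHS](bigD1 k)//= /c' eqxx mul0r add0r.
    by apply: eq_bigr => j /negbTE ->.
  by move=> /iG/(_ i); rewrite /c'; case: eqP => [->|].
exists (fun j => - ((c k)^-1 * c j)) => x.
have /eqP := split_k x; rewrite addr_eq0 => /eqP e.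
rewrite -[LHS](mulKf c0) e mulrN mulr_sumr -sumrN; apply: eq_bigr => j _.
by rewrite mulrA mulNr.
Qed.

(** Replace the functions one at a time: if both the real and the imaginary
    part of F k were in the span of the others, so would be F k itself. *)
Lemma real_family N (F : 'I_N -> T -> C) : indepC F ->
  exists G : 'I_N -> T -> R,
    (forall i, G i = (fun x => complex.Re (F i x)) \/ G i = (fun x => complex.Im (F i x))) /\
    forall c : 'I_N -> R, (forall x, \sum_(i < N) c i * G i x = 0) -> forall i, c i = 0.
Proof.
move=> iF.
have step n : (n <= N)%N -> exists G : 'I_N -> T -> C, indepC G /\ forall i : 'I_N,
    if (i < n)%N then G i = (fun x => (complex.Re (F i x))%:C) \/ G i = (fun x => (complex.Im (F i x))%:C)
    else G i = F i.
  elim: n => [_|n IH nN]; first by exists F; split.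
  have [G [iG GP]] := IH (ltnW nN).
  pose k := Ordinal nN.
  have Gk x : G k x = (complex.Re (F k x))%:C + 'i * (complex.Im (F k x))%:C.
    have := GP k; rewrite /= ltnn => ->; exact: complexE.
  have [A [iA AP]] : exists A : T -> C, indepC (fun j => if j == k then A else G j) /\
      (A = (fun x => (complex.Re (F k x))%:C) \/ A = (fun x => (complex.Im (F k x))%:C)).
    apply: contrapT => h.
    have [d dE] : exists d : 'I_N -> C, forall x,
        (complex.Re (F k x))%:C = \sum_(j < N | j != k) d j * G j x.
      by apply: (dep_replaced iG) => iA; apply: h; eexists; split; [exact: iA|left].
    have [e eE] : exists d : 'I_N -> C, forall x,
        (complex.Im (F k x))%:C = \sum_(j < N | j != k) d j * G j x.
      by apply: (dep_replaced iG) => iA; apply: h; eexists; split; [exact: iA|right].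
    pose c j := if j == k then 1 else - (d j + 'i * e j).
    have /iG/(_ k)/eqP : forall x, \sum_(j < N) c j * G j x = 0.
      move=> x; rewrite (bigD1 k)//= /c eqxx mul1r Gk dE eE mulr_sumr -!big_split /=.
      rewrite big1// => j /negbTE ->; ring.
    by rewrite /c eqxx oner_eq0.
  exists (fun j => if j == k then A else G j); split=> // i.
  case: eqP => [->|/eqP ik]; first by rewrite /= ltnSn.
  have := GP i; rewrite ltnS [(i <= n)%N]leq_eqVlt.
  have -> : (i == n :> nat) = false by apply/negbTE; apply: contra ik => /eqP e; apply/eqP/val_inj.
  by [].
have [G [iG GP]] := step N (leqnn N).
exists (fun i x => complex.Re (G i x)); split=> [i|c cG i].
  have := GP i; rewrite ltn_ord => -[] ->; [left|right]; by apply/funext.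
have GR j x : G j x = (complex.Re (G j x))%:C.
  by have := GP j; rewrite ltn_ord => -[] ->.
suff : (c i)%:C = 0 by move=> /(congr1 (@complex.Re _)).
apply: (iG (fun i => (c i)%:C)) => x.
have := congr1 (fun z : R => z%:C) (cG x); rewrite rmorph_sum => h.
by rewrite -[RHS]h; apply: eq_bigr => j _; rewrite GR rmorphM.
Qed.

End exchange.

(** * Separating the eigenvectors of a diagonal operator *)

Section separation.
Variables (K : fieldType) (N : nat) (P : ('I_N -> K) -> Prop) (d : 'I_N -> K).
Hypothesis P0 : P (fun=> 0).
Hypothesis PD : forall c c', P c -> P c' -> P (fun j => c j + c' j).
Hypothesis PZ : forall z c, P c -> P (fun j => z * c j).
Hypothesis Pd : forall c, P c -> P (fun j => c j * d j).

Lemma mul_poly_stable c (h : {poly K}) : P c -> P (fun j => c j * h.[d j]).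
Proof.
move=> Pc; elim/poly_ind: h => [|h z IH].
  by under eq_fun do rewrite horner0 mulr0.
under eq_fun do rewrite hornerMXaddC mulrDr mulrA [_ * z]mulrC.
by apply: PD; [exact: Pd|exact: PZ].
Qed.

(** Relations stable under multiplication by the eigenvalues d are stable
    under multiplication by polynomials in d, in particular by an
    interpolation polynomial selecting one eigenvalue. *)
Lemma eigen_separation c x : P c -> P (fun j => if d j == x then c j else 0).
Proof.
move=> Pc; pose s := [seq y <- undup [seq d j | j : 'I_N] | y != x].
pose h : {poly K} := \prod_(y <- s) ('X - y%:P).
have hx : h.[x] != 0.
  by rewrite -[_ == 0]/(root h x) root_prod_XsubC mem_filter eqxx.
have hd j : d j != x -> h.[d j] = 0.
  move=> dx; apply/eqP; rewrite -[_ == 0]/(root h (d j)) root_prod_XsubC mem_filter dx.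
  by rewrite mem_undup map_f// mem_enum.
have := PZ h.[x]^-1 (mul_poly_stable h Pc); congr P; apply/funext => j.
by case: eqP => [->|/eqP/hd ->]; rewrite ?mulr0// mulrCA mulVf ?mulr1.
Qed.
End separation.

(** * Linear independence of the matrix coefficients *)

Section independence.
Variable R : realType.
Local Notation C := R[i].
Local Notation SU := (SU2 R).

Lemma lderiv_family k n (c : 'I_n -> C) (F F' : 'I_n -> SU -> C) :
  (forall j, lderiv k (F j) (F' j)) -> (forall x, \sum_(j < n) c j * F j x = 0) ->
  forall x, \sum_(j < n) c j * F' j x = 0.
Proof.
move=> XF F0 x.
have := lderiv_sum (fun j => lderivZ (c j) (XF j)).
rewrite (funext F0 : (fun x => _) = fun=> 0) => /lderiv_unique/(_ (lderiv_cst k 0)).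
by move=> /(congr1 (@^~ x)).
Qed.

(** The raising operator X_2 - i X_3 sends u^p v^(q+1) to 2(q+1) u^(p+1) v^q,
    so a relation between coefficients of u^p v^q can be moved to the highest
    weight vector u^(p+q). *)
Lemma mcoef_raise n (c : 'I_n -> C) (m : 'I_n -> nat) p q :
  (forall x, \sum_(j < n) c j * mcoef p q (m j) x = 0) ->
  forall x, \sum_(j < n) c j * mcoef (p + q) 0 (m j) x = 0.
Proof.
elim: q p => [|q IH] p H; first by rewrite addn0.
rewrite -addSnnS; apply: IH => x.
have h2 := lderiv_family (fun j => lderiv2_gpoly R p q.+1 (m j)) H x.
have h3 := lderiv_family (fun j => lderiv3_gpoly R p q.+1 (m j)) H x.
have n0 : 2 * q.+1%:R != 0 :> C by rewrite mulf_neq0 ?pnatr_eq0.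
apply: (mulfI n0); rewrite mulr0.
transitivity (0 - 'i * 0 : C); last by rewrite mulr0 subr0.
rewrite -[in X in X - _]h2 -[in X in _ - _ * X]h3 !mulr_sumr -sumrB.
apply: eq_bigr => j _; rewrite /mcoef !coefD !coefZ /=.
have ii : 'i * 'i = -1 :> C by rewrite -expr2 sqrCi.
transitivity (c j * (- p%:R * (gpoly p.-1 q.+2 x)`_(m j) + q.+1%:R * (gpoly p.+1 q x)`_(m j)) -
  ('i * 'i) * (c j * (p%:R * (gpoly p.-1 q.+2 x)`_(m j) + q.+1%:R * (gpoly p.+1 q x)`_(m j)))).
  by rewrite ii; ring.
ring.
Qed.

Lemma mcoef_row n m (x : SU) : mcoef n 0 m x = 'C(n, m)%:R * (x 0 0 ^+ m * x 1 0 ^+ (n - m)).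
Proof.
elim: n m => [|n IH] m.
  by rewrite mcoef00 bin0n; case: m => [|m]; rewrite ?mul0r// !expr0 !mulr1.
rewrite mcoefS0; case: m => [|m].
  by rewrite mulr0 add0r IH !bin0 !subn0 !expr0 !mul1r exprS.
rewrite !IH binS natrD subSS.
have [mn|nm] := ltnP m n; last first.
  rewrite (bin_small (_ : n < m.+1)%N) ?ltnS// exprS; ring.
by rewrite -(subnSK mn) !exprS; ring.
Qed.

Lemma poly0_inf (p : {poly C}) : (forall n : nat, p.[n%:R] = 0) -> p = 0.
Proof.
move=> h; apply/eqP/negPn/negP => p0.
have := max_poly_roots p0 (rs := [seq n%:R | n <- iota 0 (size p)]).
rewrite size_map size_iota ltnn => H; apply: notF; apply: H.
  by apply/allP => _ /mapP[n _ ->]; rewrite /root h.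
by rewrite map_inj_uniq ?iota_uniq// => n1 n2 /eqP; rewrite eqr_nat => /eqP.
Qed.

(** On the one-parameter family with U10 / U00 = t, the coefficients of u^K
    are, up to a common factor, the distinct powers t^(K - m) times nonzero
    binomials. *)
Lemma row_indep n K (c : 'I_n -> C) (m : 'I_n -> nat) : (forall j, (m j <= K)%N) ->
  (forall x, \sum_(j < n) c j * mcoef K 0 (m j) x = 0) ->
  forall i, \sum_(j < n | m j == m i) c j = 0.
Proof.
move=> mK H i.
pose P : {poly C} := \sum_(j < n) (c j * 'C(K, m j)%:R) *: 'X^(K - m j).
have P0 : P = 0.
  apply: poly0_inf => t.
  pose z : 'rV[R]_3 := \row_k (if k == i1 then - t%:R else 0).
  have zE : (z 0 i0 = 0) * (z 0 i1 = - t%:R) * (z 0 i2 = 0) by rewrite !mxE.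
  have := H (SU2_cap z); under eq_bigr do rewrite mcoef_row /= !cap_mxE /= !zE.
  have s0 : (scal z)%:C != 0.
    by apply/eqP => /(congr1 (@complex.Re R)) /= /eqP; rewrite gt_eqF// scal_gt0.
  rewrite !mulr0 !mulr1.
  have -> : (scal z * (-1 * - t%:R)) +i* 0 = (scal z)%:C * t%:R :> C.
    by rewrite mulN1r opprK -[t%:R in RHS](rmorph_nat (real_complex R)) -rmorphM.
  move=> E; apply: (mulfI (expf_neq0 K s0)); rewrite mulr0 -[RHS]E.
  rewrite horner_sum mulr_sumr; apply: eq_bigr => j _.
  rewrite hornerZ hornerXn exprMn -[in X in X * _ = _](subnKC (mK j)) exprD.
  rewrite -[(scal z +i* 0)]/((scal z)%:C); ring.
have := congr1 (fun p : {poly C} => p`_(K - m i)) P0.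
rewrite coef0 coef_sum (eq_bigr (fun j => if m j == m i then c j * 'C(K, m i)%:R else 0)); last first.
  move=> j _; rewrite coefZ coefXn eq_sym.
  have -> : (K - m j == K - m i)%N = (m j == m i).
    by apply/eqP/eqP => [e|->//]; rewrite -(subKn (mK j)) e subKn.
  by case: eqP => [->|]; rewrite ?mulr1 ?mulr0.
rewrite -big_mkcond -mulr_suml => /eqP; rewrite mulf_eq0 => /orP[/eqP//|].
by rewrite pnatr_eq0 -leqn0 leqNgt bin_gt0 mK.
Qed.

Lemma LapC_sum a b n (c : 'I_n -> C) (F dF : 'I_n -> SU -> C) : 0 < a -> 0 < b ->
  (forall j, LapC a b b (F j) (dF j)) ->
  LapC a b b (fun x => \sum_(j < n) c j * F j x) (fun x => \sum_(j < n) c j * dF j x).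
Proof.
move=> a0 b0; elim: n c F dF => [|n IH] c F dF H.
  under eq_fun do rewrite big_ord0.
  by under [X in LapC _ _ _ _ X]eq_fun do rewrite big_ord0; split; exact: Lap0.
under eq_fun do rewrite big_ord_recl.
under [X in LapC _ _ _ _ X]eq_fun do rewrite big_ord_recl.
by apply: LapCD => //; [exact: LapCZ|exact: IH].
Qed.

(** The round Laplacian has eigenvalue K (K + 2) with K = p + q and X_1 has
    eigenvalue i (p - q): their sum separates the pairs (p, q). Within one
    pair, the raising operator reduces to the highest weight vector. *)
Lemma mcoef_indep N (idx : 'I_N -> nat * nat * nat) : injective idx ->
  (forall j, let: (p, q, k) := idx j in (k <= p + q)%N) ->
  indepC (fun j => let: (p, q, k) := idx j in mcoef p q k : SU -> C).
Proof.
move=> idx_inj kpq.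
pose p_ j := (idx j).1.1; pose q_ j := (idx j).1.2; pose m_ j := (idx j).2.
pose f j : SU -> C := mcoef (p_ j) (q_ j) (m_ j).
have -> : (fun j => let: (p, q, k) := idx j in mcoef p q k : SU -> C) = f.
  by apply/funext => j; rewrite /f /p_ /q_ /m_; case: (idx j) => [[]].
pose P (c : 'I_N -> C) := forall x, \sum_(j < N) c j * f j x = 0.
pose lam j : R := eigenval 1 1 (p_ j) (q_ j).
pose d j : C := (lam j)%:C + 'i * ((p_ j)%:R - (q_ j)%:R).
have P0 : P (fun=> 0) by move=> x; rewrite big1// => j _; rewrite mul0r.
have PD c c' : P c -> P c' -> P (fun j => c j + c' j).
  by move=> h h' x; under eq_bigr do rewrite mulrDl; rewrite big_split /= h h' addr0.
have PZ z c : P c -> P (fun j => z * c j).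
  by move=> h x; under eq_bigr do rewrite -mulrA; rewrite -mulr_sumr h mulr0.
have Pd c : P c -> P (fun j => c j * d j).
  move=> Pc x; under eq_bigr do rewrite -mulrA mulrDl mulrDr.
  rewrite big_split /=.
  have := lderiv_family (fun j => lderiv1_gpoly R (p_ j) (q_ j) (m_ j)) Pc x.
  rewrite (eq_bigr (fun j => c j * ('i * ((p_ j)%:R - (q_ j)%:R) * f j x))); last first.
    by move=> j _; rewrite coefZ.
  move=> ->; rewrite addr0.
  have L := LapC_sum c ltr01 ltr01 (fun j => LapC_mcoef (p_ j) (q_ j) (m_ j) ltr01 ltr01).
  have L0 : LapC 1 1 1 (fun=> 0 : C) (fun=> 0 : C) by split; exact: Lap0.
  have e0 : (fun x : SU => \sum_(j < N) c j * mcoef (p_ j) (q_ j) (m_ j) x) = fun=> 0.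
    by apply/funext => y; exact: Pc.
  rewrite e0 in L.
  by have /(congr1 (@^~ x)) := LapC_unique L L0.
have d_inj i j : d i = d j -> p_ i = p_ j /\ q_ i = q_ j.
  have dE k : d k = lam k +i* ((p_ k)%:R - (q_ k)%:R).
    rewrite /d (complexE (lam k +i* _)) /=; congr (_ + 'i * _).
    by rewrite rmorphB !rmorph_nat.
  rewrite !dE => -[]; rewrite /lam /eigenval.
  have E (p q : nat) : 1 ^+ 2 * (p%:R - q%:R) ^+ 2 + 1 ^+ 2 * (4 * p%:R * q%:R + 2 * p%:R + 2 * q%:R) + 1 =
      ((p + q).+1 ^ 2)%:R :> R.
    have h : (p + q).+1%:R = p%:R + q%:R + 1 :> R by rewrite -natr1 natrD.
    rewrite natrX h; ring.
  move=> /(congr1 (fun z => z + 1)); rewrite !E => /eqP; rewrite eqr_nat eqn_exp2r// => /eqP [e1] e2.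
  have e3 : (p_ i + q_ j)%N = (p_ j + q_ i)%N.
    by apply/eqP; rewrite -(eqr_nat R) !natrD; apply/eqP; lra.
  by split; lia.
move=> c Pc i.
have := eigen_separation P0 PD PZ Pd (d i) Pc => sep.
have sep' : forall x, \sum_(j < N) (if d j == d i then c j else 0) * mcoef (p_ i) (q_ i) (m_ j) x = 0.
  move=> x; rewrite -[RHS](sep x); apply: eq_bigr => j _.
  by rewrite /f; case: eqP => [/d_inj[-> ->]//|]; rewrite !mul0r.
pose m' j := if d j == d i then m_ j else 0%N.
have mK j : (m' j <= p_ i + q_ i)%N.
  rewrite /m'; case: eqP => [/d_inj[<- <-]|//].
  by have := kpq j; rewrite /p_ /q_ /m_; case: (idx j) => [[]].
have H := mcoef_raise sep'.
have := @row_indep _ _ (fun j => if d j == d i then c j else 0) _ mK.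
move=> /(_ _ i) <-; last first.
  move=> x; rewrite -[RHS](H x); apply: eq_bigr => j _; rewrite /m'.
  by case: eqP => // _; rewrite !mul0r.
rewrite [RHS](bigD1 i)//= eqxx big1 ?addr0// => j /andP[mji ji].
case: eqP => // dij; case/negP: ji; apply/eqP/idx_inj.
move: mji; rewrite /m' dij !eqxx => /eqP; have [] := d_inj _ _ dij.
by rewrite /p_ /q_ /m_; case: (idx j) (idx i) => [[? ?] ?] [[? ?] ?] /= -> -> ->.
Qed.

End independence.

(** * Counting *)

Section multiplicities.
Variable R : realType.
Local Notation SU := (SU2 R).
Variables (a b : R) (e : bool) (l : R).
Hypotheses (a0 : 0 < a) (b0 : 0 < b).

Lemma eigenval_nu k j : (j <= k)%N -> eigenval a b (k - j) j = nu a b k j.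
Proof. by move=> jk; rewrite /eigenval /nu natrB//; ring. Qed.

(** nu k j is at least b^2 k, so only finitely many k contribute to a given
    eigenvalue. *)
Definition level_bound := (Num.bound (l / b ^+ 2)).+1.
Local Notation B := level_bound.

Lemma nu_bound k j : (j <= k)%N -> nu a b k j = l -> (k < B)%N.
Proof.
move=> jk nul; rewrite ltnS -(ler_nat R).
have [->//|k0] := posnP k.
have b2 : 0 < b ^+ 2 by rewrite exprn_gt0.
have kl : k%:R <= l / b ^+ 2.
  rewrite ler_pdivlMr// -nul -eigenval_nu// /eigenval natrB//.
  have : 0 <= j%:R :> R by []. have : j%:R <= k%:R :> R by rewrite ler_nat.
  have := sqr_ge0 (a * (k%:R - j%:R - j%:R)).
  rewrite exprMn; move: (k%:R : R) (j%:R : R) => x y h xy y0.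
  have : 0 <= 4 * (x - y) * y by rewrite !mulr_ge0// subr_ge0.
  nra.
apply: (le_trans kl); apply/ltW/archi_boundP.
exact: le_trans kl.
Qed.

(** Triples (k, j, m) with m the index of the coefficient of u^(k-j) v^j; the
    k + 1 values of m give the multiplicity k + 1. *)
Definition index_set : {set 'I_B * 'I_B * 'I_B} :=
  [set t : 'I_B * 'I_B * 'I_B | [&& (t.1.2 <= t.1.1)%N, (t.2 <= t.1.1)%N,
    nu a b t.1.1 t.1.2 == l & e ==> ~~ odd t.1.1]].

Definition multiplicity := #|index_set|.

Definition index_of (j : 'I_multiplicity) : nat * nat * nat :=
  let t := enum_val j in ((t.1.1 - t.1.2)%N, t.1.2 : nat, t.2 : nat).

Lemma index_inj : injective index_of.
Proof.
move=> i j; rewrite /index_of => -[].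
have := enum_valP i; have := enum_valP j; rewrite !inE => /and4P[h1 _ _ _] /and4P[h2 _ _ _].
move=> e1 e2 e3; apply: enum_val_inj.
move: h1 h2 e1 e2 e3; case: (enum_val i) (enum_val j) => [[x y] z] [[x' y'] z'] /= h1 h2 e1 e2 e3.
congr (_, _, _); apply: val_inj => //=; lia.
Qed.

Lemma index_complete p q k : eigenval a b p q = l -> (k <= p + q)%N -> e ==> ~~ odd (p + q) ->
  exists j, index_of j = (p, q, k).
Proof.
move=> el kpq pe.
have nul : nu a b (p + q) q = l by rewrite -eigenval_nu ?leq_addl// addnK.
have pqB := nu_bound (leq_addl p q) nul.
pose t : 'I_B * 'I_B * 'I_B := (Ordinal pqB, Ordinal (leq_ltn_trans (leq_addl p q) pqB),
  Ordinal (leq_ltn_trans kpq pqB)).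
have tA : t \in index_set by rewrite inE /= leq_addl kpq nul eqxx pe.
by exists (enum_rank_in tA t); rewrite /index_of enum_rankK_in//= addnK.
Qed.

Lemma indexP j : let: (p, q, k) := index_of j in
  [/\ (k <= p + q)%N, eigenval a b p q = l & e ==> ~~ odd (p + q)].
Proof.
have := enum_valP j; rewrite /index_of inE.
case: (enum_val j) => [[x y] z] /= /and4P[h1 h2 /eqP h3 h4].
by rewrite eigenval_nu// subnK.
Qed.

Lemma dim_ge : exists v : 'I_multiplicity -> SU -> R,
  [/\ forall i, Lap a b b (v i) (fun x => l * v i x),
      e -> forall i x, v i (SU2_mul (SU2_neg1 R) x) = v i x &
      forall c : 'I_multiplicity -> R, (forall x, \sum_(i < multiplicity) c i * v i x = 0) -> forall i, c i = 0].
Proof.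
have [|v [vE vI]] := real_family (@mcoef_indep R _ _ index_inj _).
  by move=> j; move: (indexP j); case: (index_of j) => [[p q] k]; case.
exists v; split=> // [i|ee i x].
- move: (vE i) (indexP i); cbv beta; case: (index_of i) => [[p q] k] vi; case=> _ el _.
  have [L1 L2] := LapC_mcoef p q k a0 b0.
  by case: vi => ->; [move: L1|move: L2]; rewrite el; congr Lap; apply/funext => x;
    case: (mcoef p q k x) => y z /=; rewrite mul0r ?subr0 ?addr0.
- move: (vE i) (indexP i); cbv beta; case: (index_of i) => [[p q] k] vi; case=> _ _.
  rewrite ee /= => /negbTE od.
  have E : mcoef p q k (SU2_mul (SU2_neg1 R) x) = mcoef p q k x.
    by rewrite mcoef_neg -signr_odd od expr0 mul1r.
  by case: vi => ->; rewrite E.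
Qed.

Lemma multiplicity_le m (v : 'I_m -> SU -> R) :
  (forall i, Lap a b b (v i) (fun x => l * v i x)) ->
  (e -> forall i x, v i (SU2_mul (SU2_neg1 R) x) = v i x) ->
  (forall c : 'I_m -> R, (forall x, \sum_(i < m) c i * v i x = 0) -> forall i, c i = 0) ->
  (m <= multiplicity)%N.
Proof. by move=> Lv ev; apply: (dim_le a0 b0 Lv ev index_complete). Qed.

Lemma multiplicity_sum : multiplicity = (\sum_(k < B | e ==> ~~ odd k) \sum_(j < k.+1 | nu a b k j == l) k.+1)%N.
Proof.
rewrite /multiplicity -sum1_card big_mkcond /= [RHS]big_mkcond.
pose F (kj : 'I_B * 'I_B) (m : 'I_B) := (if (kj, m) \in index_set then 1 else 0)%N.
transitivity (\sum_(t : 'I_B * 'I_B * 'I_B) F t.1 t.2)%N.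
  by apply: eq_bigr => -[t1 t2] _.
rewrite -(pair_bigA _ F) /=.
transitivity (\sum_(t : 'I_B * 'I_B) \sum_(m < B) F (t.1, t.2) m)%N.
  by apply: eq_bigr => -[t1 t2] _.
rewrite -(pair_bigA _ (fun k j => \sum_(m < B) F (k, j) m)%N) /=.
apply: eq_bigr => k _; rewrite /F.
have [pk|/negbTE npk] := boolP (e ==> ~~ odd k); last first.
  by rewrite big1// => j _; rewrite big1// => m _; rewrite inE /= npk !andbF.
rewrite (big_ord_widen_cond B (fun j => nu a b k j == l) (fun=> k.+1)); last exact: ltn_ord.
rewrite [RHS]big_mkcond; apply: eq_bigr => j _.
have [/andP[nuj jk]|/negbTE nj] := boolP ((nu a b k j == l) && (j < k.+1)%N); last first.
  rewrite big1// => m _; rewrite inE /= pk andbT; move: nj; rewrite ltnS => nj.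
  by case: (j <= k)%N nj => //=; case: (_ == l) => //=; rewrite andbF.
rewrite (eq_bigr (fun m : 'I_B => if (m < k.+1)%N then 1 else 0)%N); last first.
  by move=> m _; rewrite inE /= pk nuj -ltnS jk ltnS !andbT.
by rewrite -big_mkcond -(big_ord_widen B (fun=> 1%N)) ?ltn_ord// sum1_card card_ord.
Qed.

Lemma esum_lt (P : set nat) (F : nat -> \bar R) n : (forall k, (0 <= F k)%E) ->
  (forall k, (n <= k)%N -> P k -> F k = 0%E) ->
  (\esum_(k in P) F k = \sum_(k < n) if (k : nat) \in P then F k else 0)%E.
Proof.
move=> F0 Fn.
transitivity (\esum_(k in P `&` `I_n) F k)%E.
  rewrite esum_mkcondr; apply: eq_esum => k Pk.
  by case: (boolP (k \in `I_n)) => //; rewrite notin_setE /= => /negP; rewrite -leqNgt => /Fn ->.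
rewrite esum_mkcondl esum_fset//; last by move=> k _; case: ifP.
by rewrite -fsbig_ord.
Qed.

Lemma munion_multiplicity : munion [set k : nat | e ==> ~~ odd k] (fun k : nat =>
      munion [set j : nat | (j <= k)%N] (fun j : nat => mrepeat k.+1 (nu a b k j))) l =
  (multiplicity%:R)%:E.
Proof.
have inner k : munion [set j : nat | (j <= k)%N] (fun j : nat => mrepeat k.+1 (nu a b k j)) l =
    ((\sum_(j < k.+1 | nu a b k j == l) k.+1)%N%:R)%:E.
  rewrite /munion (@esum_lt _ _ k.+1); first last.
  - by move=> j kj /=; rewrite leqNgt kj.
  - by move=> j; rewrite /mrepeat; case: ifP => // _; rewrite lee_fin.
  rewrite natr_sum -sumEFin [RHS]big_mkcond; apply: eq_bigr => j _.
  rewrite mem_set; last by rewrite /= -ltnS.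
  by rewrite /mrepeat eq_sym; case: ifP.
transitivity (\esum_(k in [set k : nat | e ==> ~~ odd k])
    ((\sum_(j < k.+1 | nu a b k j == l) k.+1)%N%:R : R)%:E)%E.
  by apply: eq_esum => k _; exact: inner.
rewrite (@esum_lt _ _ B); first last.
- move=> k Bk _; rewrite big1// => j /eqP nul.
  have jk : (j <= k)%N by rewrite -ltnS.
  by have := nu_bound jk nul; rewrite ltnNge Bk.
- by move=> k; rewrite lee_fin.
rewrite multiplicity_sum natr_sum -sumEFin [RHS]big_mkcond; apply: eq_bigr => k _.
case: (boolP (e ==> _)) => pk; first by rewrite mem_set.
by rewrite memNset//=; exact/negP.
Qed.

End multiplicities.

(** * The two spectra *)

Section spectra.
Variable R : realType.
Variables (a b : R).
Hypotheses (a0 : 0 < a) (b0 : 0 < b).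

Lemma dim_funE (M : riemannian_atlas R 3) (E : set (M -> R)) N :
  (forall m (v : 'I_m -> M -> R), (forall i, E (v i)) -> lin_indep v -> (m <= N)%N) ->
  (exists v : 'I_N -> M -> R, (forall i, E (v i)) /\ lin_indep v) ->
  dim_fun E = (N%:R)%:E.
Proof.
move=> up [v [Ev vI]]; apply/eqP; rewrite eq_le; apply/andP; split.
  by apply: ge_ereal_sup => _ [m [w [Ew wI ->]]]; rewrite lee_fin ler_nat; exact: up wI.
by apply: ereal_sup_ubound; exists N, v.
Qed.

Lemma Spec_SU2 l : Spec (SU2_metric a b b) l = ((multiplicity a b false l)%:R)%:E.
Proof.
apply: dim_funE => [m v Ev vI|].
  by apply: (multiplicity_le a0 b0 (v := v)).
by have [v [Lv _ vI]] := dim_ge false l a0 b0; exists v.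
Qed.

Lemma SO3_surj (x : SO3 R) : exists U : SU2 R, x = (\pi_(SO3 R) U)%qT.
Proof. by exists (repr x); rewrite reprK. Qed.

Lemma SO3_pi_neg (U : SU2 R) : (\pi_(SO3 R) (SU2_mul (SU2_neg1 R) U) = \pi_(SO3 R) U)%qT.
Proof. by apply/eqmodP; rewrite /= /pm_eq /= mulNmx mul1mx eqxx orbT. Qed.

(** Functions on SO(3) are the even functions on SU(2). *)
Lemma repr_pi_even (f : SU2 R -> R) (U : SU2 R) : (forall x, f (SU2_mul (SU2_neg1 R) x) = f x) ->
  f (repr (\pi_(SO3 R) U)%qT) = f U.
Proof.
move=> fe; have /eqmodP : (\pi_(SO3 R) (repr (\pi_(SO3 R) U)) = \pi_(SO3 R) U)%qT by rewrite reprK.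
rewrite /= /pm_eq => /orP[/eqP/val_inj -> //|/eqP E].
rewrite -[RHS]fe; congr f; apply: val_inj; by rewrite /= mulNmx mul1mx.
Qed.

Lemma Spec_SO3 l : Spec (SO3_metric a b b) l = ((multiplicity a b true l)%:R)%:E.
Proof.
apply: dim_funE => [m v Ev vI|].
  apply: (multiplicity_le a0 b0 (v := fun i U => v i (\pi_(SO3 R) U)%qT)) => [i|_ i x|c cv].
  - by have [sv lv] := Ev i; split.
  - by rewrite SO3_pi_neg.
  - by apply: vI => x; have [U ->] := SO3_surj x; exact: cv.
have [v [Lv ev vI]] := dim_ge true l a0 b0.
have vE i U : v i (repr (\pi_(SO3 R) U)%qT) = v i U by apply: repr_pi_even => x; exact: ev.
exists (fun i x => v i (repr x)); split=> [i|c cv].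
  have [sv lv] := Lv i.
  have E p : (fun x : SO3 R => v i (repr x)) \o SO3_param p = v i \o SU2_param p.
    by apply/funext => x /=; exact: vE.
  split=> [p|p x] /=.
    by rewrite /= E; exact: sv.
  by rewrite /= E [LHS]/=; rewrite vE; exact: (lv p x).
by apply: vI => U; rewrite -[RHS](cv (\pi_(SO3 R) U)%qT); apply: eq_bigr => i _; rewrite vE.
Qed.

End spectra.

Theorem proposition3p9 (R : realType) (a b : R) (ha : 0 < a) (hb : 0 < b) :
  Spec (SU2_metric a b b) =
    munion [set: nat] (fun k : nat =>
      munion [set j : nat | (j <= k)%N] (fun j : nat =>
        mrepeat k.+1 (nu a b k j))) /\
  Spec (SO3_metric a b b) =
    munion [set k : nat | ~~ odd k] (fun k : nat =>
      munion [set j : nat | (j <= k)%N] (fun j : nat =>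
        mrepeat k.+1 (nu a b k j))).
Proof.
split; apply/funext => l.
  rewrite Spec_SU2// -munion_multiplicity//.
  by rewrite (_ : [set k : nat | _] = [set: nat]); last by apply/seteqP; split.
by rewrite Spec_SO3// -munion_multiplicity.
Qed.
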